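(* Let $D$ be a dialgebra over $K$ with $\dim_K HY^2(D,D)<\infty$. Then the formal deformation $\eta$ of $D$ with base $C=\varprojlim_k C_k$, obtained as the projective limit of the inductively constructed deformations $\eta_k$ with bases $C_k$ described in the context, is a miniversal deformation of $D$.
   Context: $K$ is a field of characteristic zero; tensor products are over $K$ unless indicated; $'$ denotes the $K$-linear dual. Dialgebra: a $K$-vector space $D$ with two $K$-bilinear products $\dashv,\vdash$ such that for all $x,y,z$: $x\dashv(y\dashv z)=(x\dashv y)\dashv z=x\dashv(y\vdash z)$; $(x\vdash y)\dashv z=x\vdash(y\dashv z)$; $(x\dashv y)\vdash z=x\vdash(y\vdash z)=(x\vdash y)\vdash z$. Trees: $Y_n$ is the set of planar binary rooted trees with $n$ trivalent vertices and $n+1$ leaves labelled $0,\dots,n$ from left to right; $Y_0=\{|\}$, and $|$ is denoted $[0]$; $[1]$ is the unique element of $Y_1$. The grafting $y_1\vee y_2$ of a $p$-tree and a $q$-tree joins their roots to a new root; it is denoted $[y_1\; p{+}q{+}1\; y_2]$ with zeros deleted. Thus $Y_2=\{[12]=[1]\vee|,\ [21]=|\vee[1]\}$ and $Y_3=\{[123]=[12]\vee|,\ [213]=[21]\vee|,\ [131]=[1]\vee[1],\ [312]=|\vee[12],\ [321]=|\vee[21]\}$. The face map $d_i:Y_n\to Y_{n-1}$ deletes the $i$-th leaf. Cohomology: $CY^n(D,D)=\mathrm{Hom}_K(K[Y_n]\otimes D^{\otimes n},D)$, with coboundary $\delta=\sum_{i=0}^{n+1}(-1)^i\delta^i$, where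 for $y\in Y_{n+1}$: $(\delta^0f)(y;a_1,\dots,a_{n+1})=a_1\circ_0^y f(d_0y;a_2,\dots,a_{n+1})$; $(\delta^if)(y;a_1,\dots,a_{n+1})=f(d_iy;a_1,\dots,a_i\circ_i^ya_{i+1},\dots,a_{n+1})$ for $1\le i\le n$; $(\delta^{n+1}f)(y;a_1,\dots,a_{n+1})=f(d_{n+1}y;a_1,\dots,a_n)\circ_{n+1}^ya_{n+1}$. Here $\circ_0^y=\dashv$ if $y=|\vee y_1$ for some $y_1$, and $\vdash$ otherwise; for $1\le i\le n$, $\circ_i^y=\dashv$ if the $i$-th leaf is oriented like $\backslash$ and $\vdash$ if it is oriented like $/$; $\circ_{n+1}^y=\vdash$ if $y=y_1\vee|$ for some $y_1$, and $\dashv$ otherwise. $HY^n(D,D)$ is the resulting cohomology. Deformations: let $A$ be a commutative unital $K$-algebra with augmentation $\epsilon:A\to K$, $\epsilon(1)=1$, $\mathsf m=\ker\epsilon$, and assume $\dim(\mathsf m^k/\mathsf m^{k+1})<\infty$ for all $k\ge1$. A deformation $\lambda$ of $D$ with base $A$ is a dialgebra structure on $A\otimes D$ with $A$-bilinear products $\dashv_\lambda,\vdash_\lambda$ such that $\epsilon\otimes\mathrm{id}:A\otimes D\to D$ is a dialgebra morphism. If $A$ is a complete local algebra, $A=\varprojlim_n A/\mathsf m^n$ with maximal ideal $\mathsf m$, a formal deformation of $D$ with base $A$ is an $A$-dialgebra structure (with $A$-bilinear products) on $A\widehat\otimes D=\varprojlim_n((A/\mathsf m^n)\otimes D)$ such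 that $\epsilon\widehat\otimes\mathrm{id}:A\widehat\otimes D\to D$ is a dialgebra morphism. Two (formal) deformations with the same base $A$ are equivalent if there is an $A$-linear dialgebra isomorphism between them compatible with $\epsilon\otimes\mathrm{id}$ (resp. $\epsilon\widehat\otimes\mathrm{id}$). Homomorphisms $\phi:A\to A'$ of bases are unital algebra homomorphisms with $\epsilon'\circ\phi=\epsilon$. The push-out $\phi_*\lambda$ is the deformation with base $A'$ on $A'\otimes D=A'\otimes_A(A\otimes D)$ given by $(a_1'\otimes_A l_1)*_{\phi_*\lambda}(a_2'\otimes_A l_2)=a_1'a_2'\otimes_A(l_1*_\lambda l_2)$, $*\in\{\dashv,\vdash\}$; similarly for formal deformations (with completed tensor products). Miniversal: a formal deformation $\eta$ of $D$ with base $B$ is miniversal if (1) for any formal deformation $\lambda$ of $D$ with any local base $A$ there exists a homomorphism $f:B\to A$ such that $\lambda$ is equivalent to $f_*\eta$; and (2) with the same notation, if the maximal ideal $\mathsf m$ of $A$ satisfies $\mathsf m^2=0$, then $f$ is unique. Harrison cohomology and extensions: for a finite dimensional commutative local algebra $A$ with augmentation $\epsilon$, and a finite dimensional vector space $M$ viewed as an $A$-module via $\epsilon$, $H^2_{Harr}(A;M)$ is the space of symmetric bilinear 2-cocycles $f:A\times A\to M$ modulo coboundaries; $Ch_2(A)$ denotes the degree-2 part of the Harrison complex of $A$, so Harrison 2-cochains with values in $M$ are the linear maps $Ch_2(A)\to M$. Cohomology classes correspond to isomorphism classes of extensions $0\to M\xrightarrow{i}B\xrightarrow{p}A\to0$ of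 commutative algebras; a cocycle $f$ gives $B=A\oplus M$ with $(a,x)(b,y)=(ab,\epsilon(a)y+\epsilon(b)x+f(a,b))$. $B$ is again local and unital with augmentation $\widehat\epsilon=\epsilon\circ p$. Obstruction: given a deformation $\lambda$ with base $A$ and such an extension, put $I=i\otimes\mathrm{id}:M\otimes D\to B\otimes D$, $P=p\otimes\mathrm{id}:B\otimes D\to A\otimes D$, $E=\widehat\epsilon\otimes\mathrm{id}:B\otimes D\to D$. Choose $B$-bilinear operations $\{\,,\}_\dashv,\{\,,\}_\vdash$ on $B\otimes D$ with $P\{l_1,l_2\}_*=P(l_1)*_\lambda P(l_2)$ and $\{I(m\otimes l),l_1\}_*=I(m\otimes(l*E(l_1)))$ for $*\in\{\dashv,\vdash\}$, $m\in M$, $l\in D$, $l_1,l_2\in B\otimes D$. Define $\phi([321];l_1,l_2,l_3)=\{l_1,\{l_2,l_3\}_\dashv\}_\dashv-\{\{l_1,l_2\}_\dashv,l_3\}_\dashv$, $\phi([312];l_1,l_2,l_3)=\{l_1,\{l_2,l_3\}_\vdash\}_\dashv-\{\{l_1,l_2\}_\dashv,l_3\}_\dashv$, $\phi([131];l_1,l_2,l_3)=\{l_1,\{l_2,l_3\}_\dashv\}_\vdash-\{\{l_1,l_2\}_\vdash,l_3\}_\dashv$, $\phi([213];l_1,l_2,l_3)=\{l_1,\{l_2,l_3\}_\vdash\}_\vdash-\{\{l_1,l_2\}_\dashv,l_3\}_\vdash$, $\phi([123];l_1,l_2,l_3)=\{l_1,\{l_2,l_3\}_\vdash\}_\vdash-\{\{l_1,l_2\}_\vdash,l_3\}_\vdash$.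 These take values in $\ker P\cong M\otimes D$ and vanish when some $l_j\in\ker E$, so they induce a cocycle $\overline\phi\in M\otimes CY^3(D,D)$, whose class $\theta_\lambda([f])\in M\otimes HY^3(D,D)$ depends only on $\lambda$ and the class $[f]$ of the extension. Construction of $C_k,\eta_k$: $C_0=K$ and $C_1=K\oplus HY^2(D,D)'$ with $(HY^2(D,D)')^2=0$. $\eta_1$ is the following deformation with base $C_1$: choose a linear map $\mu_1:HY^2(D,D)\to CY^2(D,D)$ sending a class to a representing cocycle; on $C_1\otimes D=D\oplus\mathrm{Hom}(HY^2(D,D),D)$ put $(x_1,\phi_1)\dashv(x_2,\phi_2)=(x_1\dashv x_2,\psi_\ell)$, $(x_1,\phi_1)\vdash(x_2,\phi_2)=(x_1\vdash x_2,\psi_r)$ with $\psi_\ell(\alpha)=\mu_1(\alpha)([21];x_1,x_2)+\phi_1(\alpha)\dashv x_2+x_1\dashv\phi_2(\alpha)$ and $\psi_r(\alpha)=\mu_1(\alpha)([12];x_1,x_2)+\phi_1(\alpha)\vdash x_2+x_1\vdash\phi_2(\alpha)$. Given a finite dimensional local algebra $C_k$ ($k\ge1$) and a deformation $\eta_k$ of $D$ with base $C_k$, choose a linear map $\mu:H^2_{Harr}(C_k;K)\to(Ch_2(C_k))'$ sending a class to a representing cocycle. Its dual $f_{C_k}:Ch_2(C_k)\to H^2_{Harr}(C_k;K)'$ is a cocycle and gives an extension $0\to H^2_{Harr}(C_k;K)'\xrightarrow{\overline i_{k+1}}\overline C_{k+1}\xrightarrow{\overline p_{k+1}}C_k\to0$.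 The obstruction $\theta_{\eta_k}([f_{C_k}])\in H^2_{Harr}(C_k;K)'\otimes HY^3(D,D)$ corresponds to a linear map $\omega_k:H^2_{Harr}(C_k;K)\to HY^3(D,D)$ with dual $\omega_k':HY^3(D,D)'\to H^2_{Harr}(C_k;K)'$. Put $C_{k+1}=\overline C_{k+1}/\overline i_{k+1}\circ\omega_k'(HY^3(D,D)')$, giving an induced extension $0\to(\ker\omega_k)'\xrightarrow{i_{k+1}}C_{k+1}\xrightarrow{p_{k+1}}C_k\to0$. The deformation $\eta_k$ admits an extension to a deformation $\eta_{k+1}$ with base $C_{k+1}$, i.e. with $(p_{k+1})_*\eta_{k+1}=\eta_k$, unique up to an isomorphism and an automorphism of this extension; choose one. Then $C=\varprojlim_kC_k$ is a complete local algebra and the $\eta_k$ define, in the projective limit, a formal deformation $\eta$ of $D$ with base $C$. *)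

(* Defs.v *)
From HB Require Import structures.
From mathcomp Require Import all_boot all_algebra.
From mathcomp Require Import boolp functions.
From mathcomp Require Import freeg.

Set Implicit Arguments.
Unset Strict Implicit.
Unset Printing Implicit Defensive.

Import GRing.Theory.
Local Open Scope ring_scope.
Local Open Scope quotient_scope.

Section Subspace.
Variables (K : fieldType) (V : lmodType K).

Record subspace := Subspace {
  smem :> V -> Prop;
  smem0 : smem 0;
  smemP : forall (a : K) u v, smem u -> smem v -> smem (a *: u + v)
}.

Variable S : subspace.

Definition spred : {pred V} := fun x => `[< S x >].

Lemma spred_submod_closed : GRing.submod_closed spred.
Proof.
split; first exact/asboolP/smem0.
by move=> a u v /asboolP uS /asboolP vS; apply/asboolP/smemP.
Qed.

HB.instance Definition _ := GRing.isSubmodClosed.Build K V spred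
  (GRing.submod_closed_semi spred_submod_closed).

Record sub := Sub_ { sub_val : V; sub_valP : sub_val \in spred }.

HB.instance Definition _ := [isSub for sub_val].
HB.instance Definition _ := [Choice of sub by <:].
HB.instance Definition _ := [SubChoice_isSubLmodule of sub by <:].

Definition mksub (x : V) (Sx : S x) : sub := Sub_ (asboolT Sx).

Lemma smem_val (x : sub) : S (val x).
Proof. exact/asboolP/sub_valP. Qed.

Definition qrel : rel V := fun x y => x - y \in spred.

Lemma qrel_equiv : equiv_class_of qrel.
Proof.
split=> [x|x y|y x z]; rewrite /qrel.
- by rewrite subrr rpred0.
- by rewrite -opprB rpredN.
- by move=> xy yz; rewrite -[x](subrK y) -addrA rpredD.
Qed.

Canonical qrel_equivrel := EquivRelPack qrel_equiv.

Definition quot := {eq_quot qrel_equivrel}.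

HB.instance Definition _ := Choice.on quot.
HB.instance Definition _ := EqQuotient.on quot.

Definition qpi (x : V) : quot := \pi_quot x.
Definition qrepr (x : quot) : V := repr x.

Lemma qreprK : cancel qrepr qpi.
Proof. exact: reprK. Qed.

Lemma qpiP x y : reflect (qpi x = qpi y) (x - y \in spred).
Proof. exact: (iffP (@eqquotP _ _ quot x y)). Qed.

Lemma qpiE x : qrepr (qpi x) - x \in spred.
Proof. by apply/qpiP; rewrite qreprK. Qed.

Definition qadd (x y : quot) := qpi (qrepr x + qrepr y).
Definition qopp (x : quot) := qpi (- qrepr x).
Definition qscale (a : K) (x : quot) := qpi (a *: qrepr x).

Lemma qpiD x y : qpi (x + y) = qadd (qpi x) (qpi y).
Proof.
apply/qpiP; rewrite -rpredN opprB opprD addrACA.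
by rewrite rpredD // qpiE.
Qed.

Lemma qpiN x : qpi (- x) = qopp (qpi x).
Proof. by apply/qpiP; rewrite opprK addrC qpiE. Qed.

Lemma qpiZ a x : qpi (a *: x) = qscale a (qpi x).
Proof. by apply/qpiP; rewrite -rpredN opprB -scalerBr rpredZ // qpiE. Qed.

Lemma quotI (P : quot -> Prop) : (forall x, P (qpi x)) -> forall x, P x.
Proof. by move=> h x; rewrite -[x]qreprK. Qed.

Lemma qaddA : associative qadd.
Proof.
elim/quotI=> x; elim/quotI=> y; elim/quotI=> z.
by rewrite -!qpiD addrA.
Qed.
Lemma qaddC : commutative qadd.
Proof. by elim/quotI=> x; elim/quotI=> y; rewrite -!qpiD addrC. Qed.
Lemma qadd0 : left_id (qpi 0) qadd.
Proof. by elim/quotI=> x; rewrite -qpiD add0r. Qed.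
Lemma qaddN : left_inverse (qpi 0) qopp qadd.
Proof. by elim/quotI=> x; rewrite -qpiN -qpiD addNr. Qed.

HB.instance Definition _ := GRing.isZmodule.Build quot qaddA qaddC qadd0 qaddN.

Lemma qscaleA a b x : qscale a (qscale b x) = qscale (a * b) x.
Proof. by elim/quotI: x => x; rewrite -!qpiZ scalerA. Qed.
Lemma qscale1 : left_id 1 qscale.
Proof. by elim/quotI=> x; rewrite -qpiZ scale1r. Qed.
Lemma qscaleDr : right_distributive qscale +%R.
Proof.
move=> a; elim/quotI=> x; elim/quotI=> y.
by rewrite -[_ + _]qpiD -!qpiZ scalerDr qpiD.
Qed.
Lemma qscaleDl x : {morph qscale^~ x : a b / a + b}.
Proof. by move=> a b; elim/quotI: x => x; rewrite -!qpiZ scalerDl qpiD. Qed.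

HB.instance Definition _ := GRing.Zmodule_isLmodule.Build K quot
  qscaleA qscale1 qscaleDr qscaleDl.

Lemma qpi_is_linear : linear qpi.
Proof. by move=> a x y; rewrite qpiD qpiZ. Qed.

HB.instance Definition _ := GRing.isLinear.Build K V quot _ qpi qpi_is_linear.

End Subspace.

Section SubspaceOps.
Variables (K : fieldType).

Definition span_mem (V : lmodType K) (P : V -> Prop) (x : V) : Prop :=
  forall W : subspace V, (forall y, P y -> W y) -> W x.

Lemma span_mem0 (V : lmodType K) (P : V -> Prop) : span_mem P 0.
Proof. by move=> W _; apply: smem0. Qed.

Lemma span_memP (V : lmodType K) (P : V -> Prop) (a : K) u v :
  span_mem P u -> span_mem P v -> span_mem P (a *: u + v).
Proof. by move=> hu hv W PW; apply: smemP; [apply: hu|apply: hv]. Qed.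

Definition span (V : lmodType K) (P : V -> Prop) : subspace V :=
  Subspace (@span_mem0 V P) (@span_memP V P).

(* the trace of U on the space S, so that S / (S :&: U) is [subquot S U] *)
Definition trace_mem (V : lmodType K) (S U : subspace V) (x : sub S) : Prop :=
  U (val x).

Lemma trace_mem0 (V : lmodType K) (S U : subspace V) : trace_mem U (0 : sub S).
Proof. by rewrite /trace_mem raddf0; apply: smem0. Qed.

Lemma trace_memP (V : lmodType K) (S U : subspace V) (a : K) (u v : sub S) :
  trace_mem U u -> trace_mem U v -> trace_mem U (a *: u + v).
Proof. by rewrite /trace_mem linearP; apply: smemP. Qed.

Definition trace (V : lmodType K) (S U : subspace V) : subspace (sub S) :=
  Subspace (@trace_mem0 V S U) (@trace_memP V S U).

Definition subquot (V : lmodType K) (S U : subspace V) := quot (trace S U).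

HB.instance Definition _ (V : lmodType K) (S U : subspace V) :=
  GRing.Lmodule.on (subquot S U).

Definition class (V : lmodType K) (S U : subspace V) :
  {linear sub S -> subquot S U} := @qpi K (sub S) (trace S U).

Definition fin_dim (V : lmodType K) : Prop :=
  exists s : seq V, forall v : V, exists c : 'I_(size s) -> K,
    v = \sum_i c i *: s`_i.

Lemma linear_mem0 (V : lmodType K) : linear ((0 : V -> K^o) : V -> K^o).
Proof. by move=> a u v; rewrite /= scaler0 addr0. Qed.

Lemma linear_memP (V : lmodType K) (a : K) (f g : V -> K^o) :
  linear f -> linear g -> linear (a *: f + g).
Proof.
move=> hf hg b u v; rewrite !fctE hf hg !scalerDr addrACA.
by rewrite !scalerA [a * b]mulrC.
Qed.

Definition linear_sub (V : lmodType K) : subspace (V -> K^o) :=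
  Subspace (@linear_mem0 V) (@linear_memP V).

Definition dual (V : lmodType K) := sub (linear_sub V).

HB.instance Definition _ (V : lmodType K) := GRing.Lmodule.on (dual V).

End SubspaceOps.

Section Tensor.
Variable K : fieldType.

Definition bilinear_map (U V W : lmodType K) (b : U -> V -> W) : Prop :=
  (forall u, linear (b u)) /\ (forall v, linear (b^~ v)).

Section Def.
Variables U V : lmodType K.

Inductive tens_rel : {freeg (U * V) / K} -> Prop :=
| tens_rell a u u' v :
    tens_rel (<< (a *: u + u', v) >> - (a *: << (u, v) >> + << (u', v) >>))
| tens_relr a u v v' :
    tens_rel (<< (u, a *: v + v') >> - (a *: << (u, v) >> + << (u, v') >>)).

Definition tens := quot (span tens_rel).

HB.instance Definition _ := GRing.Lmodule.on tens.

Definition pure (u : U) (v : V) : tens := qpi (span tens_rel) << (u, v) >>.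

Lemma pure_bilinear : bilinear_map pure.
Proof.
split=> [u a v v'|v a u u']; rewrite /pure -linearP; apply/qpiP/asboolP;
by move=> W; apply; (apply: tens_relr || apply: tens_rell).
Qed.

(* the linear map u (x) v |-> b u v; meaningful when b is bilinear *)
Definition tens_lift (W : lmodType K) (b : U -> V -> W) (t : tens) : W :=
  fglift (fun uv => b uv.1 uv.2) (qrepr t).

Lemma fglift_is_linear (W : lmodType K) (T : choiceType) (f : T -> W) :
  linear (fglift f : {freeg T / K} -> W).
Proof.
have fgD (D1 D2 : {freeg T / K}) : fglift f (D1 + D2) = fglift f D1 + fglift f D2.
  by rewrite -[D1]freeg_repr -[D2]freeg_repr -freeg_cat !fglift_Freeg prelift_cat.
have fg0 : fglift f (0 : {freeg T / K}) = 0.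
  by rewrite -(@freeg_nil K T) fglift_Freeg prelift_nil.
move=> a D1 D2; rewrite fgD; congr (_ + _).
rewrite -(freeg_sumE D1) scaler_sumr !(big_morph _ fgD fg0) scaler_sumr.
apply: eq_bigr => z _.
have -> : a *: << coeff z D1 *g z >> = << a * coeff z D1 *g z >> :> {freeg T / K}.
  by apply/eqP/freeg_eqP => k; rewrite coeffZ !coeffU mulrA.
by rewrite !liftU scalerA.
Qed.

Section Lift.
Variables (W : lmodType K) (b : U -> V -> W).
Hypothesis bP : bilinear_map b.

Let bh (uv : U * V) := b uv.1 uv.2.

Lemma tens_rel_lift x : span tens_rel x -> fglift bh x = 0.
Proof.
have h0 : fglift bh (0 : {freeg (U * V) / K}) = 0.
  by rewrite -(@freeg_nil K _) fglift_Freeg prelift_nil.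
have hP (a : K) u v : fglift bh u = 0 -> fglift bh v = 0 ->
    fglift bh (a *: u + v) = 0.
  by move=> hu hv; rewrite fglift_is_linear hu hv scaler0 addr0.
move=> /(_ (Subspace h0 hP)); apply => y /= hy.
pose F : {linear {freeg (U * V) / K} -> W} :=
  HB.pack (fglift bh) (GRing.isLinear.Build K _ W _ _ (fglift_is_linear bh)).
rewrite -[LHS]/(F y).
case: hy => [a u u' v|a u v v']; rewrite linearB linearP /F /= !liftU !scale1r.
  by rewrite /bh /= bP.2 subrr.
by rewrite /bh /= bP.1 subrr.
Qed.

Lemma tens_lift_qpi x : tens_lift b (qpi _ x) = fglift bh x.
Proof.
have /tens_rel_lift : span tens_rel (-1 *: x + qrepr (qpi (span tens_rel) x)).
  by apply/asboolP; rewrite scaleN1r addrC; apply: qpiE.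
rewrite fglift_is_linear scaleN1r addrC => /eqP; rewrite subr_eq0.
by move/eqP.
Qed.

Lemma tens_lift_linear : linear (tens_lift b).
Proof.
move=> a; elim/quotI=> x; elim/quotI=> y.
by rewrite -linearP !tens_lift_qpi fglift_is_linear.
Qed.

Lemma tens_lift_pure u v : tens_lift b (pure u v) = b u v.
Proof. by rewrite tens_lift_qpi liftU scale1r. Qed.

End Lift.

Lemma tens_ext (W : lmodType K) (f g : tens -> W) :
  linear f -> linear g -> (forall u v, f (pure u v) = g (pure u v)) -> f =1 g.
Proof.
move=> lf lg fg; elim/quotI => x.
pose F : {linear tens -> W} := HB.pack f (GRing.isLinear.Build K _ W _ _ lf).
pose G : {linear tens -> W} := HB.pack g (GRing.isLinear.Build K _ W _ _ lg).
rewrite -[LHS]/(F _) -[RHS]/(G _) -(freeg_sumE x) !linear_sum.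
apply: eq_bigr => -[u v] _.
have -> : << coeff (u, v) x *g (u, v) >> =
    coeff (u, v) x *: << (u, v) >> :> {freeg (U * V) / K}.
  by apply/eqP/freeg_eqP => k; rewrite coeffZ !coeffU mul1r.
by rewrite !linearZ /=; congr (_ *: _); apply: fg.
Qed.

End Def.

Definition tens_map (U U' V V' : lmodType K) (f : U -> U') (g : V -> V') :
  tens U V -> tens U' V' := tens_lift (fun u v => pure (f u) (g v)).

(* xi (x) id : U (x) V -> K (x) V = V *)
Definition contract (U V : lmodType K) (xi : U -> K) : tens U V -> V :=
  tens_lift (fun u v => xi u *: v).

Section MapLemmas.
Variables (U U' V V' : lmodType K) (f : U -> U') (g : V -> V').
Hypotheses (lf : linear f) (lg : linear g).

Lemma tens_map_bilinear : bilinear_map (fun u v => pure (f u) (g v)).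
Proof.
have [pl pr] := pure_bilinear U' V'.
by split=> [u a v v'|v a u u']; rewrite (lf, lg) (pl, pr).
Qed.

Lemma tens_map_linear : linear (tens_map f g).
Proof. exact/tens_lift_linear/tens_map_bilinear. Qed.

Lemma tens_map_pure u v : tens_map f g (pure u v) = pure (f u) (g v).
Proof. exact/tens_lift_pure/tens_map_bilinear. Qed.

End MapLemmas.

Lemma contract_bilinear (U V : lmodType K) (xi : U -> K) :
  scalar xi -> bilinear_map (fun u (v : V) => xi u *: v).
Proof.
move=> lxi; split=> [u a v v'|v a u u'] /=.
  by rewrite scalerDr !scalerA mulrC.
by rewrite lxi scalerDl scalerA.
Qed.

Lemma contract_linear (U V : lmodType K) (xi : U -> K) :
  scalar xi -> linear (@contract U V xi).
Proof. by move=> lxi; apply/tens_lift_linear/contract_bilinear. Qed.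

Lemma contract_pure (U V : lmodType K) (xi : U -> K) u (v : V) :
  scalar xi -> contract xi (pure u v) = xi u *: v.
Proof. by move=> lxi; apply/tens_lift_pure/contract_bilinear. Qed.

Lemma tens_map_comp (U U' U'' V V' V'' : lmodType K) (f : U -> U') (g : V -> V')
    (f' : U' -> U'') (g' : V' -> V'') x :
  linear f -> linear g -> linear f' -> linear g' ->
  tens_map f' g' (tens_map f g x) = tens_map (f' \o f) (g' \o g) x.
Proof.
move=> lf lg lf' lg'.
have lff : linear (f' \o f) by move=> a u v /=; rewrite lf lf'.
have lgg : linear (g' \o g) by move=> a u v /=; rewrite lg lg'.
apply: (tens_ext (f := tens_map f' g' \o tens_map f g)) => [a u v|a u v|u v] /=.
- by rewrite !tens_map_linear.
- exact: tens_map_linear.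
- by rewrite !tens_map_pure.
Qed.

End Tensor.

Section DProd.
Variables (K : fieldType) (I : Type) (V : I -> lmodType K).

Definition dprod := forall i, V i.

HB.instance Definition _ := gen_eqMixin dprod.
HB.instance Definition _ := gen_choiceMixin dprod.

Definition dprod_add (x y : dprod) : dprod := fun i => x i + y i.
Definition dprod_zero : dprod := fun i => 0.
Definition dprod_opp (x : dprod) : dprod := fun i => - x i.
Definition dprod_scale (a : K) (x : dprod) : dprod := fun i => a *: x i.

Lemma dprod_addA : associative dprod_add.
Proof. by move=> x y z; apply: functional_extensionality_dep => i; apply: addrA. Qed.
Lemma dprod_addC : commutative dprod_add.
Proof. by move=> x y; apply: functional_extensionality_dep => i; apply: addrC. Qed.
Lemma dprod_add0 : left_id dprod_zero dprod_add.
Proof. by move=> x; apply: functional_extensionality_dep => i; apply: add0r. Qed.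
Lemma dprod_addN : left_inverse dprod_zero dprod_opp dprod_add.
Proof. by move=> x; apply: functional_extensionality_dep => i; apply: addNr. Qed.

HB.instance Definition _ := GRing.isZmodule.Build dprod
  dprod_addA dprod_addC dprod_add0 dprod_addN.

Lemma dprod_scaleA a b x :
  dprod_scale a (dprod_scale b x) = dprod_scale (a * b) x.
Proof. by apply: functional_extensionality_dep => i; apply: scalerA. Qed.
Lemma dprod_scale1 : left_id 1 dprod_scale.
Proof. by move=> x; apply: functional_extensionality_dep => i; apply: scale1r. Qed.
Lemma dprod_scaleDr : right_distributive dprod_scale +%R.
Proof. by move=> a x y; apply: functional_extensionality_dep => i; apply: scalerDr. Qed.
Lemma dprod_scaleDl x : {morph dprod_scale^~ x : a b / a + b}.
Proof. by move=> a b; apply: functional_extensionality_dep => i; apply: scalerDl. Qed.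

HB.instance Definition _ := GRing.Zmodule_isLmodule.Build K dprod
  dprod_scaleA dprod_scale1 dprod_scaleDr dprod_scaleDl.

End DProd.

Inductive dir := Left | Right.

Section Dialgebra.
Variables (K : fieldType) (D : lmodType K).

Section Products.
Variable op : dir -> D -> D -> D.
Local Notation "x ⊣ y" := (op Left x y) (at level 40, no associativity).
Local Notation "x ⊢ y" := (op Right x y) (at level 40, no associativity).

Definition dialgebra_axioms : Prop := forall x y z : D,
  [/\ x ⊣ (y ⊣ z) = (x ⊣ y) ⊣ z /\ (x ⊣ y) ⊣ z = x ⊣ (y ⊢ z),
      (x ⊢ y) ⊣ z = x ⊢ (y ⊣ z)
    & (x ⊣ y) ⊢ z = x ⊢ (y ⊢ z) /\ x ⊢ (y ⊢ z) = (x ⊢ y) ⊢ z].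
End Products.

Record dialgebra := Dialgebra {
  dop :> dir -> D -> D -> D;
  dop_bilinear : forall s, bilinear_map (dop s);
  dopP : dialgebra_axioms dop
}.

End Dialgebra.

Inductive tree := Leaf | Graft (y1 y2 : tree).

Notation "y1 ∨ y2" := (Graft y1 y2) (at level 50, no associativity).

Fixpoint nodes (y : tree) : nat :=
  if y is y1 ∨ y2 then (nodes y1 + nodes y2).+1 else 0.

Definition Y (n : nat) := {y : tree | nodes y == n}.

(* The leaves of y1 ∨ y2 are those of y1, numbered 0 .. nodes y1, followed by
   those of y2, numbered from (nodes y1).+1 on.  Deleting a leaf also deletes
   the vertex it hangs from. *)
Fixpoint del (i : nat) (y : tree) : tree :=
  match y with
  | Leaf => Leaf
  | y1 ∨ y2 =>
    if i <= nodes y1 then (if y1 is Leaf then y2 else del i y1 ∨ y2)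
    else (if y2 is Leaf then y1 else y1 ∨ del (i - (nodes y1).+1) y2)
  end%N.

(* A leaf is oriented like \ when it is the left child of its vertex, and
   like / when it is the right child. *)
Fixpoint leaf_dir (i : nat) (y : tree) : dir :=
  match y with
  | Leaf => Left
  | y1 ∨ y2 =>
    if i <= nodes y1 then (if y1 is Leaf then Left else leaf_dir i y1)
    else (if y2 is Leaf then Right else leaf_dir (i - (nodes y1).+1) y2)
  end%N.

(* the product o_i^y, for y in Y_(n+1) and 0 <= i <= n+1 = nodes y *)
Definition circ (i : nat) (y : tree) : dir :=
  if i == 0 then (if y is Leaf ∨ _ then Left else Right)
  else if i == nodes y then (if y is _ ∨ Leaf then Right else Left)
  else leaf_dir i y.

Lemma nodes_del i y : nodes (del i y) = (nodes y).-1.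
Proof.
elim: y i => //= y1 IH1 y2 IH2 i; case: leqP => _.
  by case: y1 IH1 => //= y11 y12 ->.
by case: y2 IH2 => [|y21 y22] IH2 /=; rewrite ?addn0 // IH2 /= addnS.
Qed.

Lemma face_subproof n i (y : Y n.+1) : nodes (del i (sval y)) == n.
Proof. by rewrite nodes_del (eqP (svalP y)). Qed.

Definition face n (i : nat) (y : Y n.+1) : Y n :=
  exist _ (del i (sval y)) (face_subproof i y).

Definition y12 : Y 2 := exist _ ((Leaf ∨ Leaf) ∨ Leaf) (eqxx _).
Definition y21 : Y 2 := exist _ (Leaf ∨ (Leaf ∨ Leaf)) (eqxx _).
Definition y123 : Y 3 := exist _ (((Leaf ∨ Leaf) ∨ Leaf) ∨ Leaf) (eqxx _).
Definition y213 : Y 3 := exist _ ((Leaf ∨ (Leaf ∨ Leaf)) ∨ Leaf) (eqxx _).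
Definition y131 : Y 3 := exist _ ((Leaf ∨ Leaf) ∨ (Leaf ∨ Leaf)) (eqxx _).
Definition y312 : Y 3 := exist _ (Leaf ∨ ((Leaf ∨ Leaf) ∨ Leaf)) (eqxx _).
Definition y321 : Y 3 := exist _ (Leaf ∨ (Leaf ∨ (Leaf ∨ Leaf))) (eqxx _).

Section Cohomology.
Variables (K : fieldType) (D : lmodType K) (dD : dialgebra D).

(* CY^n(D, D) = Hom(K[Y_n] (x) D^(x)n, D) is the space of the functions
   f : Y_n -> D^n -> D that are multilinear on D^n. *)
Definition cochain (n : nat) := Y n -> n.-tuple D -> D.

HB.instance Definition _ n := GRing.Lmodule.on (cochain n).

Lemma cochainP n (c : K) (f g : cochain n) y a :
  (c *: f + g) y a = c *: f y a + g y a.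
Proof. by []. Qed.

Definition upd n (a : n.-tuple D) (j : 'I_n) (x : D) : n.-tuple D :=
  [tuple if k == j then x else tnth a k | k < n].

Definition multilinear n (f : cochain n) : Prop :=
  forall y (a : n.-tuple D) (j : 'I_n), linear (fun x => f y (upd a j x)).

(* (a_1, .., a_i o a_(i+1), .., a_(n+1)), where a_k is [tnth a (k - 1)] *)
Definition contract_at n (s : dir) (i : nat) (a : n.+1.-tuple D) : n.-tuple D :=
  [tuple if (j.+1 < i)%N then tnth a (widen_ord (leqnSn n) j)
         else if j.+1 == i
              then dD s (tnth a (widen_ord (leqnSn n) j)) (tnth a (fintype.lift ord0 j))
         else tnth a (fintype.lift ord0 j) | j < n].

Definition coface n (i : nat) (f : cochain n) : cochain n.+1 := fun y a =>
  let s := circ i (sval y) in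
  if i == 0 then
    dD s (tnth a ord0) (f (face i y) [tuple tnth a (fintype.lift ord0 j) | j < n])
  else if i == n.+1 then
    dD s (f (face i y) [tuple tnth a (widen_ord (leqnSn n) j) | j < n])
         (tnth a ord_max)
  else f (face i y) (contract_at s i a).

Definition delta n (f : cochain n) : cochain n.+1 := fun y a =>
  \sum_(i < n.+2) (-1) ^+ i *: coface i f y a.

Lemma coface_linear n i : linear (@coface n i).
Proof.
move=> c f g; apply/funext => y; apply/funext => a; rewrite !cochainP /coface.
have [bl br] := dop_bilinear dD (circ i (sval y)).
by case: ifP => // _; [rewrite bl|case: ifP => // _; rewrite br].
Qed.

Lemma delta_linear n : linear (@delta n).
Proof.
move=> c f g; apply/funext => y; apply/funext => a; rewrite !cochainP /delta.
rewrite scaler_sumr -big_split /=; apply: eq_bigr => i _.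
by rewrite coface_linear !cochainP scalerDr !scalerA mulrC.
Qed.

Lemma delta0 n : delta (0 : cochain n) = 0.
Proof.
have := @delta_linear n (-1) 0 0.
by rewrite scaler0 addr0 scaleN1r addNr.
Qed.

Lemma multilinear0 n : multilinear (0 : cochain n).
Proof. by move=> y a j c u v; rewrite scaler0 addr0. Qed.

Lemma multilinearP n (c : K) (f g : cochain n) :
  multilinear f -> multilinear g -> multilinear (c *: f + g).
Proof.
move=> hf hg y a j b u v; rewrite !cochainP hf hg !scalerDr addrACA.
by rewrite !scalerA [c * b]mulrC.
Qed.

Definition cocycle_mem n (f : cochain n) : Prop := multilinear f /\ delta f = 0.

Lemma cocycle_mem0 n : cocycle_mem (0 : cochain n).
Proof. by split; [apply: multilinear0|apply: delta0]. Qed.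

Lemma cocycle_memP n (c : K) (f g : cochain n) :
  cocycle_mem f -> cocycle_mem g -> cocycle_mem (c *: f + g).
Proof.
move=> [mf df] [mg dg]; split; first exact: multilinearP.
by rewrite delta_linear df dg scaler0 addr0.
Qed.

Definition ZY n : subspace (cochain n) :=
  Subspace (@cocycle_mem0 n) (@cocycle_memP n).

Definition coboundary_mem n : cochain n -> Prop :=
  match n with
  | 0 => fun f => f = 0
  | n'.+1 => fun f => exists2 g : cochain n', multilinear g & f = delta g
  end.

Lemma coboundary_mem0 n : coboundary_mem (0 : cochain n).
Proof.
by case: n => //= n; exists 0; [apply: multilinear0|rewrite delta0].
Qed.

Lemma coboundary_memP n (c : K) (f g : cochain n) :
  coboundary_mem f -> coboundary_mem g -> coboundary_mem (c *: f + g).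
Proof.
case: n f g => [f g -> ->|n f g [f' mf ->] [g' mg ->]] /=.
  by rewrite scaler0 addr0.
by exists (c *: f' + g'); [apply: multilinearP|rewrite delta_linear].
Qed.

Definition BY n : subspace (cochain n) :=
  Subspace (@coboundary_mem0 n) (@coboundary_memP n).

Definition HY n := subquot (ZY n) (BY n).

HB.instance Definition _ n := GRing.Lmodule.on (HY n).

Definition HYclass n : {linear sub (ZY n) -> HY n} := class (ZY n) (BY n).

End Cohomology.

Section Augmented.
Variable K : fieldType.

Record augAlg := AugAlg {
  acar :> comAlgType K;
  aug : {lrmorphism acar -> K | *%R}
}.

Record augHom (A A' : augAlg) := AugHom {
  ahom :> {lrmorphism A -> A'};
  ahomP : forall a, aug A' (ahom a) = aug A a
}.

Fixpoint mpow (A : augAlg) (n : nat) : subspace A :=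
  if n is n'.+1 then
    span (fun x => exists a b, [/\ aug A a = 0, mpow A n' b & x = a * b])
  else span (fun=> True).

(* ker (aug A) is the unique maximal ideal of A *)
Definition is_local (A : augAlg) : Prop :=
  forall a, aug A a != 0 -> exists b, a * b = 1.

(* A -> lim A / m^n is bijective *)
Definition is_complete (A : augAlg) : Prop :=
  forall x : forall n, quot (mpow A n),
    (forall n, qpi (mpow A n) (qrepr (x n.+1)) = x n) ->
    exists! a : A, forall n, qpi (mpow A n) a = x n.

Definition complete_local (A : augAlg) : Prop :=
  [/\ is_local A, is_complete A
    & forall n, (0 < n)%N -> fin_dim (subquot (mpow A n) (mpow A n.+1))].

Lemma mpow_mull (A : augAlg) n (a x : A) : mpow A n x -> mpow A n (a * x).
Proof.
elim: n a x => [|n IHn] a x /=; first by move=> _ W; apply.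
have h0 : mpow A n.+1 (a * 0) by rewrite mulr0; apply: smem0.
have hP (c : K) u v : mpow A n.+1 (a * u) -> mpow A n.+1 (a * v) ->
    mpow A n.+1 (a * (c *: u + v)).
  by move=> hu hv; rewrite mulrDr -scalerAr; apply: smemP.
move=> /(_ (Subspace h0 hP)); apply => _ [b [c [b0 hc ->]]] /=.
move=> W; apply; exists b, (a * c); split=> //; first exact: IHn.
by rewrite mulrCA.
Qed.

Lemma mpowS (A : augAlg) n (x : A) : mpow A n.+1 x -> mpow A n x.
Proof.
move=> /(_ (mpow A n)); apply => _ [a [b [_ hb ->]]].
exact: mpow_mull.
Qed.

Lemma mpow_hom (A A' : augAlg) (f : augHom A A') n x :
  mpow A n x -> mpow A' n (f x).
Proof.
elim: n x => [|n IHn] x; first by move=> _ W; apply.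
have h0 : mpow A' n.+1 (f 0) by rewrite linear0; apply: smem0.
have hP (c : K) u v : mpow A' n.+1 (f u) -> mpow A' n.+1 (f v) ->
    mpow A' n.+1 (f (c *: u + v)).
  by move=> hu hv; rewrite linearP; apply: smemP.
move=> /(_ (Subspace h0 hP)); apply => _ [a [b [a0 hb ->]]] /=.
move=> W; apply; exists (f a), (f b); split; last exact: rmorphM.
  by rewrite ahomP.
exact: IHn.
Qed.

Section QuotMap.
Variables (V V' : lmodType K) (S : subspace V) (S' : subspace V').

(* meaningful when f is linear and maps S into S' *)
Definition quot_map (f : V -> V') (x : quot S) : quot S' := qpi S' (f (qrepr x)).

Variable f : V -> V'.
Hypotheses (lf : linear f) (fS : forall x, S x -> S' (f x)).

Lemma quot_mapE x : quot_map f (qpi S x) = qpi S' (f x).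
Proof.
apply/qpiP/asboolP.
have -> : f (qrepr (qpi S x)) - f x = f (qrepr (qpi S x) - x).
  by rewrite -scaleN1r [in RHS]addrC -scaleN1r lf addrC.
exact/fS/asboolP/qpiE.
Qed.

Lemma quot_map_linear : linear (quot_map f).
Proof.
move=> a; elim/quotI=> x; elim/quotI=> y.
by rewrite -linearP !quot_mapE lf linearP.
Qed.

End QuotMap.

Lemma qpi_linear (V : lmodType K) (S : subspace V) : linear (qpi S).
Proof. exact: qpi_is_linear. Qed.

Lemma id_linear (V : lmodType K) : linear (@idfun V).
Proof. by []. Qed.

Arguments quot_map {V V'} S S' f x.

Section Completion.
Variable D : lmodType K.

Definition transition (A : augAlg) n :
    tens (quot (mpow A n.+1)) D -> tens (quot (mpow A n)) D :=
  tens_map (quot_map (mpow A n.+1) (mpow A n) idfun) idfun.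

Lemma transition_linear (A : augAlg) n : linear (@transition A n).
Proof. by apply: tens_map_linear => //; apply: quot_map_linear => //; apply: mpowS. Qed.

Definition compat_mem (A : augAlg)
    (x : dprod (fun n => tens (quot (mpow A n)) D)) : Prop :=
  forall n, transition (x n.+1) = x n.

Lemma compat_mem0 (A : augAlg) : compat_mem (0 : dprod (fun n => tens (quot (mpow A n)) D)).
Proof.
move=> n; have := @transition_linear A n (-1) 0 0.
by rewrite scaler0 addr0 scaleN1r addNr.
Qed.

Lemma compat_memP (A : augAlg) (a : K)
    (x y : dprod (fun n => tens (quot (mpow A n)) D)) :
  compat_mem x -> compat_mem y -> compat_mem (a *: x + y).
Proof. move=> hx hy n; rewrite /= -[RHS]/(a *: x n + y n).
rewrite -[in RHS](hx n) -[in RHS](hy n).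
exact: (@transition_linear A n a (x n.+1) (y n.+1)).
 Qed.

Definition compat (A : augAlg) :
    subspace (dprod (fun n => tens (quot (mpow A n)) D)) :=
  Subspace (@compat_mem0 A) (@compat_memP A).

(* the completed tensor product lim (A / m^n) (x) D *)
Definition ctens (A : augAlg) := sub (compat A).

HB.instance Definition _ (A : augAlg) := GRing.Lmodule.on (ctens A).

Section CMap.
Variables (A A' : augAlg) (f : A -> A').
Hypotheses (lf : linear f) (fS : forall n x, mpow A n x -> mpow A' n (f x)).

Definition cmap_fun (x : ctens A) : dprod (fun n => tens (quot (mpow A' n)) D) :=
  fun n => tens_map (quot_map (mpow A n) (mpow A' n) f) idfun (val x n).

Lemma cmap_subproof x : compat_mem (cmap_fun x).
Proof.
move=> n; rewrite /cmap_fun -(smem_val x n) /transition.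
have l1 m := quot_map_linear lf (fS (n := m)).
have l2 (B : augAlg) := quot_map_linear (@id_linear B) (@mpowS B n).
have lid := @id_linear D.
rewrite (tens_map_comp _ (l1 n.+1) lid (l2 A') lid).
rewrite (tens_map_comp _ (l2 A) lid (l1 n) lid).
congr (tens_map _ _ _); apply/funext; elim/quotI => a /=.
by rewrite !(quot_mapE lf (@fS _)) !(quot_mapE (@id_linear _) (@mpowS _ _)).
Qed.

Definition cmap (x : ctens A) : ctens A' := @mksub _ _ (compat A') _ (cmap_subproof x).

End CMap.

Section MulLinear.
Variables (A : augAlg) (a : A).
Lemma mull_linear : linear (fun b : A => a * b).
Proof. by move=> c u v; rewrite mulrDr -scalerAr. Qed.
End MulLinear.

Definition tact (A : augAlg) (a : A) : tens A D -> tens A D :=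
  tens_map (fun b => a * b) idfun.

Definition cact (A : augAlg) (a : A) : ctens A -> ctens A :=
  cmap (mull_linear a) (fun n x => @mpow_mull A n a x).

Definition tpush (A A' : augAlg) (f : augHom A A') : tens A D -> tens A' D :=
  tens_map f idfun.

Definition cpush (A A' : augAlg) (f : augHom A A') : ctens A -> ctens A' :=
  cmap (fun c u v => linearP f c u v) (@mpow_hom A A' f).

(* epsilon (x) id and its completion; the latter factors through
   (A / m) (x) D *)
Definition teps (A : augAlg) : tens A D -> D := contract (aug A).

Definition ceps (A : augAlg) (x : ctens A) : D :=
  contract (fun c : quot (mpow A 1) => aug A (qrepr c)) (val x 1%N).

Lemma canon_subproof (A : augAlg) (x : tens A D) :
  compat_mem (fun n => tens_map (qpi (mpow A n)) idfun x).
Proof.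
move=> n; rewrite /transition.
have l2 := quot_map_linear (@id_linear A) (@mpowS A n).
have lid := @id_linear D.
rewrite (tens_map_comp _ (@qpi_linear _ (mpow A n.+1)) lid l2 lid).
congr (tens_map _ _ _); apply/funext => a /=.
by rewrite (quot_mapE (@id_linear _) (@mpowS _ _)).
Qed.

Definition canon (A : augAlg) (x : tens A D) : ctens A :=
  @mksub _ _ (compat A) _ (canon_subproof x).

End Completion.
End Augmented.

Section Deformations.
Variables (K : fieldType) (D : lmodType K) (dD : dialgebra D).

(* the part of A-bilinearity that is not K-bilinearity *)
Definition act_bilinear (A T : Type) (act : A -> T -> T) (op : T -> T -> T) :=
  forall a x y, op (act a x) y = act a (op x y) /\
                op x (act a y) = act a (op x y).

Record deformation (A : augAlg K) := Deformation {
  def_dialgebra :> dialgebra (tens A D);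
  def_bilinear : forall s, act_bilinear (@tact K D A) (def_dialgebra s);
  def_eps : forall s x y,
    teps (def_dialgebra s x y) = dD s (teps x) (teps y)
}.

Record fdeformation (A : augAlg K) := FDeformation {
  fdef_dialgebra :> dialgebra (ctens D A);
  fdef_bilinear : forall s, act_bilinear (@cact K D A) (fdef_dialgebra s);
  fdef_eps : forall s x y,
    ceps (fdef_dialgebra s x y) = dD s (ceps x) (ceps y)
}.

Definition fequiv (A : augAlg K) (lam lam' : fdeformation A) : Prop :=
  exists Phi : {linear ctens D A -> ctens D A},
    [/\ bijective Phi,
        forall a x, Phi (cact a x) = cact a (Phi x),
        forall s x y, Phi (lam s x y) = lam' s (Phi x) (Phi y)
      & forall x, ceps (Phi x) = ceps x].

(* lam' is the push-out f_* lam: under A' (x) D = A' (x)_A (A (x) D) the element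
   a' (x)_A l is [tact a' (tpush f l)]. *)
Definition is_pushout (A A' : augAlg K) (f : augHom A A')
    (lam : deformation A) (lam' : deformation A') : Prop :=
  forall s a1 a2 l1 l2,
    lam' s (tact a1 (tpush f l1)) (tact a2 (tpush f l2)) =
    tact (a1 * a2) (tpush f (lam s l1 l2)).

Definition is_fpushout (A A' : augAlg K) (f : augHom A A')
    (lam : fdeformation A) (lam' : fdeformation A') : Prop :=
  forall s a1 a2 l1 l2,
    lam' s (cact a1 (cpush f l1)) (cact a2 (cpush f l2)) =
    cact (a1 * a2) (cpush f (lam s l1 l2)).

Definition induces (B A : augAlg K) (eta : fdeformation B) (f : augHom B A)
    (lam : fdeformation A) : Prop :=
  exists2 lam' : fdeformation A, is_fpushout f eta lam' & fequiv lam lam'.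

(* The bases of formal deformations are complete local algebras, so this is
   part of the statement that eta is a miniversal formal deformation. *)
Definition miniversal (B : augAlg K) (eta : fdeformation B) : Prop :=
  complete_local B /\
  forall A : augAlg K, complete_local A -> forall lam : fdeformation A,
    (exists f : augHom B A, induces eta f lam) /\
    ((forall a b, aug A a = 0 -> aug A b = 0 -> a * b = 0) ->
     forall f f' : augHom B A, induces eta f lam -> induces eta f' lam -> f =1 f').

End Deformations.

Section Harrison.
Variables (K : fieldType) (A : augAlg K) (M : lmodType K).

Definition harr_cocycle_mem (f : A -> A -> M) : Prop :=
  [/\ bilinear_map f, forall a b, f a b = f b a
    & forall a b c,
        aug A a *: f b c - f (a * b) c + f a (b * c) - aug A c *: f a b = 0].

Lemma fct2P (k : K) (f g : A -> A -> M) a b :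
  (k *: f + g) a b = k *: f a b + g a b.
Proof. by []. Qed.

Lemma harr_cocycle_mem0 : harr_cocycle_mem 0.
Proof.
have e (a : K) : a *: (0 : M) + 0 = 0 by rewrite scaler0 addr0.
split=> // [|a b c].
  by split=> u a v w; apply/esym/e.
by rewrite /= !scaler0 !subr0 addr0.
Qed.

Lemma harr_cocycle_memP (k : K) f g :
  harr_cocycle_mem f -> harr_cocycle_mem g -> harr_cocycle_mem (k *: f + g).
Proof.
move=> [[f1 f2] fC fZ] [[g1 g2] gC gZ]; split=> [|a b|a b c].
- split=> u a v w; rewrite !fct2P ?(f1, g1) ?(f2 u, g2 u) !scalerDr addrACA;
  by rewrite !scalerA [k * a]mulrC.
- by rewrite !fct2P fC gC.
- rewrite !fct2P !scalerDr !scalerA ![aug A _ * k]mulrC -!scalerA.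
  have key (x1 x2 x3 x4 z1 z2 z3 z4 : M) :
      (x1 + z1) - (x2 + z2) + (x3 + z3) - (x4 + z4) =
      (x1 - x2 + x3 - x4) + (z1 - z2 + z3 - z4).
    by rewrite !opprD [X in X + _ + _]addrACA [X in X + _]addrACA [LHS]addrACA.
  by rewrite key gZ addr0 -!scalerBr -scalerDr -scalerBr fZ scaler0.
Qed.

Definition ZHarr : subspace (A -> A -> M) :=
  Subspace harr_cocycle_mem0 harr_cocycle_memP.

Definition harr_coboundary_mem (f : A -> A -> M) : Prop :=
  exists2 g : A -> M, linear g &
    forall a b, f a b = aug A a *: g b - g (a * b) + aug A b *: g a.

Lemma harr_coboundary_mem0 : harr_coboundary_mem 0.
Proof.
exists (fun=> 0) => [a u v|a b]; first by rewrite scaler0 addr0.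
by rewrite !scaler0 subr0 addr0.
Qed.

Lemma harr_coboundary_memP (k : K) f g :
  harr_coboundary_mem f -> harr_coboundary_mem g ->
  harr_coboundary_mem (k *: f + g).
Proof.
move=> [f' lf ff] [g' lg gg]; exists (k *: f' + g') => [a u v|a b].
  rewrite !fctE lf lg !scalerDr addrACA.
  by rewrite !scalerA [k * a]mulrC.
rewrite fct2P ff gg !fctE !scalerDr !scalerA ![aug A _ * k]mulrC -!scalerA scalerN.
by rewrite !opprD addrACA [X in X + _]addrACA.
Qed.

Definition BHarr : subspace (A -> A -> M) :=
  Subspace harr_coboundary_mem0 harr_coboundary_memP.

Definition H2Harr := subquot ZHarr BHarr.

HB.instance Definition _ := GRing.Lmodule.on H2Harr.

Definition H2class : {linear sub ZHarr -> H2Harr} := class ZHarr BHarr.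

(* The extension 0 -> M -> A (+) M -> A -> 0 defined by a cocycle.  Since f is
   not assumed normalized, its unit is (1, - f(1, 1)). *)
Section Extension.
Variable f : sub ZHarr.

Definition extension : Type := A * M.

HB.instance Definition _ := GRing.Lmodule.on extension.

Definition ext_mul (u v : extension) : extension :=
  (u.1 * v.1, aug A u.1 *: v.2 + aug A v.1 *: u.2 + val f u.1 v.1).

Definition ext_one : extension := (1, - val f 1 1).

Lemma ext_f_cocycle : harr_cocycle_mem (val f).
Proof. exact: (smem_val f). Qed.

Lemma ext_f1 c : val f 1 c = aug A c *: val f 1 1.
Proof.
have [_ _ /(_ 1 1 c)] := ext_f_cocycle.
rewrite rmorph1 scale1r !mul1r subrr add0r => /eqP.
by rewrite subr_eq0 => /eqP.
Qed.

Lemma ext_mulA : associative ext_mul.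
Proof.
have [_ _ fZ] := ext_f_cocycle.
have key (p q r t u v w : M) :
    t + u = v + w -> p + q + t + r + u = p + (q + r + v) + w.
  move=> h; rewrite -[p + _ + t]addrA -!addrA; do 2!congr (_ + _).
  by rewrite addrCA h addrA.
move=> [a x] [b y] [c z]; rewrite /ext_mul /=; congr pair; first exact: mulrA.
rewrite !rmorphM /= !scalerDr !scalerA [aug A c * aug A a]mulrC.
rewrite [aug A b * aug A c]mulrC; apply: key.
have /eqP := fZ a b c; rewrite subr_eq0 addrAC subr_eq => /eqP.
by move=> fabc; rewrite fabc.
Qed.

Lemma ext_mulC : commutative ext_mul.
Proof.
have [_ fC _] := ext_f_cocycle.
move=> [a x] [b y]; rewrite /ext_mul /=; congr pair; first exact: mulrC.
by rewrite [_ *: y + _]addrC fC.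
Qed.

Lemma ext_mul1 : left_id ext_one ext_mul.
Proof.
move=> [a x]; rewrite /ext_mul /=; congr pair; first exact: mul1r.
by rewrite (ext_f1 a) rmorph1 scale1r scalerN subrK.
Qed.

Lemma ext_mulDl : left_distributive ext_mul +%R.
Proof.
have [[_ fl] _ _] := ext_f_cocycle.
move=> [a x] [b y] [c z]; rewrite /ext_mul; congr pair; first exact: mulrDl.
rewrite /= rmorphD scalerDl scalerDr.
have := fl c 1 a b; rewrite !scale1r => ->.
by rewrite [RHS]addrACA [X in _ = X + _]addrACA.
Qed.

Lemma ext_one_neq0 : ext_one != 0.
Proof. by apply/eqP => -[/eqP]; rewrite oner_eq0. Qed.

HB.instance Definition _ := GRing.Zmodule_isComNzRing.Build extension
  ext_mulA ext_mulC ext_mul1 ext_mulDl ext_one_neq0.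

Lemma ext_scaleAl (k : K) (u v : extension) : k *: (u * v) = k *: u * v.
Proof.
have [[_ fl] _ _] := ext_f_cocycle.
case: u v => [a x] [b y]; congr pair; first exact: scalerAl.
rewrite /= linearZ /= !scalerDr !scalerA [aug A b * k]mulrC.
congr (_ + _); have := fl b k a 0; rewrite !addr0 => ->.
by have := fl b (-1) 0 0; rewrite scaler0 addr0 scaleN1r addNr => ->; rewrite addr0.
Qed.

HB.instance Definition _ :=
  GRing.Lmodule_isLalgebra.Build K extension ext_scaleAl.
HB.instance Definition _ := GRing.Lalgebra_isComAlgebra.Build K extension.

Definition ext_aug_fun (u : extension) : K := aug A u.1.

Lemma ext_aug_scalar : scalar ext_aug_fun.
Proof. by move=> k [a x] [b y]; rewrite /ext_aug_fun /= linearP. Qed.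

Lemma ext_aug_monoid : monoid_morphism ext_aug_fun.
Proof.
by split=> [|[a x] [b y]]; rewrite /ext_aug_fun ?rmorph1 //= rmorphM.
Qed.

HB.instance Definition _ :=
  GRing.isLinear.Build K extension K *%R ext_aug_fun ext_aug_scalar.
HB.instance Definition _ :=
  GRing.isMonoidMorphism.Build extension K ext_aug_fun ext_aug_monoid.

Definition ext_alg : augAlg K := @AugAlg K extension ext_aug_fun.

Definition ext_inj (m : M) : ext_alg := (0, m).
Definition ext_proj (u : ext_alg) : A := u.1.

End Extension.
End Harrison.

Section Obstruction.
Variables (K : fieldType) (D : lmodType K) (dD : dialgebra D).
Variables (A : augAlg K) (lam : deformation dD A).
Variables (M : lmodType K) (f : sub (ZHarr A M)).

Let B := ext_alg f.
Let I : tens M D -> tens B D := tens_map (@ext_inj K A M f) idfun.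
Let P : tens B D -> tens A D := tens_map (@ext_proj K A M f) idfun.
Let E : tens B D -> D := @teps K D B.

Definition is_lifting (br : dir -> tens B D -> tens B D -> tens B D) : Prop :=
  forall s,
  [/\ bilinear_map (br s) /\ act_bilinear (@tact K D B) (br s),
      forall l1 l2, P (br s l1 l2) = lam s (P l1) (P l2)
    & forall m l l1, br s (I (pure m l)) l1 = I (pure m (dD s l (E l1)))].

Definition lifting_defect (br : dir -> tens B D -> tens B D -> tens B D)
    (y : tree) (l1 l2 l3 : tens B D) : tens B D :=
  let l := br Left in let r := br Right in
  match y with
  | (* [321] *) Leaf ∨ (Leaf ∨ (Leaf ∨ Leaf)) =>
      l l1 (l l2 l3) - l (l l1 l2) l3
  | (* [312] *) Leaf ∨ ((Leaf ∨ Leaf) ∨ Leaf) =>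
      l l1 (r l2 l3) - l (l l1 l2) l3
  | (* [131] *) (Leaf ∨ Leaf) ∨ (Leaf ∨ Leaf) =>
      r l1 (l l2 l3) - l (r l1 l2) l3
  | (* [213] *) (Leaf ∨ (Leaf ∨ Leaf)) ∨ Leaf =>
      r l1 (r l2 l3) - r (l l1 l2) l3
  | (* [123] *) ((Leaf ∨ Leaf) ∨ Leaf) ∨ Leaf =>
      r l1 (r l2 l3) - r (r l1 l2) l3
  | _ => 0
  end.

(* theta in M (x) HY^3 is the class of the cocycle phi in M (x) ZY^3 induced
   by the defect of some lifting of lam; phi is evaluated at y and a by
   id (x) ev_(y, a) : M (x) ZY^3 -> M (x) D. *)
Definition is_obstruction (theta : tens M (HY dD 3)) : Prop :=
  exists2 br, is_lifting br &
  exists2 phi : tens M (sub (ZY dD 3)),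
    (forall (y : Y 3) (l1 l2 l3 : tens B D),
       I (tens_map idfun
            (fun z : sub (ZY dD 3) => val z y [tuple E l1; E l2; E l3]) phi) =
       lifting_defect br (sval y) l1 l2 l3)
    & theta = tens_map idfun (HYclass dD 3) phi.

End Obstruction.

Section Construction.
Variables (K : fieldType) (D : lmodType K) (dD : dialgebra D).

(* A is the algebra K (+) HY^2(D, D)' with (HY^2(D, D)')^2 = 0, the isomorphism
   being a |-> (aug A a, v a), and lam is the deformation eta_1 of D.  Under
   A (x) D = D (+) Hom(HY^2(D, D), D), an element l of A (x) D is the pair
   (teps l, hcomp l) where hcomp l alpha is the image of l by
   (a |-> v a alpha) (x) id. *)
Definition is_first (A : augAlg K) (lam : deformation dD A) : Prop :=
  exists v : {linear A -> dual (HY dD 2)},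
  exists mu : {linear HY dD 2 -> sub (ZY dD 2)},
  [/\ bijective (fun a => (aug A a, v a)),
      forall a b, v (a * b) = aug A a *: v b + aug A b *: v a,
      forall alpha, HYclass dD 2 (mu alpha) = alpha
    & let hcomp (l : tens A D) (alpha : HY dD 2) : D :=
        contract (fun a : A => val (v a) alpha) l in
      forall l1 l2 alpha,
        hcomp (lam Left l1 l2) alpha =
          val (mu alpha) y21 [tuple teps l1; teps l2] +
          dD Left (hcomp l1 alpha) (teps l2) + dD Left (teps l1) (hcomp l2 alpha)
     /\ hcomp (lam Right l1 l2) alpha =
          val (mu alpha) y12 [tuple teps l1; teps l2] +
          dD Right (hcomp l1 alpha) (teps l2) +
          dD Right (teps l1) (hcomp l2 alpha)].

Section DualCocycle.
Variable A : augAlg K.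
Let H := H2Harr A K^o.
Variable mu : {linear H -> sub (ZHarr A K^o)}.

Lemma dual_cocycle_lin (a b : A) : linear_sub H (fun h => val (mu h) a b).
Proof.
move=> k h h'; have -> := linearP mu k h h'.
by have -> := linearP val k (mu h) (mu h').
Qed.

Definition dual_cocycle_fun (a b : A) : dual H := mksub (dual_cocycle_lin a b).

Lemma dual_cocycle_subproof : ZHarr A (dual H) dual_cocycle_fun.
Proof.
have mZ h : harr_cocycle_mem (val (mu h)) := smem_val (mu h).
split=> [|a b|a b c].
- by split=> u k a b; apply/val_inj/funext => h; have [[fl fr] _ _] := mZ h;
    rewrite /= ?fl ?fr.
- by apply/val_inj/funext => h; have [_ fC _] := mZ h; apply: fC.
- by apply/val_inj/funext => h; have [_ _ fZ] := mZ h; apply: fZ.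
Qed.

(* the dual Ch_2(A) -> H^2_Harr(A; K)' of mu, as a cocycle on A *)
Definition dual_cocycle : sub (ZHarr A (dual H)) := mksub dual_cocycle_subproof.

End DualCocycle.

(* pi : ext_alg f -> A' is surjective with kernel i (omega' (HY^3(D, D)')),
   where omega' is the transpose of omega *)
Definition is_coker (A A' : augAlg K) (H : lmodType K)
    (f : sub (ZHarr A (dual H))) (omega : H -> HY dD 3)
    (pi : augHom (ext_alg f) A') : Prop :=
  (forall c, exists b, pi b = c) /\
  (forall b, pi b = 0 <-> exists zeta : dual (HY dD 3),
     exists2 m : dual H, b = ext_inj f m & forall h, val m h = val zeta (omega h)).

(* (A', lam', p) is obtained from (A, lam) by one step of the construction:
   A' is the quotient, by pi, of the extension Abar of A given by the dual of mu
   by the ideal i (omega' (HY^3(D, D)')). *)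
Definition is_next (A A' : augAlg K) (p : augHom A' A)
    (lam : deformation dD A) (lam' : deformation dD A') : Prop :=
  exists mu : {linear H2Harr A K^o -> sub (ZHarr A K^o)},
  exists theta : tens (dual (H2Harr A K^o)) (HY dD 3),
  exists omega : {linear H2Harr A K^o -> HY dD 3},
  let f := dual_cocycle mu in
  exists pi : augHom (ext_alg f) A',
  [/\ forall h, H2class A K^o (mu h) = h,
      is_obstruction lam f theta,
      forall h, omega h = contract (fun xi : dual (H2Harr A K^o) => val xi h) theta,
      is_coker omega pi
    & (forall b, p (pi b) = ext_proj b) /\ is_pushout p lam' lam].

(* C_0 = K is expressed by tw0.  eta_0 is then forced by def_eps, and the
   projection C_1 -> C_0 by ahomP. *)
Record tower := Tower {
  tw_alg : nat -> augAlg K;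
  tw_proj : forall k, augHom (tw_alg k.+1) (tw_alg k);
  tw_def : forall k, deformation dD (tw_alg k);
  tw0 : bijective (aug (tw_alg 0));
  tw1 : is_first (tw_def 1);
  twS : forall k, (0 < k)%N ->
    is_next (tw_proj k) (tw_def k) (tw_def k.+1)
}.

Variable T : tower.

Definition is_limit (C : augAlg K) (pi : forall k, augHom C (tw_alg T k)) : Prop :=
  (forall k c, tw_proj T k (pi k.+1 c) = pi k c) /\
  (forall x : forall k, tw_alg T k, (forall k, tw_proj T k (x k.+1) = x k) ->
     exists! c : C, forall k, pi k c = x k).

(* eta is the projective limit of the eta_k; here C_k (x) D is identified by
   canon with its completion. *)
Definition is_limit_def (C : augAlg K) (pi : forall k, augHom C (tw_alg T k))
    (eta : fdeformation dD C) : Prop :=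
  forall k s (l1 l2 : ctens D C) (x1 x2 : tens (tw_alg T k) D),
    cpush (pi k) l1 = canon x1 -> cpush (pi k) l2 = canon x2 ->
    cpush (pi k) (eta s l1 l2) = canon (tw_def T k s x1 x2).

End Construction.

(* Main.v *)
Require Import Defs.
From HB Require Import structures.
From mathcomp Require Import all_boot all_algebra.
From mathcomp Require Import boolp functions freeg ring.

(** Let lam be a formal deformation with complete local base A, and let A_k be the
    quotient of A by the power k + 1 of its maximal ideal. Since A-bilinear
    products on the completed tensor product are continuous ([ctens_ker]), lam
    is the limit of deformations lam_k with base A_k ([fdef_descend]). One
    constructs by induction homomorphisms g_k : C_k -> A_k together with
    morphisms of deformations from eta_k to lam_k over g_k ([versal_tower]); in
    the limit they give a homomorphism f : C -> A and an equivalence of lam with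
    the push-out of eta ([versal_hom]).

    The step from k to k + 1 is where the construction of C_{k+1} enters. The
    algebra A_{k+1} is an extension of A_k by a space N annihilated by the
    maximal ideal. Pulled back to C_k it has Harrison classes, one for each
    coordinate of N, so g_k lifts to the universal extension of C_k. The lift
    factors through C_{k+1} provided that omega_k vanishes on these classes,
    and it does because lam_{k+1} exists: comparing it with a lifting of the
    products of eta_k to the universal extension, one finds that the defect of
    associativity is the coboundary of the defect of multiplicativity
    ([assoc_defect_delta], [hom_lift]). The morphism of deformations then lifts
    up to a 2-cocycle with values in N, whose class is removed by adding to the
    homomorphism a derivation with values in N: such derivations are families of
    elements of HY^2, and eta has the corresponding cocycles as its first order
    part ([mor_lift]).

    That C is a complete local algebra for the topology of the powers of its
    maximal ideal requires comparing this topology with that of the limit. The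
    kernel of C_{k+1} -> C_k lies in the square of the maximal ideal, because a
    linear form on it that is a derivation would trivialize a class of
    H^2_Harr(C_k; K) ([next_ker_mpow2]). Hence all the maximal ideals are
    generated by lifts of a basis of that of C_1, and Mittag-Leffler for finite
    dimensional spaces shows that the powers of the maximal ideal of C are
    closed ([mpow_limit]) and that the two topologies agree ([ker_pi_mpow]). The
    latter is also what makes the limit of the eta_k a formal deformation.

    If the maximal ideal of A has square zero, a homomorphism C -> A is determined
    by its composites with the linear forms xi on A vanishing at 1. Each of them
    factors through C_1 and so is an element of HY^2, namely the class of the
    xi-component of lam, which is invariant under equivalence
    ([induced_class_unique]). *)

Set Implicit Arguments.
Unset Strict Implicit.
Unset Printing Implicit Defensive.

Import GRing.Theory.
Local Open Scope ring_scope.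

(** * Linear maps as bare functions *)

Section Linear.
Variables (K : fieldType) (U V : lmodType K) (f : U -> V).
Hypothesis lf : linear f.

Definition lin_pack : {linear U -> V} :=
  HB.pack f (GRing.isLinear.Build K U V _ f lf).

Lemma lin0 : f 0 = 0. Proof. exact: (linear0 lin_pack). Qed.
Lemma linD u v : f (u + v) = f u + f v. Proof. exact: (linearD lin_pack). Qed.
Lemma linB u v : f (u - v) = f u - f v. Proof. exact: (linearB lin_pack). Qed.
Lemma linN u : f (- u) = - f u. Proof. exact: (linearN lin_pack). Qed.
Lemma linZ a u : f (a *: u) = a *: f u. Proof. exact: (linearZZ lin_pack). Qed.
Lemma lin_sum I (r : seq I) (P : pred I) F :
  f (\sum_(i <- r | P i) F i) = \sum_(i <- r | P i) f (F i).
Proof. exact: (linear_sum lin_pack). Qed.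

End Linear.

Section Scalar.
Variables (K : fieldType) (U : lmodType K) (f : U -> K).
Hypothesis lf : scalar f.

Lemma scal0 : f 0 = 0. Proof. exact: (@lin0 K U K^o f lf). Qed.
Lemma scalD u v : f (u + v) = f u + f v. Proof. exact: (@linD K U K^o f lf). Qed.
Lemma scalB u v : f (u - v) = f u - f v. Proof. exact: (@linB K U K^o f lf). Qed.
Lemma scalZ a u : f (a *: u) = a * f u. Proof. exact: (@linZ K U K^o f lf). Qed.
Lemma scal_sum I (r : seq I) (P : pred I) F :
  f (\sum_(i <- r | P i) F i) = \sum_(i <- r | P i) f (F i).
Proof. exact: (@lin_sum K U K^o f lf). Qed.

End Scalar.

Section LinearOps.
Variable K : fieldType.
Implicit Types U V W : lmodType K.

Lemma linear_map U V (f : {linear U -> V}) : linear f.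
Proof. by move=> a u v; rewrite linearP. Qed.

Lemma lin_comp U V W (f : U -> V) (g : V -> W) :
  linear f -> linear g -> linear (g \o f).
Proof. by move=> lf lg a u v /=; rewrite lf lg. Qed.

Lemma lin_add U V (f g : U -> V) :
  linear f -> linear g -> linear (fun x => f x + g x).
Proof. by move=> lf lg a u v /=; rewrite lf lg scalerDr addrACA. Qed.

Lemma lin_opp U V (f : U -> V) : linear f -> linear (fun x => - f x).
Proof. by move=> lf a u v /=; rewrite lf opprD scalerN. Qed.

Lemma lin_sub U V (f g : U -> V) :
  linear f -> linear g -> linear (fun x => f x - g x).
Proof. by move=> lf lg; apply: lin_add => //; apply: lin_opp. Qed.

Lemma lin_scale U V c (f : U -> V) : linear f -> linear (fun x => c *: f x).
Proof. by move=> lf a u v /=; rewrite lf scalerDr !scalerA mulrC. Qed.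

Lemma lin_scalel U V (f : U -> K) (v : V) : scalar f -> linear (fun x => f x *: v).
Proof. by move=> lf a x y /=; rewrite lf scalerDl scalerA. Qed.

Lemma lin_big U V n (f : 'I_n -> U -> V) :
  (forall i, linear (f i)) -> linear (fun x => \sum_i f i x).
Proof.
move=> lf a u v; rewrite scaler_sumr -big_split /=.
by apply: eq_bigr => i _; apply: lf.
Qed.

(** Homomorphisms out of quotient algebras are obtained in this way. *)
Lemma lin_factor U V W (e : U -> V) (h : U -> W) :
  linear e -> linear h -> (forall v, exists u, e u = v) ->
  (forall u, e u = 0 -> h u = 0) ->
  exists2 g : V -> W, linear g & forall u, g (e u) = h u.
Proof.
move=> le lh surj ker; have [s sK] := choice surj.
have hE u u' : e u = e u' -> h u = h u'.
  by move=> euu; apply/eqP; rewrite -subr_eq0 -linB // ker // linB // euu subrr.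
exists (h \o s) => [a v v'|u] /=; last by apply: hE; rewrite sK.
by rewrite -lh; apply: hE; rewrite le !sK.
Qed.

Lemma lin_inverse U V (f : U -> V) (g : V -> U) :
  linear f -> cancel f g -> cancel g f -> linear g.
Proof.
by move=> lf fK gK a u v; apply: (can_inj fK); rewrite lf !gK.
Qed.

End LinearOps.

(** * Finite dimensional spaces *)

Section FinDim.
Variable K : fieldType.
Implicit Types U V : lmodType K.

(** The bridge to the subspaces of a [vectType]: a subspace given by a bare
    predicate is equal to any subspace of maximal dimension that it contains.
    *)
Lemma vspace_of (W : vectType K) (S : subspace W) :
  exists U : {vspace W}, forall x, S x <-> x \in U.
Proof.
pose P n := `[< exists2 U : {vspace W}, (forall x, x \in U -> S x) & \dim U = n >].
have exP : exists n, P n.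
  exists 0; apply/asboolP; exists 0%VS; last exact: dimv0.
  by move=> x; rewrite memv0 => /eqP ->; apply: smem0.
have ubP n : P n -> (n <= \dim {:W})%N.
  by case/asboolP=> U _ <-; apply/dimvS/subvf.
case: (ex_maxnP exP ubP) => n /asboolP[U US dU] maxn.
exists U => x; split; last exact: US.
move=> Sx; have : P (\dim (U + <[x]>)%VS).
  apply/asboolP; exists (U + <[x]>)%VS => // y /memv_addP[u uU [_ /vlineP[k ->] ->]].
  by rewrite addrC; apply: smemP => //; apply: US.
move/maxn; rewrite -dU => le.
have /eqP -> : (U == U + <[x]>)%VS by rewrite eqEdim addvSl.
by rewrite memvE addvSr.
Qed.

Lemma vect_fin_dim (W : vectType K) : fin_dim W.
Proof.
exists (vbasis {:W}) => v; rewrite size_tuple.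
exists (fun i => coord (vbasis {:W}) i v).
exact: (coord_vbasis (memvf v)).
Qed.

Lemma fin_dim_surj U V (e : U -> V) :
  linear e -> (forall v, exists u, e u = v) -> fin_dim U -> fin_dim V.
Proof.
move=> le surj [s sP]; exists (map e s) => v; have [u <-] := surj v.
have [c ->] := sP u; rewrite size_map; exists c.
rewrite lin_sum //; apply: eq_bigr => i _.
by rewrite linZ // (nth_map 0).
Qed.

(** A spanning sequence presents V as the image of a space of row vectors, and
    the image is isomorphic to a complement of the kernel. *)
Lemma fin_dim_vect V : fin_dim V ->
  exists (W : vectType K) (e : W -> V) (e' : V -> W),
    [/\ linear e, linear e', cancel e e' & cancel e' e].
Proof.
case=> s sP; pose n := size s.
pose e0 (u : 'rV[K]_n) : V := \sum_i u 0 i *: s`_i.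
have le0 : linear e0.
  apply: lin_big => i; apply: lin_scalel => a u v.
  by rewrite !mxE.
have surj v : exists u, e0 u = v.
  have [c ->] := sP v; exists (\row_i c i).
  by apply: eq_bigr => i _; rewrite mxE.
have k0 : e0 0 = 0 by apply: lin0.
have kP (a : K) u v : e0 u = 0 -> e0 v = 0 -> e0 (a *: u + v) = 0.
  by move=> hu hv; rewrite le0 hu hv scaler0 addr0.
have [U UP] := vspace_of (Subspace k0 kP).
pose e (w : subvs_of (U^C)%VS) : V := e0 (vsval w).
have le : linear e by move=> a u v; rewrite /e linearP le0.
have inj : injective e.
  move=> u v euv; apply: val_inj; apply/eqP; rewrite -subr_eq0 /=.
  have : vsval u - vsval v \in (U :&: U^C)%VS.
    rewrite memv_cap (memvB (subvsP u) (subvsP v)) andbT; apply/UP => /=.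
    by rewrite linB // -/(e u) euv subrr.
  by rewrite capv_compl memv0.
have esurj v : exists u, e u = v.
  have [u <-] := surj v.
  have : u \in (U + U^C)%VS by rewrite addv_complf memvf.
  case/memv_addP=> [x xU [y yU ->]]; exists (vsproj (U^C)%VS y).
  by rewrite /e vsprojK // linD // (proj2 (UP x) xU) add0r.
have [e' e'K] := choice esurj.
exists (subvs_of (U^C)%VS), e, e'; split=> //.
  by move=> a u v; apply: inj; rewrite le !e'K.
by move=> u; apply: inj; rewrite e'K.
Qed.

Lemma fin_dim_inj U V (e : U -> V) : linear e -> injective e -> fin_dim V -> fin_dim U.
Proof.
move=> le inj /fin_dim_vect[W [f [f' [lf lf' fK f'K]]]].
pose g x := f' (e x).
have lg : linear g by apply: lin_comp.
have h0 : exists x, g x = 0 by exists 0; apply: lin0.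
have hP (a : K) u v : (exists x, g x = u) -> (exists x, g x = v) ->
    exists x, g x = a *: u + v.
  by move=> [x <-] [y <-]; exists (a *: x + y); apply: lg.
have [A AP] := vspace_of (Subspace h0 hP).
have /choice[b bP] (i : 'I_(\dim A)) : exists x, g x = (vbasis A)`_i.
  have /= [_ ] := AP (vbasis A)`_i; apply.
  by apply: vbasis_mem; rewrite mem_nth // size_tuple.
exists (codom b) => v; rewrite size_codom card_ord.
exists (fun i => coord (vbasis A) i (g v)); apply: inj; apply: (can_inj f'K).
rewrite -/(g v) -/(g _) lin_sum //.
have vA : g v \in A by apply/AP; exists v.
rewrite {1}(coord_vbasis vA); apply: eq_bigr => i _; rewrite linZ // -bP.
by congr (_ *: g _); rewrite (nth_map i) ?nth_ord_enum // size_enum_ord.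
Qed.

Lemma fin_dim_sub V (S : subspace V) : fin_dim V -> fin_dim (sub S).
Proof. by apply: fin_dim_inj val_inj; apply: linear_map. Qed.

Lemma fin_dim_quot V (S : subspace V) : fin_dim V -> fin_dim (quot S).
Proof.
by apply: fin_dim_surj (@qpi_linear _ _ S) _ => v; exists (qrepr v); rewrite qreprK.
Qed.

Lemma fin_dim_scalar : fin_dim (K^o : lmodType K).
Proof.
exists [:: 1] => v; exists (fun=> v); rewrite big_ord1 /=.
by rewrite -[RHS]/(v * 1) mulr1.
Qed.

Lemma fin_dim_prod U V : fin_dim U -> fin_dim V -> fin_dim (U * V)%type.
Proof.
move=> /fin_dim_vect[W [f [f' [lf lf' fK f'K]]]].
move=> /fin_dim_vect[X [g [g' [lg lg' gK g'K]]]].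
pose h (w : W * X) := (f w.1, g w.2).
apply: (@fin_dim_surj _ _ h) (vect_fin_dim _).
  by move=> a u v; rewrite /h /= lf lg.
by move=> [u v]; exists (f' u, g' v); rewrite /h /= f'K g'K.
Qed.

Lemma fin_dim_fun n V : fin_dim V -> fin_dim ('I_n -> V).
Proof.
move=> /fin_dim_vect[W [f [f' [lf lf' fK f'K]]]].
pose h (w : {ffun 'I_n -> W}) (i : 'I_n) := f (w i).
apply: (@fin_dim_surj _ _ h) (vect_fin_dim _).
  by move=> a u v; apply/funext => i; rewrite /h !ffunE lf.
by move=> u; exists [ffun i => f' (u i)]; apply/funext => i; rewrite /h ffunE f'K.
Qed.

Lemma fin_dim_basis V : fin_dim V ->
  exists (n : nat) (e : 'I_n -> V) (x : 'I_n -> V -> K),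
  [/\ forall i, scalar (x i), forall v, v = \sum_i x i v *: e i
    & forall i j, x i (e j) = (i == j)%:R].
Proof.
move=> /fin_dim_vect[W [f [f' [lf lf' fK f'K]]]].
exists (\dim {:W}), (fun i => f (vbasis {:W})`_i).
exists (fun i v => coord (vbasis {:W}) i (f' v)); split=> [i a u v|v|i j].
- by rewrite lf' linearP.
- rewrite -{1}[v]f'K [in LHS](coord_vbasis (memvf (f' v))) lin_sum //.
  by apply: eq_bigr => i _; rewrite linZ.
- by rewrite fK coord_free ?(basis_free (vbasisP _)) // eq_sym.
Qed.

(** A coordinate form of the quotient by S which does not vanish at the class
    of x, rescaled and pulled back. *)
Lemma fin_dim_sep V (S : subspace V) x : fin_dim V -> ~ S x ->
  exists2 chi : V -> K, scalar chi & chi x = 1 /\ forall y, S y -> chi y = 0.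
Proof.
move=> fV Sx.
have [n [e [c [lc cE _]]]] := fin_dim_basis (fin_dim_quot S fV).
have [i ci] : exists i, c i (qpi S x) != 0.
  apply/existsP; apply: contrapT => /negP; rewrite negb_exists => /forallP c0.
  apply: Sx; suff /qpiP/asboolP : qpi S x = qpi S 0 by rewrite subr0.
  rewrite (cE (qpi S x)) big1 ?linear0 // => i _.
  by have := c0 i; rewrite negbK => /eqP ->; rewrite scale0r.
exists (fun v => (c i (qpi S x))^-1 * c i (qpi S v)).
  by move=> a u v; rewrite linearP lc mulrDr mulrCA.
split=> [|y Sy]; first by rewrite mulVf.
have -> : qpi S y = 0 by rewrite -(linear0 (qpi S)); apply/qpiP/asboolP; rewrite subr0.
by rewrite (scal0 (lc i)) mulr0.
Qed.

Lemma dual_linear V (m : dual V) : scalar (val m).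
Proof. exact: (smem_val m). Qed.

Lemma dual_evalP V (x : V) : scalar (fun m : dual V => val m x).
Proof. by move=> a m m'; rewrite linearP. Qed.

Lemma fin_dim_dual V : fin_dim V -> fin_dim (dual V).
Proof.
move=> /fin_dim_basis[n [e [c [lc cE _]]]].
apply: (@fin_dim_inj _ _ (fun m : dual V => \row_i val m (e i))).
- by move=> a u v; apply/rowP => i; rewrite !mxE dual_evalP.
- move=> m m' mm'; apply/val_inj/funext => v; rewrite (cE v).
  rewrite !(scal_sum (dual_linear _)); apply: eq_bigr => i _.
  rewrite !(scalZ (dual_linear _)).
  by have := congr1 (fun r : 'rV_n => r 0 i) mm'; rewrite !mxE => ->.
- exact: vect_fin_dim.
Qed.

(** Reflexivity is what turns a linear form on the dual of a cohomology space
    into a cohomology class, and so identifies tangent vectors of the base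
    with elements of HY^2. *)
Lemma dual_reflexive V (chi : dual V -> K) : fin_dim V -> scalar chi ->
  exists v, forall m, chi m = val m v.
Proof.
move=> /fin_dim_basis[n [e [c [lc cE _]]]] lchi.
pose d i : dual V := @mksub _ _ (linear_sub V) (c i : V -> K^o) (lc i).
exists (\sum_i chi (d i) *: e i) => m.
have {1}-> : m = \sum_i (val m (e i) : K) *: d i.
  apply/val_inj/funext => v; rewrite {1}(cE v) (scal_sum (dual_linear _)).
  rewrite (scal_sum (dual_evalP v)); apply: eq_bigr => i _.
  by rewrite (scalZ (dual_linear _)) (scalZ (dual_evalP v)) mulrC.
rewrite (scal_sum lchi) (scal_sum (dual_linear _)); apply: eq_bigr => i _.
by rewrite (scalZ lchi) (scalZ (dual_linear _)) mulrC.
Qed.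

(** This is the form in which extensions of the base are used. The section s
    makes the coordinates xi in the kernel into forms on the whole of U. *)
Lemma fin_dim_split U V (q : U -> V) : linear q -> fin_dim U ->
  (forall v, exists u, q u = v) ->
  exists (s : V -> U) (r : nat) (n : 'I_r -> U) (xi : 'I_r -> U -> K),
  [/\ linear s, forall v, q (s v) = v & forall i, q (n i) = 0] /\
  [/\ forall i, scalar (xi i), forall u, u - s (q u) = \sum_i xi i u *: n i
    & forall i j, xi i (n j) = (i == j)%:R].
Proof.
move=> lq fU surj.
have k0 : q 0 = 0 by apply: lin0.
have kP (a : K) u v : q u = 0 -> q v = 0 -> q (a *: u + v) = 0.
  by move=> hu hv; rewrite lq hu hv scaler0 addr0.
pose N := Subspace k0 kP.
have [W [f [f' [lf lf' fK f'K]]]] := fin_dim_vect (fin_dim_surj lq surj fU).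
have [s [ls sK]] : exists s : V -> U, linear s /\ forall v, q (s v) = v.
  have [t tK] := choice surj.
  have [n [e [c [lc cE _]]]] := fin_dim_basis (fin_dim_surj lq surj fU).
  exists (fun v => \sum_i c i v *: t (e i)); split.
    by apply: lin_big => i; apply: lin_scalel.
  move=> v; rewrite lin_sum // [RHS](cE v).
  by apply: eq_bigr => i _; rewrite linZ // tK.
have [r [n [xi [lxi nE xin]]]] := fin_dim_basis (fin_dim_sub N fU).
have prN u : N (u - s (q u)) by rewrite /= linB // sK subrr.
pose pr u : sub N := mksub (prN u).
have lval : linear (val : sub N -> U) by apply: linear_map.
have lpr : linear pr.
  move=> a u v; apply: val_inj; rewrite linearP /= lq ls.
  by rewrite opprD addrACA scalerBr.
have prn u : q u = 0 -> val (pr u) = u by move=> /= ->; rewrite lin0 // subr0.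
exists s, r, (fun i => val (n i)), (fun i u => xi i (pr u)); split; split=> //.
- by move=> i; apply: (smem_val (n i)).
- by move=> i a u v; rewrite lpr lxi.
- move=> u; rewrite -[LHS]/(val (pr u)) [in LHS](nE (pr u)) (lin_sum lval).
  by apply: eq_bigr => i _; rewrite (linZ lval).
- move=> i j; suff -> : pr (val (n j)) = n j by [].
  by apply: val_inj; apply/prn/(smem_val (n j)).
Qed.

(** A term of minimal dimension is contained in all the later ones. *)
Lemma fin_dim_dcc V (S : nat -> subspace V) : fin_dim V ->
  (forall k x, S k.+1 x -> S k x) ->
  exists k0, forall k x, (k0 <= k)%N -> S k0 x -> S k x.
Proof.
move=> /fin_dim_vect[W [f [f' [lf lf' fK f'K]]]] dec.
have decn k j x : (k <= j)%N -> S j x -> S k x.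
  by move=> kj; rewrite -(subnK kj); elim: (j - k)%N => //= m IH /dec.
have S0 k : S k (f 0) by rewrite lin0 //; apply: smem0.
have SP k (a : K) u v : S k (f u) -> S k (f v) -> S k (f (a *: u + v)).
  by move=> hu hv; rewrite lf; apply: smemP.
have /choice[U UP] k := vspace_of (Subspace (S0 k) (SP k)).
pose P n := `[< exists k, \dim (U k) = n >].
have exP : exists n, P n by exists (\dim (U 0)); apply/asboolP; exists 0.
case: (ex_minnP exP) => n /asboolP[k0 dk0] minn; exists k0 => k x k0k.
rewrite -[x]f'K => /UP xU; apply/UP.
have sUU : (U k <= U k0)%VS by apply/subvP => y /UP yU; apply/UP/(decn _ _ _ k0k).
have /eqP -> // : (U k == U k0)%VS.
by rewrite eqEdim sUU dk0; apply: minn; apply/asboolP; exists k.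
Qed.

End FinDim.

(** * Inverse limits of finite dimensional spaces *)

Lemma dep_choice (X : nat -> Type) (R : forall k, X k -> X k.+1 -> Prop) (x0 : X 0) :
  (forall k x, exists y, R k x y) ->
  exists x : forall k, X k, x 0 = x0 /\ forall k, R k (x k) (x k.+1).
Proof.
move=> ex; pose next k (x : X k) := projT1 (cid (ex k x)).
exists (nat_rect X x0 next); split=> // k /=.
by rewrite /next; case: cid.
Qed.

(** The images of the later spaces in V_k stabilize, by finite dimension, and
    the transition maps are surjective between the stable images. The form kap
    is 1 on the sequence to be found: it turns affine conditions into linear
    ones, so that only chains of linear subspaces have to be considered. *)
Lemma mittag_leffler (K : fieldType) (V : nat -> lmodType K)
    (t : forall k, V k.+1 -> V k) (kap : forall k, V k -> K) :
  (forall k, fin_dim (V k)) -> (forall k, linear (t k)) ->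
  (forall k, scalar (kap k)) -> (forall k x, kap k (t k x) = kap k.+1 x) ->
  (forall k, exists x, kap k x = 1) ->
  exists x : forall k, V k, (forall k, t k (x k.+1) = x k) /\ forall k, kap k (x k) = 1.
Proof.
move=> fV lt lk kt ex.
pose fix im j : forall k, V k -> Prop :=
  if j is j'.+1 then fun k x => exists2 y, im j' k.+1 y & t k y = x else fun=> xpredT.
have S0 j k : im j k 0.
  by elim: j k => //= j IH k; exists 0 => //; apply: lin0.
have SP j k (a : K) u v : im j k u -> im j k v -> im j k (a *: u + v).
  elim: j k u v => //= j IH k _ _ [x xS <-] [y yS <-].
  by exists (a *: x + y); [apply: IH|apply: lt].
pose S k j := Subspace (S0 j k) (SP j k).
have Sd j k x : S k j.+1 x -> S k j x.
  by elim: j k x => //= j IH k _ [y /IH yS <-]; exists y.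
have Sdn k j i x : (j <= i)%N -> S k i x -> S k j x.
  by move=> ji; rewrite -(subnK ji); elim: (i - j)%N => // m IH /Sd.
have S1 j k : exists2 x, S k j x & kap k x = 1.
  elim: j k => [|j IH] k; first by have [x x1] := ex k; exists x.
  by have [y yS y1] := IH k.+1; exists (t k y); [exists y|rewrite kt].
have /choice[N NP] k := fin_dim_dcc (fV k) (fun j => Sd j k).
pose X k := {x : V k | S k (N k) x /\ kap k x = 1}.
have [x0 x0S x01] := S1 (N 0) 0.
have step k (x : X k) : exists y : X k.+1, t k (sval y) = sval x.
  case: x => x [xS x1] /=; pose m := maxn (N k) (N k.+1).
  have [y yS yx] : S k m.+1 x by apply: NP => //; rewrite ltnW // ltnS leq_maxl.
  have y1 : kap k.+1 y = 1 by rewrite -kt yx.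
  by exists (exist _ y (conj (Sdn _ _ _ _ (leq_maxr _ _) yS) y1)).
have [x [_ xP]] := dep_choice (X := X) (exist _ x0 (conj x0S x01)) step.
by exists (fun k => sval (x k)); split=> // k; case: (x k) => ? [].
Qed.

(** * Tensor products and changes of base *)

Section TensKit.
Variable K : fieldType.
Implicit Types U V W : lmodType K.

Lemma pure_linl U V (v : V) : linear (fun u : U => pure u v).
Proof. exact: (pure_bilinear U V).2. Qed.

Lemma pure_linr U V (u : U) : linear (@pure K U V u).
Proof. exact: (pure_bilinear U V).1. Qed.

(** The coefficient of a generator can be absorbed in its left factor, so that
    sums of pure tensors suffice. *)
Lemma tens_ind U V (P : tens U V -> Prop) :
  P 0 -> (forall u v t, P t -> P (pure u v + t)) -> forall t, P t.
Proof.
move=> P0 PD; elim/quotI => x; rewrite -(freeg_sumE x) linear_sum /=.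
elim: (dom x) => [|[u v] s IH]; first by rewrite big_nil.
rewrite big_cons; have -> : << coeff (u, v) x *g (u, v) >> =
    coeff (u, v) x *: << (u, v) >> :> {freeg (U * V) / K}.
  by apply/eqP/freeg_eqP => k; rewrite coeffZ !coeffU mul1r.
by rewrite linearZ /= -/(pure u v) -(linZ (pure_linl v)); apply: PD.
Qed.

Lemma tens_sum U V (t : tens U V) :
  exists n (u : 'I_n -> U) (v : 'I_n -> V), t = \sum_i pure (u i) (v i).
Proof.
elim/tens_ind: t => [|u v _ [n [us [vs ->]]]].
  exists 0, (fun=> 0), (fun=> 0); by rewrite big_ord0.
exists n.+1, (fun i => if unlift ord0 i is Some j then us j else u).
exists (fun i => if unlift ord0 i is Some j then vs j else v).
by rewrite big_ord_recl unlift_none; congr (_ + _); apply: eq_bigr => i _; rewrite liftK.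
Qed.

(** Products on A (x) D are compared on pure tensors by this lemma. *)
Lemma bilinear_ext U V U' V' W (F G : tens U V -> tens U' V' -> W) :
  bilinear_map F -> bilinear_map G ->
  (forall a x b y, F (pure a x) (pure b y) = G (pure a x) (pure b y)) ->
  forall l1 l2, F l1 l2 = G l1 l2.
Proof.
move=> [Fr Fl] [Gr Gl] FG l1 l2; move: l1.
apply: tens_ext => // a x; move: l2.
by apply: tens_ext => // b y.
Qed.

Lemma tens_map_id U V (t : tens U V) : tens_map idfun idfun t = t.
Proof.
by apply: (tens_ext (f := @tens_map K U U V V idfun idfun) (g := idfun)) => [||u v];
  [apply: tens_map_linear| |rewrite tens_map_pure].
Qed.

Lemma tens_map_linl U U' V (f g : U -> U') (a : K) t :
  linear f -> linear g ->
  tens_map (fun u => a *: f u + g u) (@idfun V) t =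
  a *: tens_map f idfun t + tens_map g idfun t.
Proof.
move=> lf lg; have lh : linear (fun u => a *: f u + g u).
  by apply: lin_add => //; apply: lin_scale.
apply: (tens_ext (f := tens_map (fun u => a *: f u + g u) idfun)
  (g := fun t => a *: tens_map f idfun t + tens_map g idfun t)) => [||u v].
- exact: tens_map_linear.
- by apply: lin_add; [apply: lin_scale|]; apply: tens_map_linear.
- by rewrite !tens_map_pure // pure_linl.
Qed.

Lemma contract_map U U' V (f : U -> U') (xi : U' -> K) (t : tens U V) :
  linear f -> scalar xi -> contract xi (tens_map f idfun t) = contract (xi \o f) t.
Proof.
move=> lf lxi; have lc : scalar (xi \o f) by move=> a u v /=; rewrite lf lxi.
apply: (tens_ext (f := contract xi \o tens_map f idfun)
  (g := contract (xi \o f))) => [||u v] /=.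
- by apply: lin_comp; [apply: tens_map_linear|apply: contract_linear].
- exact: contract_linear.
- by rewrite tens_map_pure // !contract_pure.
Qed.

Lemma contract_mapr U V V' (g : V -> V') (xi : U -> K) (t : tens U V) :
  linear g -> scalar xi -> contract xi (tens_map idfun g t) = g (contract xi t).
Proof.
move=> lg lxi; apply: (tens_ext (f := contract xi \o tens_map idfun g)
  (g := g \o contract xi)) => [||u v] /=.
- by apply: lin_comp; [apply: tens_map_linear|apply: contract_linear].
- by apply: lin_comp => //; apply: contract_linear.
- by rewrite tens_map_pure // !contract_pure // linZ.
Qed.

End TensKit.

Section Acts.
Variables (K : fieldType) (D : lmodType K).
Implicit Types A B R : augAlg K.

Lemma tact_linear A (a : A) : linear (@tact K D A a).
Proof. by apply: tens_map_linear => //; apply: mull_linear. Qed.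

Lemma tact_pure A (a b : A) (x : D) : tact a (pure b x) = pure (a * b) x.
Proof. by rewrite /tact tens_map_pure //; apply: mull_linear. Qed.

Lemma tact_linearl A (l : tens A D) : linear (fun a : A => tact a l).
Proof.
move=> c a b; rewrite /tact.
have -> : (fun b0 => (c *: a + b) * b0) = (fun u : A => c *: (a * u) + b * u).
  by apply/funext => u; rewrite mulrDl scalerAl.
by rewrite (tens_map_linl (V := D)) //; apply: mull_linear.
Qed.

Lemma tact1 A (l : tens A D) : tact 1 l = l.
Proof.
apply: (tens_ext (f := tact 1)) => [||u v] //; first exact: tact_linear.
by rewrite tact_pure mul1r.
Qed.

Lemma tactM A (a b : A) (l : tens A D) : tact (a * b) l = tact a (tact b l).
Proof.
apply: (tens_ext (f := tact (a * b)) (g := tact a \o tact b)) => [||u v] /=.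
- exact: tact_linear.
- by apply: lin_comp; apply: tact_linear.
- by rewrite !tact_pure mulrA.
Qed.

Lemma aug_scalar A : scalar (aug A).
Proof. by move=> a u v; rewrite linearP. Qed.

Lemma teps_linear A : linear (@teps K D A).
Proof. exact/contract_linear/aug_scalar. Qed.

Lemma teps_pure A (a : A) (x : D) : teps (pure a x) = aug A a *: x.
Proof. exact/contract_pure/aug_scalar. Qed.

Lemma teps_pure1 A (x : D) : teps (pure (1 : A) x) = x.
Proof. by rewrite teps_pure rmorph1 scale1r. Qed.

Lemma teps_tact A (a : A) (l : tens A D) : teps (tact a l) = aug A a *: teps l.
Proof.
apply: (tens_ext (f := @teps _ _ _ \o tact a) (g := fun l => aug A a *: teps l))
  => [||b x] /=.
- by apply: lin_comp; [apply: tact_linear|apply: teps_linear].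
- by apply: lin_scale; apply: teps_linear.
- by rewrite tact_pure !teps_pure rmorphM scalerA.
Qed.

Lemma ahom_linear A B (f : augHom A B) : linear f.
Proof. by move=> a u v; rewrite linearP. Qed.

Lemma ahomM A B (f : augHom A B) a b : f (a * b) = f a * f b.
Proof. exact: rmorphM. Qed.

Lemma ahom1 A B (f : augHom A B) : f 1 = 1.
Proof. exact: rmorph1. Qed.

Lemma tpush_linear A B (f : augHom A B) : linear (@tpush K D A B f).
Proof. by apply: tens_map_linear => //; apply: linear_map. Qed.

Lemma tpush_pure A B (f : augHom A B) a (x : D) : tpush f (pure a x) = pure (f a) x.
Proof. by rewrite /tpush tens_map_pure //; apply: linear_map. Qed.

Lemma tpush_tact A B (f : augHom A B) a (l : tens A D) :
  tpush f (tact a l) = tact (f a) (tpush f l).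
Proof.
apply: (tens_ext (f := tpush f \o tact a) (g := tact (f a) \o tpush f)) => [||b x] /=.
- by apply: lin_comp; [apply: tact_linear|apply: tpush_linear].
- by apply: lin_comp; [apply: tpush_linear|apply: tact_linear].
- by rewrite tact_pure !tpush_pure tact_pure rmorphM.
Qed.

Lemma teps_tpush A B (f : augHom A B) (l : tens A D) : teps (tpush f l) = teps l.
Proof.
rewrite /teps /tpush contract_map; [|exact: linear_map|exact: aug_scalar].
by congr (contract _ _); apply/funext => a /=; rewrite ahomP.
Qed.

(** An element n annihilated by the maximal ideal only sees the fibre of A (x)
    D at the augmentation. *)
Lemma tact_socle A (n : A) (l : tens A D) : (forall b, b * n = aug A b *: n) ->
  tact n l = pure n (teps l).
Proof.
move=> nP; apply: (tens_ext (f := tact n) (g := fun l => pure n (teps l))) => [||b x].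
- exact: tact_linear.
- by apply: (lin_comp (@teps_linear A)); apply: pure_linr.
- by rewrite tact_pure mulrC nP teps_pure (linZ (pure_linl x)) (linZ (pure_linr n)).
Qed.

(** When the augmentation is injective, A is the ground field and A (x) D is
    D. *)
Lemma teps_inj A (l l' : tens A D) : (forall a, aug A a = 0 -> a = 0) ->
  teps l = teps l' -> l = l'.
Proof.
move=> A0; have H (t : tens A D) : t = pure 1 (teps t).
  move: t; apply: (tens_ext (f := idfun) (g := fun t => pure (1 : A) (teps t)))
    => [||a x] //; first exact: lin_comp (@teps_linear A) (pure_linr _).
  rewrite teps_pure (linZ (pure_linr _)) -(linZ (pure_linl x)) /=; congr pure.
  apply/eqP; rewrite -subr_eq0; apply/eqP/A0.
  by rewrite linearB linearZ /= rmorph1 mulr1 subrr.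
by move=> ll'; rewrite (H l) ll' -H.
Qed.

Section Pull.
Variables (A R : augAlg K) (phi : A -> R) (T : D -> tens R D).
Hypotheses (lphi : linear phi) (lT : linear T).

Lemma pull_bilinear : bilinear_map (fun a x => tact (phi a) (T x)).
Proof.
split=> [a k u v|x k a b] /=; first by rewrite lT tact_linear.
by rewrite lphi (tact_linearl (T x)).
Qed.

(** The phi-semilinear extension of T to A (x) D. An A-linear dialgebra
    morphism from a push-out of a deformation is the same as such a semilinear
    map on the deformation itself, which saves carrying push-outs and
    equivalences along the induction. *)
Definition pull : tens A D -> tens R D := tens_lift (fun a x => tact (phi a) (T x)).

Lemma pull_linear : linear pull.
Proof. exact/tens_lift_linear/pull_bilinear. Qed.

Lemma pull_pure a x : pull (pure a x) = tact (phi a) (T x).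
Proof. exact/tens_lift_pure/pull_bilinear. Qed.

End Pull.

Lemma pull_tact A R (g : augHom A R) (T : D -> tens R D) a l : linear T ->
  pull g T (tact a l) = tact (g a) (pull g T l).
Proof.
move=> lT; have lg := linear_map g.
apply: (tens_ext (f := pull g T \o tact a) (g := tact (g a) \o pull g T)) => [||b x] /=.
- by apply: lin_comp; [apply: tact_linear|apply: pull_linear].
- by apply: lin_comp; [apply: pull_linear|apply: tact_linear].
- by rewrite tact_pure !pull_pure // rmorphM tactM.
Qed.

Lemma pull_teps A R (g : augHom A R) (T : D -> tens R D) l : linear T ->
  (forall x, teps (T x) = x) -> teps (pull g T l) = teps l.
Proof.
move=> lT eT; have lg := linear_map g.
apply: (tens_ext (f := @teps _ _ _ \o pull g T) (g := @teps _ _ _)) => [||b x] /=.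
- by apply: lin_comp; [apply: pull_linear|apply: teps_linear].
- exact: teps_linear.
- by rewrite pull_pure // teps_tact eT ahomP teps_pure.
Qed.

Lemma pull_square A A' R R' (p : augHom A' A) (q : augHom R' R)
    (g : augHom A R) (g' : augHom A' R') (T : D -> tens R D) (T' : D -> tens R' D) l :
  linear T -> linear T' -> (forall a, q (g' a) = g (p a)) ->
  (forall x, tpush q (T' x) = T x) ->
  tpush q (pull g' T' l) = pull g T (tpush p l).
Proof.
move=> lT lT' sq sT; have lg := linear_map g; have lg' := linear_map g'.
apply: (tens_ext (f := tpush q \o pull g' T') (g := pull g T \o tpush p)) => [||b x] /=.
- by apply: lin_comp; [apply: pull_linear|apply: tpush_linear].
- by apply: lin_comp; [apply: tpush_linear|apply: pull_linear].
- by rewrite tpush_pure !pull_pure // tpush_tact sq sT.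
Qed.

Lemma act_bilinear_pure A (op : tens A D -> tens A D -> tens A D) a b x y :
  act_bilinear (@tact K D A) op ->
  op (pure a x) (pure b y) = tact (a * b) (op (pure 1 x) (pure 1 y)).
Proof.
move=> ab; rewrite -[a in LHS]mulr1 -[b in LHS]mulr1 -!tact_pure.
by rewrite (ab _ _ _).1 (ab _ _ _).2 -tactM.
Qed.

End Acts.

(** * Associativity conditions and cochains of degree two *)

Section Quad.
Variables (K : fieldType) (D : lmodType K) (dD : dialgebra D).

(** The products in the associativity condition attached to a tree of Y_3: the
    tree with quadruple (p, q, r, s) compares x1 p (x2 q x3) with (x1 r x2) s
    x3. *)
Definition quad (y : tree) : dir * dir * dir * dir :=
  match y with
  | Leaf ∨ (Leaf ∨ (Leaf ∨ Leaf)) => (Left, Left, Left, Left)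
  | Leaf ∨ ((Leaf ∨ Leaf) ∨ Leaf) => (Left, Right, Left, Left)
  | (Leaf ∨ Leaf) ∨ (Leaf ∨ Leaf) => (Right, Left, Right, Left)
  | (Leaf ∨ (Leaf ∨ Leaf)) ∨ Leaf => (Right, Right, Left, Right)
  | _ => (Right, Right, Right, Right)
  end.

Definition assoc_defect (X : zmodType) (op : dir -> X -> X -> X) (y : tree) (l1 l2 l3 : X) :=
  let: (p, q, r, s) := quad y in op p l1 (op q l2 l3) - op s (op r l1 l2) l3.

Lemma nodes0 y : nodes y = 0 -> y = Leaf.
Proof. by case: y. Qed.

Lemma nodes1 y : nodes y = 1 -> y = Leaf ∨ Leaf.
Proof.
by case: y => // y1 y2 /= [] /eqP; rewrite addn_eq0 => /andP[/eqP/nodes0 -> /eqP/nodes0 ->].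
Qed.

Lemma nodes2 y : nodes y = 2 -> y = sval y12 \/ y = sval y21.
Proof.
case: y => // y1 y2 /= []; case E: (nodes y1) => [|[|//]].
  by rewrite (nodes0 E) => /nodes1 ->; right.
by rewrite (nodes1 E) => -[/nodes0 ->]; left.
Qed.

Lemma Y3_ind (P : Y 3 -> Prop) :
  P y123 -> P y213 -> P y131 -> P y312 -> P y321 -> forall y, P y.
Proof.
move=> P1 P2 P3 P4 P5 [y yP].
suff H : [\/ y = sval y123, y = sval y213, y = sval y131 | y = sval y312 \/ y = sval y321].
  have E (z : Y 3) : y = sval z -> P z -> P (exist _ y yP).
    by move=> yz; rewrite (_ : exist _ _ _ = z) //; apply: val_inj.
  by case: H => [|||[]] /E; apply.
move/eqP: yP; case: y => // y1 y2 /= [].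
case E: (nodes y1) => [|[|[|//]]].
- by rewrite (nodes0 E) => /nodes2[] ->; [constructor 4; left|constructor 4; right].
- by rewrite (nodes1 E) => -[/nodes1 ->]; constructor 3.
- by case: (nodes2 E) => -> [/nodes0 ->]; [constructor 1|constructor 2].
Qed.

Lemma assoc_defect0 (X : lmodType K) (op : dialgebra X) (y : Y 3) l1 l2 l3 :
  assoc_defect op (sval y) l1 l2 l3 = 0.
Proof.
elim/Y3_ind: y; rewrite /assoc_defect /=; apply/eqP; rewrite subr_eq0; apply/eqP;
  by case: (dopP op l1 l2 l3) => -[? ?] ? [? ?]; congruence.
Qed.

(** The trees [21] and [12] index the left and the right product, so that a
    pair of bilinear maps is a 2-cochain. *)
Definition cochain2 (h : dir -> D -> D -> D) : cochain D 2 := fun y a =>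
  h (if sval y is Leaf ∨ _ then Left else Right) (tnth a ord0) (tnth a ord_max).

Lemma cochain2_multilinear h : (forall s, bilinear_map (h s)) -> multilinear (cochain2 h).
Proof.
move=> hb y a j c u v; rewrite /cochain2.
have [hl hr] := hb (if sval y is Leaf ∨ _ then Left else Right).
rewrite !tnth_mktuple; case: j => -[|[|//]] j2; rewrite -!val_eqE /=; [exact: hr|exact: hl].
Qed.

(** The coboundary of a 2-cochain is the linearization of the five
    associativity conditions: each tree contributes the condition with its own
    four products. *)
Lemma delta2E (h : dir -> D -> D -> D) (y : Y 3) (a : 3.-tuple D) :
  let: (p, q, r, s) := quad (sval y) in
  let x1 := tnth a ord0 in let x2 := tnth a (fintype.lift ord0 ord0) in let x3 := tnth a ord_max in
  delta dD (cochain2 h) y a =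
    dD p x1 (h q x2 x3) - h s (dD r x1 x2) x3 + h p x1 (dD q x2 x3) - dD s (h r x1 x2) x3.
Proof.
have e1 : widen_ord (leqnSn 2) ord0 = ord0 by apply: val_inj.
have e2 : widen_ord (leqnSn 2) ord_max = fintype.lift ord0 ord0 by apply: val_inj.
have e3 : fintype.lift ord0 (ord_max : 'I_2) = ord_max by apply: val_inj.
elim/Y3_ind: y; rewrite /delta !big_ord_recl big_ord0 /= /coface /cochain2 /=;
  rewrite expr0 expr1 addr0 expr2 mulrNN mulr1 exprS expr2 mulrNN !mulr1;
  by rewrite !scale1r !scaleN1r !tnth_mktuple /= !(e1, e2, e3) /circ /= !addrA.
Qed.

End Quad.

(** * Small extensions of the base *)

(** A surjection q whose kernel is annihilated by the maximal ideal of R',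
    split as vector spaces by the section se_sec. The se_n form a basis of the
    kernel and the se_xi are the coordinates of a - se_sec (q a). *)
Record small_ext (K : fieldType) (R' R : augAlg K) (q : augHom R' R) := SmallExt {
  se_sec : R -> R';
  se_rank : nat;
  se_n : 'I_se_rank -> R';
  se_xi : 'I_se_rank -> R' -> K;
  se_sec_lin : linear se_sec;
  se_secK : forall a, q (se_sec a) = a;
  se_xi_lin : forall i, scalar (se_xi i);
  se_qn : forall i, q (se_n i) = 0;
  se_dec : forall a, a - se_sec (q a) = \sum_i se_xi i a *: se_n i;
  se_dual : forall i j, se_xi i (se_n j) = (i == j)%:R;
  se_small : forall i a, a * se_n i = aug R' a *: se_n i
}.

Lemma small_ext_exists (K : fieldType) (R' R : augAlg K) (q : augHom R' R) :
  fin_dim R' -> (forall b, exists a, q a = b) ->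
  (forall a n, q n = 0 -> a * n = aug R' a *: n) -> inhabited (small_ext q).
Proof.
move=> fR' sq sm.
have [s [r [n [xi [[ls sK qn] [lxi dec dual]]]]]] := fin_dim_split (linear_map q) fR' sq.
apply: inhabits; apply: (SmallExt (se_sec := s) (se_n := n) (se_xi := xi)) => //.
by move=> i a; apply: sm; apply: qn.
Qed.

Section SmallExtTheory.
Variables (K : fieldType) (D : lmodType K) (R' R : augAlg K) (q : augHom R' R).
Variable E : small_ext q.
Local Notation n := (se_n (s := E)).
Local Notation xi := (se_xi (s := E)).

(** Tensoring with D keeps the split exact sequence exact, so that elements of
    (ker q) (x) D have coordinates in D. *)
Lemma se_tens_dec (l : tens R' D) : tpush q l = 0 ->
  l = \sum_i pure (n i) (contract (xi i) l).
Proof.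
move=> l0; have le := se_sec_lin E; have lx (i : 'I_(se_rank E)) := se_xi_lin i.
have H (t : tens R' D) : t = tens_map (se_sec E) idfun (tpush q t) +
    \sum_i pure (n i) (contract (xi i) t).
  move: t; apply: (tens_ext (f := idfun)
    (g := fun t : tens R' D => tens_map (se_sec E) idfun (tpush q t) +
      \sum_i pure (n i) (contract (xi i) t))) => [||a x] //=.
    apply: lin_add; last first.
      by apply: lin_big => i; apply: lin_comp (contract_linear _) (pure_linr _).
    by apply: lin_comp (tpush_linear _) (tens_map_linear _ _).
  rewrite tpush_pure tens_map_pure //.
  have {1}-> : a = se_sec E (q a) + (a - se_sec E (q a)) by rewrite addrC subrK.
  rewrite (linD (pure_linl x)).
  congr (_ + _); rewrite se_dec (lin_sum (pure_linl x)); apply: eq_bigr => i _.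
  by rewrite contract_pure // (linZ (pure_linl x)) (linZ (pure_linr _)).
by rewrite {1}(H l) l0 (lin0 (tens_map_linear le (@id_linear K D))) add0r.
Qed.

Lemma se_contract i (d : 'I_(se_rank E) -> D) :
  contract (xi i) (\sum_j pure (n j) (d j)) = d i.
Proof.
have lx := se_xi_lin i; rewrite (lin_sum (contract_linear lx)) (bigD1 i) //=.
rewrite contract_pure // se_dual eqxx scale1r big1 ?addr0 // => j ji.
by rewrite contract_pure // se_dual eq_sym (negPf ji) scale0r.
Qed.

Lemma se_tpush0 (d : 'I_(se_rank E) -> D) : tpush q (\sum_j pure (n j) (d j)) = 0.
Proof.
rewrite (lin_sum (tpush_linear q)) big1 // => i _.
by rewrite tpush_pure se_qn (lin0 (pure_linl _)).
Qed.

Lemma se_lift (T : D -> tens R D) : linear T ->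
  exists T' : D -> tens R' D, [/\ linear T', forall x, tpush q (T' x) = T x
    & forall x, teps (T' x) = teps (T x)].
Proof.
move=> lT; have ls := se_sec_lin E.
have qT x : tpush q (tens_map (se_sec E) idfun (T x)) = T x.
  rewrite /tpush tens_map_comp //; last exact: linear_map.
  rewrite (_ : q \o se_sec E = idfun) ?tens_map_id //.
  by apply/funext => a /=; rewrite se_secK.
exists (fun x => tens_map (se_sec E) idfun (T x)); split=> // [|x].
  exact: lin_comp lT (tens_map_linear ls (@id_linear K D)).
by rewrite -(teps_tpush q) qT.
Qed.

Variables (dD : dialgebra D) (B : augAlg K) (op : dir -> tens B D -> tens B D -> tens B D).
Hypotheses (opb : forall s, bilinear_map (op s))
  (opa : forall s, act_bilinear (@tact K D B) (op s))
  (ope : forall s x y, teps (op s x y) = dD s (teps x) (teps y)).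
Variables (rho : deformation dD R') (g : augHom B R') (T : D -> tens R' D).
Hypotheses (lT : linear T) (eT : forall x, teps (T x) = x).
Hypothesis opq : forall s x y,
  tpush q (pull g T (op s (pure 1 x) (pure 1 y))) = tpush q (rho s (T x) (T y)).

(** Over R a semilinear map is multiplicative; any lift of it to R' fails to
    be so by an element of (ker q) (x) D, and this is its i-th coordinate. *)
Definition mdefect i s x y : D :=
  contract (xi i) (pull g T (op s (pure 1 x) (pure 1 y)) - rho s (T x) (T y)).

Lemma mdefect_bilinear i s : bilinear_map (mdefect i s).
Proof.
have lg := linear_map g; have lc := contract_linear (V := D) (se_xi_lin i).
have [or ol] := opb s; have [rr rl] := dop_bilinear rho s.
split=> z; apply: (lin_comp _ lc); apply: lin_sub.
- by apply: lin_comp (pull_linear lg lT); apply: lin_comp (pure_linr _) (or _).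
- exact: lin_comp lT (rr _).
- apply: lin_comp (pull_linear lg lT); apply: lin_comp (pure_linr _) (ol _).
- exact: lin_comp lT (rl _).
Qed.

Lemma mdefectE1 s x y : pull g T (op s (pure 1 x) (pure 1 y)) =
  rho s (T x) (T y) + \sum_i pure (n i) (mdefect i s x y).
Proof.
rewrite -se_tens_dec ?(linB (tpush_linear q)) ?opq ?subrr //.
by rewrite addrC subrK.
Qed.

Lemma tact_se_n a i (x : D) : tact a (pure (n i) x) = pure (n i) (aug R' a *: x).
Proof. by rewrite tact_pure se_small (linZ (pure_linl x)) (linZ (pure_linr _)). Qed.

(** The defect is semilinear with values in a space killed by the maximal
    ideal, so it only depends on the fibres of its arguments at the
    augmentation. *)
Lemma mdefectE s l1 l2 : pull g T (op s l1 l2) =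
  rho s (pull g T l1) (pull g T l2) +
  \sum_i pure (n i) (mdefect i s (teps l1) (teps l2)).
Proof.
have lg := linear_map g; have lP := pull_linear lg lT.
have [or ol] := opb s; have [rr rl] := dop_bilinear rho s.
apply: (bilinear_ext (F := fun l1 l2 => pull g T (op s l1 l2))
  (G := fun l1 l2 => rho s (pull g T l1) (pull g T l2) +
  \sum_i pure (n i) (mdefect i s (teps l1) (teps l2)))).
- by split=> l; apply: (lin_comp _ lP).
- split=> l; apply: lin_add.
  + exact: lin_comp lP (rr _).
  + apply: lin_big => i; apply: lin_comp (pure_linr _).
    exact: lin_comp (@teps_linear K D B) ((mdefect_bilinear i s).1 _).
  + exact: lin_comp lP (rl _).
  + apply: lin_big => i; apply: lin_comp (pure_linr _).
    exact: lin_comp (@teps_linear K D B) ((mdefect_bilinear i s).2 _).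
- move=> a x b y; rewrite (act_bilinear_pure _ _ _ _ (opa s)) pull_tact // mdefectE1.
  rewrite !pull_pure // (def_bilinear rho s _ _ _).1 (def_bilinear rho s _ _ _).2.
  rewrite -tactM -rmorphM (linD (tact_linear _)) (lin_sum (tact_linear _)).
  congr (_ + _); apply: eq_bigr => i _; rewrite tact_se_n !teps_pure ahomP rmorphM.
  have [mr ml] := mdefect_bilinear i s.
  by rewrite (linZ (ml _)) (linZ (mr _)) scalerA.
Qed.

Lemma def_se_nr s l i x : rho s l (pure (n i) x) = pure (n i) (dD s (teps l) x).
Proof.
rewrite -[n i]mulr1 -tact_pure (def_bilinear rho s _ _ _).2.
rewrite tact_socle; last by move=> b; apply: se_small.
by rewrite def_eps teps_pure1 mulr1.
Qed.

Lemma def_se_nl s l i x : rho s (pure (n i) x) l = pure (n i) (dD s x (teps l)).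
Proof.
rewrite -[n i]mulr1 -tact_pure (def_bilinear rho s _ _ _).1.
rewrite tact_socle; last by move=> b; apply: se_small.
by rewrite def_eps teps_pure1 mulr1.
Qed.

Lemma defect_regroup (V : zmodType) (X P Q S U : V) :
  X + P + Q - (X + S + U) = P - U + Q - S.
Proof.
apply: (addIr (X + S + U)); rewrite subrK [X + S]addrC -[S + X + U]addrA.
by rewrite [RHS]addrA subrK [P - U + Q]addrAC addrACA addNr addr0 addrC addrA.
Qed.

(** The key computation. The products rho satisfy the associativity
    conditions, so expanding both sides of a condition for op by [mdefectE]
    leaves the four terms of the coboundary of the multiplicative defect. For
    op a dialgebra it says that the defect is a cocycle; for op a lifting of a
    deformation to an extension, that the image of the obstruction cocycle is
    a coboundary. *)
Lemma assoc_defect_delta i (y : Y 3) l1 l2 l3 :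
  contract (xi i) (pull g T (assoc_defect op (sval y) l1 l2 l3)) =
  delta dD (cochain2 (mdefect i)) y [tuple teps l1; teps l2; teps l3].
Proof.
have lg := linear_map g; have lP := pull_linear lg lT.
have rho0 := assoc_defect0 rho y (pull g T l1) (pull g T l2) (pull g T l3).
have := delta2E dD (mdefect i) y [tuple teps l1; teps l2; teps l3].
move: rho0; rewrite /assoc_defect.
case: (quad (sval y)) => [[[a b] c] d]; rewrite !(tnth_nth 0) /= => rho0 ->.
have lc := contract_linear (V := D) (se_xi_lin i).
rewrite (linB lP) !mdefectE !ope.
have [ra rl] := dop_bilinear rho a; have [rr rd] := dop_bilinear rho d.
rewrite (linD (ra _)) (lin_sum (ra _)) (linD (rd _)) (lin_sum (rd _)).
under eq_bigr => j _ do rewrite def_se_nr pull_teps //.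
under [X in _ - (_ + X + _)]eq_bigr => j _ do rewrite def_se_nl pull_teps //.
move/eqP: rho0; rewrite subr_eq0 => /eqP ->.
by rewrite defect_regroup !(linD lc, linN lc) !se_contract.
Qed.

End SmallExtTheory.

(** * Morphisms of deformations and first order parts *)

Lemma augHom_of (K : fieldType) (A R : augAlg K) (f : A -> R) :
  linear f -> f 1 = 1 -> (forall a b, f (a * b) = f a * f b) ->
  (forall a, aug R (f a) = aug A a) -> exists g : augHom A R, forall a, g a = f a.
Proof.
move=> lf f1 fM fe.
have mf : monoid_morphism f by split.
pose F : {lrmorphism A -> R} := HB.pack f (GRing.isLinear.Build K A R _ f lf)
  (GRing.isMonoidMorphism.Build A R f mf).
by exists (@AugHom K A R F fe).
Qed.

Section Classes.
Variables (K : fieldType) (D : lmodType K) (dD : dialgebra D).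

Lemma HYclass0 n (z : sub (ZY dD n)) : HYclass dD n z = 0 <-> BY dD n (val z).
Proof.
split=> [z0|Bz].
  have /qpiP/asboolP : HYclass dD n z = HYclass dD n 0 by rewrite z0 linear0.
  by rewrite subr0.
by rewrite -(linear0 (HYclass dD n)); apply/qpiP/asboolP; rewrite subr0.
Qed.

Lemma H2class0 (A : augAlg K) (M : lmodType K) (z : sub (ZHarr A M)) :
  H2class A M z = 0 <-> BHarr A M (val z).
Proof.
split=> [z0|Bz].
  have /qpiP/asboolP : H2class A M z = H2class A M 0 by rewrite z0 linear0.
  by rewrite subr0.
by rewrite -(linear0 (H2class A M)); apply/qpiP/asboolP; rewrite subr0.
Qed.

Definition ytree (s : dir) : Y 2 := if s is Left then y21 else y12.

Lemma Y2_ind (P : Y 2 -> Prop) : (forall s, P (ytree s)) -> forall y, P y.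
Proof.
move=> PY [y yP].
suff [s ys] : exists s, y = sval (ytree s).
  by rewrite (_ : exist _ y yP = ytree s) //; apply: val_inj.
by case: (nodes2 (eqP yP)) => ->; [exists Right|exists Left].
Qed.

Lemma cochain2_ytree (h : dir -> D -> D -> D) s a :
  cochain2 h (ytree s) a = h s (tnth a ord0) (tnth a ord_max).
Proof. by rewrite /cochain2; case: s. Qed.

Definition one_tree : Y 1 := exist _ (Leaf ∨ Leaf) (eqxx _).

Lemma Y1_eq (y : Y 1) : y = one_tree.
Proof. by case: y => y yP; apply: val_inj; apply/nodes1/eqP. Qed.

(** The coboundary of a 1-cochain measures its failure to be a derivation. *)
Lemma delta1E (t : cochain D 1) s (a : 2.-tuple D) :
  let x := tnth a ord0 in let y := tnth a ord_max in
  delta dD t (ytree s) a =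
    dD s x (t one_tree [tuple y]) - t one_tree [tuple dD s x y] +
    dD s (t one_tree [tuple x]) y.
Proof.
have e1 : widen_ord (leqnSn 1) ord0 = ord0 by apply: val_inj.
have e3 : fintype.lift ord0 (ord0 : 'I_1) = ord_max by apply: val_inj.
have t1 (f : 'I_1 -> D) : [tuple f j | j < 1] = [tuple f ord0].
  by apply: eq_from_tnth => j; rewrite tnth_mktuple (ord1 j) (tnth_nth 0).
rewrite /= /delta !big_ord_recl big_ord0 /= /coface /contract_at !(Y1_eq (face _ _)) /= !t1.
rewrite expr0 expr1 addr0 expr2 mulrNN mulr1 !scale1r !scaleN1r /= !(e1, e3) !addrA.
by case: s.
Qed.

End Classes.

Section Morphisms.
Variables (K : fieldType) (D : lmodType K) (dD : dialgebra D).

(** T is the restriction to D of the semilinear morphism [pull g T], which is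
    required to reduce to the identity of D at the augmentation. *)
Definition def_mor (A R : augAlg K) (lam : deformation dD A) (rho : deformation dD R)
    (g : augHom A R) (T : D -> tens R D) : Prop :=
  [/\ linear T, forall x, teps (T x) = x
    & forall s x y, pull g T (lam s (pure 1 x) (pure 1 y)) = rho s (T x) (T y)].

Definition push_mor (A' A : augAlg K) (p : augHom A' A) (lam' : deformation dD A')
    (lam : deformation dD A) : Prop :=
  forall s l1 l2, tpush p (lam' s l1 l2) = lam s (tpush p l1) (tpush p l2).

Lemma pushout_mor (A' A : augAlg K) (p : augHom A' A) lam' lam :
  is_pushout p lam' lam -> push_mor p lam' lam.
Proof. by move=> po s l1 l2; have := po s 1 1 l1 l2; rewrite mulr1 !tact1. Qed.

(** The first order part of lam: in the direction alpha of HY^2 it is the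
    chosen cocycle mu alpha. Pulling back along the projections gives such
    data on all the bases C_k from the data defining the deformation over C_1.
    *)
Definition tangent (A : augAlg K) (lam : deformation dD A)
    (v : A -> dual (HY dD 2)) (mu : HY dD 2 -> sub (ZY dD 2)) : Prop :=
  [/\ linear v, forall a b, v (a * b) = aug A a *: v b + aug A b *: v a,
      linear mu, forall alpha, HYclass dD 2 (mu alpha) = alpha
    & forall s x y alpha,
        contract (fun a => val (v a) alpha : K) (lam s (pure 1 x) (pure 1 y)) =
        val (mu alpha) (ytree s) [tuple x; y]].

Section MorLift.
Variables (A' A R' R : augAlg K) (p : augHom A' A) (q : augHom R' R) (E : small_ext q).
Variables (lam' : deformation dD A') (lam : deformation dD A).
Variables (rho' : deformation dD R') (rho : deformation dD R).
Hypotheses (plam : push_mor p lam' lam) (qrho : push_mor q rho' rho).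
Variables (g : augHom A R) (T : D -> tens R D) (mor : def_mor lam rho g T).

Local Notation n := (se_n (s := E)).
Local Notation xi := (se_xi (s := E)).

Lemma aug_se_n i : aug R' (n i) = 0.
Proof. by rewrite -(ahomP q) se_qn rmorph0. Qed.

Lemma se_n_mul0 i j : n i * n j = 0.
Proof. by rewrite se_small aug_se_n scale0r. Qed.

(** The kernel of q has square zero, so derivations into it can be added to
    homomorphisms without spoiling multiplicativity. *)
Lemma hom_add_deriv (g' : augHom A' R') (d : 'I_(se_rank E) -> A' -> K) :
  (forall i, scalar (d i)) ->
  (forall i a b, d i (a * b) = aug A' a * d i b + aug A' b * d i a) ->
  exists g'' : augHom A' R', forall a, g'' a = g' a + \sum_i d i a *: n i.
Proof.
move=> ld dM; have d1 i : d i 1 = 0.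
  have := dM i 1 1; rewrite mulr1 rmorph1 !mul1r => /eqP.
  by rewrite -subr_eq subrr eq_sym => /eqP.
apply: augHom_of => [||a b|a].
- apply: lin_add; first exact: linear_map.
  by apply: lin_big => i; apply: lin_scalel.
- by rewrite rmorph1 big1 ?addr0 // => i _; rewrite d1 scale0r.
- rewrite rmorphM mulrDl !mulrDr -!addrA; congr (_ + _).
  have -> : (\sum_i d i a *: n i) * (\sum_i d i b *: n i) = 0.
    rewrite big_distrl big1 //= => i _; rewrite big_distrr big1 //= => j _.
    by rewrite -scalerAl -scalerAr se_n_mul0 !scaler0.
  rewrite addr0 big_distrr big_distrl -big_split /=; apply: eq_bigr => i _.
  rewrite -scalerAr mulrC -mulrC -scalerAl [n i * _]mulrC !se_small !ahomP.
  by rewrite !scalerA dM scalerDl ![d i _ * _]mulrC.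
- rewrite (scalD (@aug_scalar K R')) ahomP (scal_sum (@aug_scalar K R')) big1 ?addr0 // => i _.
  by rewrite (scalZ (@aug_scalar K R')) aug_se_n mulr0.
Qed.

(** The multiplicative defect of a lift is a family of 2-cocycles. Adding to
    g' the derivations dual to alpha changes their classes by alpha, because
    lam' has the cocycles mu alpha as first order part; alpha is chosen to
    make the classes zero, and the remaining coboundaries are absorbed in T.
    *)
Lemma mor_lift (g' : augHom A' R') v mu :
  (forall a, q (g' a) = g (p a)) -> tangent lam' v mu ->
  exists (g'' : augHom A' R') (T'' : D -> tens R' D),
  [/\ forall a, q (g'' a) = g (p a), forall x, tpush q (T'' x) = T x
    & def_mor lam' rho' g'' T''].
Proof.
move=> sq [lv vM lmu muK vmu]; have [lT eT gT] := mor.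
have [T' [lT' qT' eT']] := se_lift E lT.
have {}eT' x : teps (T' x) = x by rewrite eT'.
have opq s x y : tpush q (pull g' T' (lam' s (pure 1 x) (pure 1 y))) =
    tpush q (rho' s (T' x) (T' y)).
  rewrite (pull_square _ lT lT' sq qT') plam !tpush_pure rmorph1 gT.
  by rewrite qrho !qT'.
pose h i := mdefect (E := E) lam' rho' g' T' i.
have hb i s : bilinear_map (h i s) := mdefect_bilinear (dop_bilinear lam') rho' g' lT' i s.
have hZ i : ZY dD 2 (cochain2 (h i)).
  split; first exact: cochain2_multilinear.
  apply/funext => y; apply/funext => a.
  have := assoc_defect_delta (E := E) (dop_bilinear lam') (def_bilinear lam')
    (def_eps lam') lT' eT' opq i y (pure 1 (tnth a ord0))
    (pure 1 (tnth a (fintype.lift ord0 ord0))) (pure 1 (tnth a ord_max)).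
  rewrite !teps_pure1 assoc_defect0 (lin0 (pull_linear (ahom_linear g') lT')).
  rewrite (lin0 (contract_linear (se_xi_lin i))).
  rewrite (_ : [tuple _; _; _] = a) => [<- //|].
  apply: eq_from_tnth => -[[|[|[|//]]] j3]; rewrite (tnth_nth 0) /=;
    by congr (tnth a _); apply: val_inj.
pose z i : sub (ZY dD 2) := mksub (hZ i).
pose alpha i := - HYclass dD 2 (z i).
(* with this alpha the corrected defects are the coboundaries of the t i *)
have /choice[t tP] i : exists t : cochain D 1, multilinear t /\
    cochain2 (h i) + val (mu (alpha i)) = delta dD t.
  have /HYclass0[t mt tE] : HYclass dD 2 (z i + mu (alpha i)) = 0.
    by rewrite linearD /= muK subrr.
  by exists t; split=> //; rewrite -tE raddfD.
pose tau i x := t i one_tree [tuple x].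
have tup1 x y : upd [tuple x] ord0 y = [tuple y].
  by apply: eq_from_tnth => j; rewrite tnth_mktuple (ord1 j) eqxx (tnth_nth 0).
have ltau i : linear (tau i).
  move=> k x y; have [mt _] := tP i.
  by have := mt one_tree [tuple 0] ord0 k x y; rewrite !tup1.
have tauE i s x y : h i s x y + val (mu (alpha i)) (ytree s) [tuple x; y] =
    dD s x (tau i y) - tau i (dD s x y) + dD s (tau i x) y.
  have [_ tE] := tP i; have := delta1E dD (t i) s [tuple x; y].
  by rewrite -tE /= !(tnth_nth 0) /= => <-; rewrite -(cochain2_ytree (h i) s [tuple x; y]).
pose d i a : K := val (v a) (alpha i).
have ld i : scalar (d i) by move=> k a b; rewrite /d lv dual_evalP.
have dM i a b : d i (a * b) = aug A' a * d i b + aug A' b * d i a.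
  rewrite /d vM (scalD (dual_evalP (alpha i))).
  by rewrite !(scalZ (dual_evalP (alpha i))).
have [g'' g''E] := hom_add_deriv g' ld dM.
pose T'' x := T' x + \sum_i pure (n i) (tau i x).
have lT'' : linear T''.
  by apply: lin_add => //; apply: lin_big => i; apply: lin_comp (pure_linr _).
have qT'' x : tpush q (T'' x) = T x.
  by rewrite (linD (tpush_linear q)) se_tpush0 addr0.
have eT'' x : teps (T'' x) = x by rewrite -(teps_tpush q) qT''.
exists g'', T''; split=> // [a|].
  rewrite g''E (linD (ahom_linear q)) sq (lin_sum (ahom_linear q)) big1 ?addr0 // => i _.
  by rewrite (linZ (ahom_linear q)) se_qn scaler0.
split=> // s x y.
(* the effect on pull of adding derivations to g' and 1-cochains to T' *)
have pullE l : pull g'' T'' l = pull g' T' l +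
    \sum_i pure (n i) (contract (d i) l + tau i (teps l)).
  move: l; apply: (tens_ext (f := pull g'' T'') (g := fun l => pull g' T' l +
    \sum_i pure (n i) (contract (d i) l + tau i (teps l)))) => [||a u].
  - exact: pull_linear (ahom_linear g'') lT''.
  - apply: lin_add; first exact: pull_linear (ahom_linear g') lT'.
    apply: lin_big => i; apply: lin_comp (pure_linr _); apply: lin_add.
      exact: contract_linear.
    exact: lin_comp (@teps_linear K D A') (ltau i).
  - rewrite !pull_pure ?lT' ?lT'' //; try exact: linear_map.
    rewrite g''E (linD (tact_linearl _)) [in LHS](linD (tact_linear (g' a))) -addrA.
    congr (_ + _); rewrite (lin_sum (tact_linearl _)) (lin_sum (tact_linear _)).
    rewrite addrC -big_split /=; apply: eq_bigr => i _.
    rewrite (linZ (tact_linearl _)) tact_socle; last by move=> b; apply: se_small.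
    rewrite eT'' tact_pure se_small ahomP contract_pure // teps_pure (linZ (ltau i)).
    by rewrite (linD (pure_linr _)) !(linZ (pure_linr _)) (linZ (pure_linl _)).
rewrite pullE (mdefectE1 E opq) -addrA -big_split /=.
have [rr rl] := dop_bilinear rho' s.
have sum0 (u : D) : teps (\sum_i pure (n i) (tau i u)) = 0.
  by rewrite -(teps_tpush q) se_tpush0 (lin0 (@teps_linear K D R)).
have rx : rho' s (T'' x) (T'' y) = rho' s (T' x) (T'' y) +
    \sum_i rho' s (pure (n i) (tau i x)) (T'' y).
  by rewrite -(lin_sum (rl (T'' y))) -(linD (rl (T'' y))).
have ry : rho' s (T' x) (T'' y) = rho' s (T' x) (T' y) +
    \sum_i rho' s (T' x) (pure (n i) (tau i y)).
  by rewrite -(lin_sum (rr _)) -(linD (rr _)).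
rewrite rx ry -addrA; congr (_ + _).
rewrite -big_split /=; apply: eq_bigr => i _.
rewrite def_se_nr def_se_nl eT' eT'' -!(linD (pure_linr _)); congr pure.
rewrite def_eps !teps_pure1 vmu addrA tauE.
by rewrite addrAC subrK.
Qed.

End MorLift.
End Morphisms.

(** * Lifting homomorphisms of bases *)

Lemma harr_evalB (K : fieldType) (A : augAlg K) (M : lmodType K)
    (z z' : sub (ZHarr A M)) a b : val (z - z') a b = val z a b - val z' a b.
Proof. by rewrite raddfB. Qed.

Lemma ext_mul1E (K : fieldType) (A : augAlg K) (M : lmodType K)
    (f : sub (ZHarr A M)) (u v : ext_alg f) : (u * v).1 = u.1 * v.1.
Proof. by []. Qed.

Lemma ext_mul2E (K : fieldType) (A : augAlg K) (M : lmodType K)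
    (f : sub (ZHarr A M)) (u v : ext_alg f) :
  (u * v).2 = aug A u.1 *: v.2 + aug A v.1 *: u.2 + val f u.1 v.1.
Proof. by []. Qed.

Lemma dual_cocycleE (K : fieldType) (A : augAlg K)
    (mu : {linear H2Harr A K^o -> sub (ZHarr A K^o)}) a b h :
  val (val (dual_cocycle mu) a b) h = val (mu h) a b.
Proof. by []. Qed.

Section HomLift.
Variables (K : fieldType) (D : lmodType K) (dD : dialgebra D).
Variables (A R' R : augAlg K) (q : augHom R' R) (E : small_ext q).
Variables (lam : deformation dD A).
Variables (rho' : deformation dD R') (rho : deformation dD R).
Hypotheses (qrho : push_mor q rho' rho).
Variables (g : augHom A R) (T : D -> tens R D) (mor : def_mor lam rho g T).

Local Notation n := (se_n (s := E)).
Local Notation xi := (se_xi (s := E)).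

Let lift0 (a : A) : R' := se_sec E (g a).
Let def0 (a b : A) : R' := lift0 a * lift0 b - lift0 (a * b).

Lemma lift0_lin : linear lift0.
Proof. exact: lin_comp (ahom_linear g) (se_sec_lin E). Qed.

Lemma q_lift0 a : q (lift0 a) = g a.
Proof. exact: se_secK. Qed.

Lemma aug_lift0 a : aug R' (lift0 a) = aug A a.
Proof. by rewrite -(ahomP q) q_lift0 ahomP. Qed.

Lemma q_def0 a b : q (def0 a b) = 0.
Proof. by rewrite (linB (ahom_linear q)) ahomM !q_lift0 ahomM subrr. Qed.

Lemma se_ker (u : R') : q u = 0 -> u = \sum_i xi i u *: n i.
Proof. by move=> u0; rewrite -se_dec u0 (lin0 (se_sec_lin E)) subr0. Qed.

Lemma se_ker_small a (u : R') : q u = 0 -> a * u = aug R' a *: u.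
Proof.
move=> /se_ker ->; rewrite big_distrr scaler_sumr /=; apply: eq_bigr => i _.
by rewrite -scalerAr se_small !scalerA mulrC.
Qed.

Let harr0 i (a b : A) : K^o := xi i (def0 a b).

(** The multiplicative defect of a linear lift of g is a Harrison cocycle, by
    associativity in R'. *)
Lemma harr0_cocycle i : ZHarr A K^o (harr0 i).
Proof.
have l0 := lift0_lin; have lx := se_xi_lin i.
split=> [|a b|a b c].
- split=> [a k b c|c k a b]; rewrite /harr0 -[RHS]lx; congr (xi i _).
    by rewrite /def0 mulrDr -scalerAr l0 l0 mulrDr -scalerAr scalerBr opprD addrACA.
  by rewrite /def0 mulrDl -scalerAl l0 l0 mulrDl -scalerAl scalerBr opprD addrACA.
- by rewrite /harr0 /def0 mulrC [a * b]mulrC.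
- rewrite /harr0 -!(linZ (V := K^o) lx) -!aug_lift0.
  rewrite -!se_ker_small ?q_def0 // -(linB (V := K^o) lx) -(linD (V := K^o) lx).
  rewrite -(linB (V := K^o) lx) -[RHS](lin0 (V := K^o) lx); congr (xi i _).
  rewrite /def0 mulrA; ring.
Qed.

Variables (A' : augAlg K) (p : augHom A' A) (lam' : deformation dD A').
Hypothesis nextA : is_next p lam lam'.

(** The extension of A is universal: the classes h i of the extension pulled
    back from R' give, after correcting the linear lift by the 1-cochains w i,
    a homomorphism G to R'. The ideal killed to form A' consists of the m =
    zeta o omega, on which G has the coordinates zeta (omega (h i)). These
    vanish since R' does carry a deformation: omega (h i) is the class of the
    i-th coordinate of the obstruction cocycle, which [assoc_defect_delta]
    shows to be a coboundary. *)
Lemma hom_lift : exists g' : augHom A' R', forall a, q (g' a) = g (p a).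
Proof.
have [lT eT gT] := mor; have l0 := lift0_lin.
have [mu [theta [omega]]] := nextA; cbv zeta.
move=> [pi [muK obs omE [pis pik] [ppi pout]]].
pose z i : sub (ZHarr A K^o) := mksub (harr0_cocycle i).
pose h i := H2class A K^o (z i).
have /choice[w wP] i : exists w : A -> K^o, linear w /\ forall a b,
    val (mu (h i)) a b - harr0 i a b = aug A a *: w b - w (a * b) + aug A b *: w a.
  have /H2class0[w lw wE] : H2class A K^o (mu (h i) - z i) = 0.
    by rewrite (linB (linear_map (H2class A K^o))) muK subrr.
  exists w; split=> [|a b]; first exact: lw.
  by rewrite -wE harr_evalB.
have lw i : scalar (w i) by have [] := wP i.
have {wP}wP i a b : aug A a * w i b + aug A b * w i a =
    w i (a * b) + (val (mu (h i)) a b - xi i (def0 a b)).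
  have [_ /(_ a b)] := wP i; rewrite -[xi i _]/(harr0 i a b) => ->.
  rewrite -!/(_ *: _ : K^o); rewrite -![aug A _ *: _]/(aug A _ * _ : K); ring.
set f := dual_cocycle mu in theta obs omE pi pik pis ppi.
pose G (u : ext_alg f) : R' := lift0 u.1 + \sum_i (w i u.1 + val u.2 (h i)) *: n i.
have lG : linear G.
  apply: lin_add; first by move=> k a b; rewrite -l0.
  apply: lin_big => i; apply: lin_scalel => k a b.
  rewrite (lw i k a.1 b.1 : w i (k *: a + b).1 = _).
  rewrite (dual_evalP (h i) k a.2 b.2 : val (k *: a + b).2 (h i) = _).
  by rewrite mulrDr addrACA.
have qG u : q (G u) = g (ext_proj u).
  rewrite (linD (ahom_linear q)) q_lift0 (lin_sum (ahom_linear q)) big1 ?addr0 // => i _.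
  by rewrite (linZ (ahom_linear q)) se_qn scaler0.
have GM u v : G (u * v) = G u * G v.
  rewrite /G ext_mul1E ext_mul2E; move: u.1 u.2 v.1 v.2 => a m b m'.
  have nn i j : n i * n j = 0 by apply: se_n_mul0.
  set Sab := \sum_i _; set Sa := \sum_i _; set Sb := \sum_i _.
  have SS : Sa * Sb = 0.
    rewrite big_distrl big1 //= => i _; rewrite big_distrr big1 //= => j _.
    by rewrite -scalerAl -scalerAr nn !scaler0.
  have key : Sab = def0 a b + lift0 a * Sb + lift0 b * Sa.
    rewrite (se_ker (q_def0 a b)) !big_distrr -!big_split /=.
    apply: eq_bigr => i _.
    rewrite -!scalerAr !se_small !aug_lift0 !scalerA -!scalerDl; congr (_ *: _).
    rewrite !(scalD (dual_evalP (h i))) !(scalZ (dual_evalP (h i))) dual_cocycleE.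
    have e := canRL (addrK _) (wP i a b).
    rewrite ![_ * aug A _]mulrC !mulrDr e.
    by rewrite -[sub_val m]/(val m) -[sub_val m']/(val m'); ring.
  by rewrite key mulrDl !mulrDr SS /def0; ring.
have eG u : aug R' (G u) = aug _ u by rewrite -(ahomP q) qG ahomP.
(* G 1 - 1 lies in ker q, on which G 1 acts as 1, and G 1 is idempotent *)
have G1 : G 1 = 1.
  have q1 : q (G 1 - 1) = 0 by rewrite (linB (ahom_linear q)) qG [ext_proj _]/(1 : A) !ahom1 subrr.
  have := se_ker_small (G 1) q1; rewrite eG rmorph1 scale1r mulrBr -GM !mulr1 subrr.
  by move/esym/eqP; rewrite subr_eq0 => /eqP.
have [G' G'E] := augHom_of lG G1 GM eG.
have [T' [lT' qT' eT']] := se_lift E lT.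
have {}eT' x : teps (T' x) = x by rewrite eT'.
have [pE pEE] : exists pE : augHom (ext_alg f) A, forall u, pE u = ext_proj u.
  by apply: augHom_of.
have om0 i : omega (h i) = 0.
  have [br brl [phi phiE thE]] := obs.
  rewrite omE thE (contract_mapr phi (linear_map (HYclass dD 3)) (dual_evalP (h i))).
  apply/HYclass0; exists (cochain2 (mdefect (E := E) br rho' G' T' i)).
    apply: cochain2_multilinear => s; apply: mdefect_bilinear => // s'.
    by have [[]] := brl s'.
  have brb s : bilinear_map (br s) by have [[]] := brl s.
  have bra s : act_bilinear (@tact K D (ext_alg f)) (br s) by have [[]] := brl s.
  have PE : tens_map (@ext_proj K A _ f) (@idfun D) = tpush pE.
    by rewrite /tpush; congr (tens_map _ _); apply/funext => u; rewrite pEE.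
  have brP s l1 l2 : tpush pE (br s l1 l2) = lam s (tpush pE l1) (tpush pE l2).
    by rewrite -PE; have [_ ->] := brl s.
  have bre s l1 l2 : teps (br s l1 l2) = dD s (teps l1) (teps l2).
    by rewrite -(teps_tpush pE) brP def_eps !teps_tpush.
  have brq s x y : tpush q (pull G' T' (br s (pure 1 x) (pure 1 y))) =
      tpush q (rho' s (T' x) (T' y)).
    have sq u : q (G' u) = g (pE u) by rewrite G'E qG pEE.
    by rewrite (pull_square _ lT lT' sq qT') brP !tpush_pure ahom1 gT qrho !qT'.
  (* contracting with h i is taking the i-th coordinate after applying G *)
  have IE (t : tens (dual (H2Harr A K^o)) D) :
      contract (fun m : dual (H2Harr A K^o) => val m (h i) : K) t =
      contract (xi i) (pull G' T' (tens_map (@ext_inj K A _ f) idfun t)).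
    have lI : linear (@ext_inj K A _ f).
      by move=> k m m'; congr pair; rewrite /= scaler0 addr0.
    have lX := contract_linear (V := D) (se_xi_lin i).
    move: t; apply: (tens_ext (g := fun t => contract (xi i)
       (pull G' T' (tens_map (@ext_inj K A _ f) idfun t)))) => [||m x].
    - exact/contract_linear/dual_evalP.
    - apply: lin_comp lX; apply: lin_comp (pull_linear (ahom_linear G') lT').
      exact: tens_map_linear.
    - rewrite contract_pure; last exact: dual_evalP.
      rewrite tens_map_pure // pull_pure //; last exact: ahom_linear.
      have -> : G' (ext_inj f m) = \sum_j val m (h j) *: n j.
        rewrite G'E /G /= (lin0 l0) add0r; apply: eq_bigr => j _.
        by rewrite (scal0 (lw j)) add0r.
      rewrite (lin_sum (tact_linearl _)) -(se_contract i (fun j => val m (h j) *: x)).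
      congr (contract _ _); apply: eq_bigr => j _.
      rewrite (linZ (tact_linearl _)) tact_socle; last by move=> b; apply: se_small.
      by rewrite eT' (linZ (pure_linr _)).
  apply/funext => y; apply/funext => a.
  pose l j : tens (ext_alg f) D := pure 1 (tnth a j).
  pose ev (z : sub (ZY dD 3)) := val z y a.
  have lev : linear ev by move=> k z1 z2; rewrite /ev linearP.
  rewrite -[LHS]/(ev _) -(contract_mapr phi lev (dual_evalP (h i))) IE.
  have := phiE y (l ord0) (l (fintype.lift ord0 ord0)) (l ord_max).
  have aE : [tuple teps (l ord0); teps (l (fintype.lift ord0 ord0)); teps (l ord_max)] = a.
    apply: eq_from_tnth => -[[|[|[|//]]] j3]; rewrite (tnth_nth 0) /= teps_pure1;
    by congr (tnth a _); apply: val_inj.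
  rewrite aE -/ev => ->.
  have -> : lifting_defect br (sval y) (l ord0) (l (fintype.lift ord0 ord0)) (l ord_max)
     = assoc_defect br (sval y) (l ord0) (l (fintype.lift ord0 ord0)) (l ord_max).
    by elim/Y3_ind: (y).
  by rewrite (assoc_defect_delta (E := E) brb bra bre lT' eT' brq) aE.
have kerG u : pi u = 0 -> G u = 0.
  move/pik => [zeta [m -> mE]]; rewrite /G /= (lin0 l0) add0r big1 // => i _.
  by rewrite (scal0 (lw i)) add0r mE om0 (scal0 (dual_linear zeta)) scale0r.
have [g' lg' g'E] := lin_factor (ahom_linear pi) lG pis kerG.
have [g'' g''E] : exists g'' : augHom A' R', forall a, g'' a = g' a.
  apply: augHom_of => // [|a b|a].
  - by rewrite -(ahom1 pi) g'E G1.
  - by have [u <-] := pis a; have [v <-] := pis b; rewrite -ahomM !g'E GM.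
  - by have [u <-] := pis a; rewrite g'E eG ahomP.
exists g'' => a; rewrite g''E; have [u <-] := pis a.
by rewrite g'E qG ppi.
Qed.

End HomLift.

(** * Powers of the maximal ideal *)

Section Mpow.
Variables (K : fieldType).
Implicit Types A : augAlg K.

Lemma smemD (V : lmodType K) (S : subspace V) x y : S x -> S y -> S (x + y).
Proof. by move=> Sx Sy; rewrite -[x]scale1r; apply: smemP. Qed.

Lemma smemZ (V : lmodType K) (S : subspace V) a x : S x -> S (a *: x).
Proof. by move=> Sx; rewrite -[_ *: _]addr0; apply: smemP => //; apply: smem0. Qed.

Lemma smemN (V : lmodType K) (S : subspace V) x : S x -> S (- x).
Proof. by move=> Sx; rewrite -scaleN1r; apply: smemZ. Qed.

Lemma smem_sum (V : lmodType K) (S : subspace V) n (f : 'I_n -> V) :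
  (forall i, S (f i)) -> S (\sum_i f i).
Proof. by move=> Sf; elim/big_ind: _ => //; [apply: smem0|apply: smemD]. Qed.

Lemma qpi0 (V : lmodType K) (S : subspace V) x : qpi S x = 0 <-> S x.
Proof.
rewrite -(linear0 (qpi S)); split=> [/qpiP/asboolP|Sx]; first by rewrite subr0.
by apply/qpiP/asboolP; rewrite subr0.
Qed.

Lemma mpow0 A x : mpow A 0 x.
Proof. by move=> W; apply. Qed.

Lemma mpowM1 A n a b : aug A a = 0 -> mpow A n b -> mpow A n.+1 (a * b).
Proof. by move=> a0 mb W; apply; exists a, b. Qed.

Lemma mpow1 A x : mpow A 1 x <-> aug A x = 0.
Proof.
split=> [|x0]; last by rewrite -[x]mulr1; apply: mpowM1 => //; apply: mpow0.
have S0 : aug A 0 = 0 by rewrite linear0.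
have SP (a : K) u v : aug A u = 0 -> aug A v = 0 -> aug A (a *: u + v) = 0.
  by move=> hu hv; rewrite linearP /= hu hv mulr0 addr0.
move/(_ (Subspace S0 SP)); apply=> _ [a [b [a0 _ ->]]] /=.
by rewrite rmorphM /= a0 mul0r.
Qed.

Lemma mpow_le A i j x : (i <= j)%N -> mpow A j x -> mpow A i x.
Proof. by move=> ij; rewrite -(subnK ij); elim: (j - i)%N => //= m IH /mpowS. Qed.

Lemma mpow_ind A n (P : A -> Prop) : P 0 -> (forall (a : K) u v, P u -> P v -> P (a *: u + v)) ->
  (forall a b, aug A a = 0 -> mpow A n b -> P (a * b)) ->
  forall x, mpow A n.+1 x -> P x.
Proof.
move=> P0 PP PM x /(_ (Subspace P0 PP)); apply=> _ [a [b [a0 mb ->]]].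
exact: PM.
Qed.

Lemma mpowM A i j x y : mpow A i x -> mpow A j y -> mpow A (i + j) (x * y).
Proof.
elim: i x => [|i IH] x mx my; first exact: mpow_mull.
move: x mx; apply: (mpow_ind (P := fun x => mpow A (i.+1 + j) (x * y)))
  => [|a u v hu hv|a b a0 mb].
- by rewrite mul0r; apply: smem0.
- by rewrite mulrDl -scalerAl; apply: smemP.
- by rewrite -mulrA; apply: mpowM1 => //; apply: IH.
Qed.

Lemma mpow_surj A A' (f : augHom A A') n y : (forall b, exists a, f a = b) ->
  mpow A' n y -> exists2 x, mpow A n x & f x = y.
Proof.
move=> sf; elim: n y => [|n IH] y.
  by have [x <-] := sf y; exists x => //; apply: mpow0.
move: y; apply: (mpow_ind (P := fun y => exists2 x, mpow A n.+1 x & f x = y))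
  => [|a _ _ [u mu <-] [v mv <-]|a b a0 /IH[v mv <-]].
- by exists 0; [apply: smem0|apply: (lin0 (ahom_linear f))].
- by exists (a *: u + v); [apply: smemP|apply: ahom_linear].
- have [u ua] := sf a; exists (u * v); last by rewrite ahomM ua.
  by apply: mpowM1 => //; rewrite -(ahomP f) ua.
Qed.

Definition mgens A r (t : 'I_r -> A) : Prop := (forall i, aug A (t i) = 0) /\
  forall a, aug A a = 0 -> exists c : 'I_r -> A, a = \sum_i t i * c i.

Lemma mpow_gens A r (t : 'I_r -> A) n x : mgens t -> mpow A n.+1 x ->
  exists c : 'I_r -> A, (forall i, mpow A n (c i)) /\ x = \sum_i t i * c i.
Proof.
move=> [t0 tg]; move: x; apply: (mpow_ind (P := fun x =>
  exists c : 'I_r -> A, (forall i, mpow A n (c i)) /\ x = \sum_i t i * c i))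
  => [|a _ _ [c [mc ->]] [d [md ->]]|a b a0 mb].
- exists (fun=> 0); split=> [i|]; first exact: smem0.
  by rewrite big1 // => i _; rewrite mulr0.
- exists (fun i => a *: c i + d i); split=> [i|]; first exact: smemP.
  rewrite scaler_sumr -big_split; apply: eq_bigr => i _.
  by rewrite mulrDr scalerAr.
- have [c ->] := tg a a0; exists (fun i => c i * b); split=> [i|]; first exact: mpow_mull.
  by rewrite mulr_suml; apply: eq_bigr => i _; rewrite mulrA.
Qed.

(** Nakayama's lemma when the maximal ideal is nilpotent: the error terms are
    pushed into higher and higher powers. *)
Lemma mgens_nil A r (t : 'I_r -> A) N : (forall x, mpow A N x -> x = 0) ->
  (forall i, aug A (t i) = 0) ->
  (forall a, aug A a = 0 -> exists c : 'I_r -> K, mpow A 2 (a - \sum_i c i *: t i)) ->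
  mgens t.
Proof.
move=> nil t0 tg; split=> // a a0.
have step j x : mpow A j.+1 x -> exists c : 'I_r -> A, mpow A j.+2 (x - \sum_i t i * c i).
  move: x; apply: (mpow_ind (P := fun x =>
    exists c : 'I_r -> A, mpow A j.+2 (x - \sum_i t i * c i))) => [|k u v [c mc] [d md]|b y b0 my].
  - exists (fun=> 0); rewrite big1 ?subrr; first exact: smem0.
    by move=> i _; rewrite mulr0.
  - exists (fun i => k *: c i + d i).
    have -> : \sum_i t i * (k *: c i + d i) = k *: (\sum_i t i * c i) + \sum_i t i * d i.
      by rewrite scaler_sumr -big_split; apply: eq_bigr => i _; rewrite mulrDr scalerAr.
    by rewrite opprD addrACA -scalerBr; apply: smemP.
  - have [c mc] := tg b b0; exists (fun i => c i *: y).
    have -> : \sum_i t i * (c i *: y) = (\sum_i c i *: t i) * y.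
      by rewrite mulr_suml; apply: eq_bigr => i _; rewrite -scalerAr scalerAl.
    by rewrite -mulrBl; apply: (mpowM mc my).
have H j : exists c : 'I_r -> A, mpow A j.+1 (a - \sum_i t i * c i).
  elim: j => [|j [c mc]].
    exists (fun=> 0); apply/mpow1; rewrite big1 ?subr0 // => i _.
    by rewrite mulr0.
  have [d md] := step _ _ mc; exists (fun i => c i + d i).
  rewrite (_ : \sum_i t i * (c i + d i) = \sum_i t i * c i + \sum_i t i * d i).
    by rewrite opprD addrA.
  by rewrite -big_split; apply: eq_bigr => i _; rewrite mulrDr.
have [c mc] := H N; exists c; apply/eqP; rewrite -subr_eq0; apply/eqP/nil.
exact: mpow_le mc.
Qed.

(** A is the sum of the scalars and of the t_i A, so the quotient by the power
    n + 1 is a quotient of K plus r copies of the quotient by the power n. *)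
Lemma fin_dim_mpow A r (t : 'I_r -> A) n : mgens t -> fin_dim (quot (mpow A n)).
Proof.
move=> tg; have [t0 tP] := tg; elim: n => [|n IH].
  apply: (@fin_dim_surj _ K^o _ (fun=> 0)); last exact: fin_dim_scalar.
    by move=> a u v; rewrite scaler0 addr0.
  by elim/quotI => x; exists 0; apply/esym/qpi0/mpow0.
have mt i x : mpow A n x -> mpow A n.+1 (t i * x) by apply: mpowM1.
pose e (u : (K^o * ('I_r -> quot (mpow A n)))%type) : quot (mpow A n.+1) :=
  (u.1 : K) *: qpi _ 1 + \sum_i @quot_map _ _ _ (mpow A n) (mpow A n.+1) (fun x => t i * x) (u.2 i).
apply: (@fin_dim_surj _ _ _ e); last first.
- by apply: fin_dim_prod; [apply: fin_dim_scalar|apply: fin_dim_fun].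
- elim/quotI => x; have [|c xE] := tP (x - (aug A x)%:A).
    by rewrite linearB linearZ /= rmorph1 mulr1 subrr.
  exists (aug A x, fun i => qpi _ (c i)); rewrite /e /=.
  rewrite -linearZ /=; under eq_bigr => i _ do rewrite (quot_mapE (mull_linear (t i)) (@mt i)).
  by rewrite -linear_sum -xE -linearD /= addrC subrK.
- move=> k u v; rewrite /e /= scalerDl scalerDr scalerA addrACA; congr (_ + _).
  rewrite scaler_sumr -big_split; apply: eq_bigr => i _.
  exact: (quot_map_linear (mull_linear (t i)) (@mt i) k (u.2 i) (v.2 i)).
Qed.

Lemma derivation1 A (M : lmodType K) (d : A -> M) :
  (forall a b, d (a * b) = aug A a *: d b + aug A b *: d a) -> d 1 = 0.
Proof.
move=> dM; have := dM 1 1; rewrite mulr1 rmorph1 !scale1r => /eqP.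
by rewrite -subr_eq subrr eq_sym => /eqP.
Qed.

(** Linear forms that vanish at 1 and on the square of the maximal ideal are
    the tangent vectors of A. *)
Lemma form_derivation A (chi : A -> K) : scalar chi -> chi 1 = 0 ->
  (forall y, mpow A 2 y -> chi y = 0) ->
  forall a b, chi (a * b) = aug A a * chi b + aug A b * chi a.
Proof.
move=> lchi chi1 chi2 a b; have dec c : exists2 c', aug A c' = 0 & c = (aug A c)%:A + c'.
  exists (c - (aug A c)%:A); last by rewrite addrC subrK.
  by rewrite linearB linearZ /= rmorph1 mulr1 subrr.
have [a' a0 aE] := dec a; have [b' b0 bE] := dec b.
rewrite {1 3}aE {1 2}bE mulrDl !mulrDr !(scalD lchi).
rewrite -!scalerAl !mul1r -scalerAr mulr1 !(scalZ lchi) chi1 !mulr0 !add0r.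
rewrite (chi2 (a' * b')) ?addr0 //; apply: mpowM1 => //.
exact/mpow1.
Qed.

Lemma fin_dim_subquot (V : lmodType K) (S U : subspace V) :
  fin_dim (quot U) -> fin_dim (subquot S U).
Proof.
have lv : linear (val : sub S -> V) by apply: linear_map.
have vS x : trace S U x -> U (val x) by [].
apply: (@fin_dim_inj _ _ _ (@quot_map _ _ _ (trace S U) U val)).
  exact: quot_map_linear lv vS.
elim/quotI => x; elim/quotI => y; rewrite !(quot_mapE lv vS) => /qpiP xy.
by apply/qpiP/asboolP; move/asboolP: xy; rewrite /= /trace_mem (linB lv).
Qed.

Lemma fin_dim_quot_ext (V : lmodType K) (S U : subspace V) : (forall x, U x -> S x) ->
  fin_dim (quot S) -> fin_dim (subquot S U) -> fin_dim (quot U).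
Proof.
move=> US [s sP] fSU.
have lv : linear (val : sub S -> V) by apply: linear_map.
have vS x : trace S U x -> U (val x) by [].
have lS := @qpi_linear K V S; have lU := @qpi_linear K V U.
pose e (u : (subquot S U * ('I_(size s) -> K^o))%type) : quot U :=
  @quot_map _ _ _ (trace S U) U val u.1 + \sum_i (u.2 i : K) *: qpi U (qrepr s`_i).
apply: (@fin_dim_surj _ _ _ e).
- move=> k u v; rewrite /e (quot_map_linear lv vS) scalerDr addrACA; congr (_ + _).
  rewrite scaler_sumr -big_split; apply: eq_bigr => i _.
  by rewrite scalerDl scalerA.
- elim/quotI => x; have [c xE] := sP (qpi S x).
  have Sx : S (x - \sum_i c i *: qrepr s`_i).
    apply/qpi0; rewrite (linB lS) xE (lin_sum lS); apply/eqP; rewrite subr_eq0; apply/eqP.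
    by apply: eq_bigr => i _; rewrite (linZ lS) qreprK.
  exists (qpi _ (mksub Sx), c); rewrite /e /= (quot_mapE lv vS) /= (linB lU) (lin_sum lU).
  under [X in _ + X]eq_bigr => i _ do rewrite -(linZ lU).
  by rewrite subrK.
- by apply: fin_dim_prod => //; apply/fin_dim_fun/fin_dim_scalar.
Qed.

(** The inverse is given by the geometric series in 1 - a / aug a. *)
Lemma nil_unit A N a : (forall x, mpow A N x -> x = 0) -> aug A a != 0 ->
  exists b, a * b = 1.
Proof.
move=> nil a0; pose z := 1 - (aug A a)^-1 *: a.
have z0 : aug A z = 0 by rewrite linearB linearZ /= rmorph1 mulVf // subrr.
have mz n : mpow A n (z ^+ n).
  elim: n => [|n IH]; first exact: mpow0.
  by rewrite exprS; apply: mpowM1.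
exists ((aug A a)^-1 *: \sum_(i < N) z ^+ i).
have -> : a * ((aug A a)^-1 *: \sum_(i < N) z ^+ i) = (1 - z) * \sum_(i < N) z ^+ i.
  by rewrite -scalerAr scalerAl; congr (_ * _); rewrite /z opprB addrC subrK.
by rewrite -opprB mulNr -subrX1 (nil _ (mz N)) sub0r opprK.
Qed.

End Mpow.

(** * One step of the construction *)

Lemma ext_small (K : fieldType) (A : augAlg K) (M : lmodType K) (f : sub (ZHarr A M))
    (u v : ext_alg f) : v.1 = 0 -> u * v = aug _ u *: v.
Proof.
case: v => b m /= ->; have [[fl _] _ _] := smem_val f.
congr pair; rewrite /= ?mulr0 ?scaler0 // linear0 scale0r addr0.
by rewrite (lin0 (fl u.1)) addr0.
Qed.

Lemma ext_mul_split (K : fieldType) (A : augAlg K) (M : lmodType K)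
    (f : sub (ZHarr A M)) (a b : A) :
  ((a, 0) : ext_alg f) * ((b, 0) : ext_alg f) =
  ((a * b, 0) : ext_alg f) + ext_inj f (val f a b).
Proof. by congr pair; rewrite /= ?addr0 // !scaler0 !add0r. Qed.

Section OneStep.
Variables (K : fieldType) (D : lmodType K) (dD : dialgebra D).

(** A Harrison cocycle is determined by its values on a basis of A. *)
Lemma fin_dim_H2Harr (A : augAlg K) : fin_dim A -> fin_dim (H2Harr A K^o).
Proof.
move=> fA; have [n [e [c [lc cE _]]]] := fin_dim_basis fA.
apply: (fin_dim_quot (V := sub (ZHarr A K^o))).
apply: (@fin_dim_inj _ _ 'M[K]_n (fun z : sub (ZHarr A K^o) =>
  \matrix_(i, j) (val z (e i) (e j) : K))); last exact: vect_fin_dim.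
  move=> k z z'; apply/matrixP => i j; rewrite !mxE.
  by have -> := linearP (val : sub (ZHarr A K^o) -> _) k z z'.
move=> z z' zz'; apply/val_inj/funext => a; apply/funext => b.
have [[zl zr] _ _] := smem_val z; have [[zl' zr'] _ _] := smem_val z'.
rewrite (cE a) (cE b) (lin_sum (zl _)) (lin_sum (zl' _)); apply: eq_bigr => j _.
rewrite (linZ (zl _)) (linZ (zl' _)) (lin_sum (zr _)) (lin_sum (zr' _)).
congr (_ *: _); apply: eq_bigr => i _.
rewrite (linZ (zr _)) (linZ (zr' _)); congr (_ *: _).
by have := congr1 (fun m : 'M_n => m i j) zz'; rewrite !mxE.
Qed.

Variables (A' A : augAlg K) (p : augHom A' A).
Variables (lam : deformation dD A) (lam' : deformation dD A').
Hypothesis nextA : is_next p lam lam'.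

Lemma next_push : push_mor p lam' lam.
Proof.
by have [mu [theta [omega [pi [_ _ _ _ [_ po]]]]]] := nextA; apply: pushout_mor.
Qed.

Lemma next_surj b : exists a, p a = b.
Proof.
have [mu [theta [omega [pi [_ _ _ [pis _] [ppi _]]]]]] := nextA.
by exists (pi ((b, 0) : ext_alg _)); rewrite ppi.
Qed.

Lemma next_fin : fin_dim A -> fin_dim A'.
Proof.
move=> fA; have [mu [theta [omega [pi [_ _ _ [pis _] [ppi _]]]]]] := nextA.
apply: (fin_dim_surj (ahom_linear pi) pis).
apply: (fin_dim_prod fA); apply: fin_dim_dual; exact: fin_dim_H2Harr.
Qed.

Lemma next_small a n : p n = 0 -> a * n = aug A' a *: n.
Proof.
have [mu [theta [omega [pi [_ _ _ [pis _] [ppi _]]]]]] := nextA.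
have [u <-] := pis a; have [v <-] := pis n; rewrite ppi => v0.
by rewrite -ahomM ahomP -(linZ (ahom_linear pi)) ext_small.
Qed.

(** The extension has no redundant direction. Otherwise some linear form chi
    vanishes at 1 and on the square of the maximal ideal of A' but not at x in
    ker p; being a derivation, chi exhibits as a coboundary the cocycle mu h
    obtained from its restriction to the kernel. Hence h = 0, so chi x = 0. *)
Lemma next_ker_mpow2 x : fin_dim A -> p x = 0 -> mpow A' 2 x.
Proof.
move=> fA px; apply: contrapT => nx.
have ax : aug A' x = 0 by rewrite -(ahomP p) px linear0.
(* the span of 1 and of the square of the maximal ideal *)
have W0 : exists c : K, mpow A' 2 (0 - c%:A) by exists 0; rewrite scale0r subr0; apply: smem0.
have WP (k : K) u v : (exists c : K, mpow A' 2 (u - c%:A)) ->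
    (exists c : K, mpow A' 2 (v - c%:A)) -> exists c : K, mpow A' 2 (k *: u + v - c%:A).
  move=> [c mc] [d md]; exists (k * c + d).
  by rewrite scalerDl -scalerA opprD addrACA -scalerBr; apply: smemP.
have nW : ~ Subspace W0 WP x.
  move=> [c /= mc]; apply: nx; suff c0 : c = 0 by rewrite c0 scale0r subr0 in mc.
  have /mpow1 := mpow_le (leqnSn 1) mc.
  by rewrite linearB linearZ /= rmorph1 mulr1 ax sub0r => /eqP; rewrite oppr_eq0 => /eqP.
have [chi lchi [chix chiW]] := fin_dim_sep (next_fin fA) nW.
have chi1 : chi 1 = 0 by apply: chiW; exists 1; rewrite scale1r subrr; apply: smem0.
have chi2 y : mpow A' 2 y -> chi y = 0.
  by move=> my; apply: chiW; exists 0; rewrite scale0r subr0.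
have chiM := form_derivation lchi chi1 chi2.
have [mu [theta [omega [pi [muK _ _ [pis _] [ppi _]]]]]] := nextA.
set f := dual_cocycle mu in pi pis ppi.
have [u xE] := pis x; have u0 : u.1 = 0 by rewrite -[u.1]/(ext_proj u) -ppi xE.
have linj : linear (@ext_inj K A _ f).
  by move=> k m m'; congr pair; rewrite /= scaler0 addr0.
have [|h hE] := dual_reflexive (chi := fun m => chi (pi (ext_inj f m))) (fin_dim_H2Harr fA).
  by move=> k m m'; rewrite linj (ahom_linear pi) lchi.
(* the cocycle mu h is the coboundary of a |-> chi (pi (a, 0)) *)
have h0 : h = 0.
  rewrite -(muK h); apply/H2class0; exists (fun a => chi (pi ((a, 0) : ext_alg f))).
    move=> k a b; rewrite -[RHS]lchi -(ahom_linear pi); congr (chi (pi _)).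
    by congr pair; rewrite /= scaler0 addr0.
  move=> a b; have := chiM (pi ((a, 0) : ext_alg f)) (pi ((b, 0) : ext_alg f)).
  rewrite -ahomM !ahomP -dual_cocycleE -hE.
  rewrite ext_mul_split (linD (ahom_linear pi)) (scalD lchi) => /(canRL (addKr _)) ->.
  rewrite addrC addrAC; congr (_ + _); exact: addrAC.
have xm : x = pi (ext_inj f u.2) by rewrite -xE; case: u u0 {xE} => a m /= ->.
have chi0 : chi x = 0 by rewrite xm hE h0; exact: (scal0 (dual_linear u.2)).
by move/eqP: chix; rewrite chi0 eq_sym oner_eq0.
Qed.

Lemma next_nil n : (forall x, mpow A n.+1 x -> x = 0) -> forall x, mpow A' n.+2 x -> x = 0.
Proof.
move=> nil; apply: (mpow_ind (P := fun x => x = 0)) => // [k u v -> ->|a b a0 mb].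
  by rewrite scaler0 addr0.
by rewrite next_small ?a0 ?scale0r //; apply: nil; apply: mpow_hom.
Qed.

End OneStep.

Section FirstStep.
Variables (K : fieldType) (D : lmodType K) (dD : dialgebra D).

Lemma tangent_push (A' A : augAlg K) (p : augHom A' A) (lam : deformation dD A)
    (lam' : deformation dD A') v mu :
  push_mor p lam' lam -> tangent lam v mu -> tangent lam' (v \o p) mu.
Proof.
move=> po [lv vM lmu muK vmu]; split=> //.
- exact: lin_comp (ahom_linear p) lv.
- by move=> a b /=; rewrite ahomM vM !ahomP.
- move=> s x y alpha; rewrite -vmu.
  have e u : tpush p (pure 1 u) = pure 1 u :> tens A D by rewrite tpush_pure ahom1.
  rewrite -(e x) -(e y) -po.
  rewrite contract_map //; first exact: ahom_linear.
  by move=> k a b; rewrite lv dual_evalP.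
Qed.

Lemma first_tangent (A : augAlg K) (lam : deformation dD A) : is_first lam ->
  exists v mu, tangent lam v mu /\ bijective (fun a => (aug A a, v a)).
Proof.
move=> [v [mu [vb vM muK H]]]; exists v, mu; split=> //; split=> //.
- exact: linear_map.
- exact: linear_map.
- move=> s x y alpha.
  have v1 := derivation1 vM.
  have lva : scalar (fun a => val (v a) alpha : K).
    by move=> k a b; rewrite linearP dual_evalP.
  have [HL HR] := H (pure 1 x) (pure 1 y) alpha.
  have c0 u : contract (fun a => val (v a) alpha : K) (pure 1 u : tens A D) = 0.
    by rewrite contract_pure // v1 (scal0 (dual_evalP alpha)) scale0r.
  have d0 s' : dD s' x 0 = 0 /\ dD s' 0 y = 0.
    by have [rr rl] := dop_bilinear dD s'; rewrite (lin0 (rr x)) (lin0 (rl y)).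
  case: s; [rewrite HL|rewrite HR]; rewrite !c0 !teps_pure1;
    by rewrite (d0 _).1 (d0 _).2 !addr0.
Qed.

End FirstStep.

(** * The limit algebra *)

Section TowerFacts.
Variables (K : fieldType) (D : lmodType K) (dD : dialgebra D).
Hypothesis HY2fin : fin_dim (HY dD 2).
Variable T : tower dD.
Local Notation CC := (tw_alg T).
Local Notation p := (tw_proj T).

Lemma tw0_aug (a : CC 0) : aug _ a = 0 -> a = 0.
Proof. by move=> a0; apply: (bij_inj (tw0 T)); rewrite a0 linear0. Qed.

Lemma tw_surj k b : exists a, p k a = b.
Proof.
case: k b => [|k] b; last exact: next_surj (twS T (ltn0Sn k)) b.
exists (aug _ b)%:A; apply/(bij_inj (tw0 T)).
by rewrite ahomP linearZ /= rmorph1 mulr1.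
Qed.

Lemma tw_push k : push_mor (p k) (tw_def T k.+1) (tw_def T k).
Proof.
case: k => [|k]; last exact: next_push (twS T (ltn0Sn k)).
move=> s l1 l2; apply: (teps_inj tw0_aug).
by rewrite teps_tpush !def_eps !teps_tpush.
Qed.

Lemma tw1_tangent : exists v mu, tangent (tw_def T 1) v mu /\
  bijective (fun a => (aug (CC 1) a, v a)).
Proof. exact/first_tangent/tw1. Qed.

Lemma tw_tangent k : exists v mu, tangent (tw_def T k.+1) v mu.
Proof.
elim: k => [|k [v [mu tg]]]; first by have [v [mu [tg _]]] := tw1_tangent; exists v, mu.
exists (v \o p k.+1), mu; apply: tangent_push tg; exact: tw_push.
Qed.

Lemma tw_fin k : fin_dim (CC k).
Proof.
case: k => [|k].
  apply: (@fin_dim_inj _ _ K^o (aug (CC 0))); last exact: fin_dim_scalar.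
    exact: aug_scalar.
  exact: bij_inj (tw0 T).
elim: k => [|k IH]; last exact: next_fin (twS T (ltn0Sn k)) IH.
have [v [mu [[lv _ _ _ _] vb]]] := tw1_tangent.
apply: (@fin_dim_inj _ _ (K^o * dual (HY dD 2))%type (fun a => (aug (CC 1) a, v a))).
- by move=> a u w; congr pair; [rewrite linearP|rewrite lv].
- exact: bij_inj vb.
- by apply: fin_dim_prod; [apply: fin_dim_scalar|apply: fin_dim_dual].
Qed.

(** Each step adds a kernel annihilated by the maximal ideal, so the order of
    nilpotency grows by at most one. *)
Lemma tw_nil k x : mpow (CC k) k.+1 x -> x = 0.
Proof.
case: k x => [|k] x; first by move=> /mpow1/tw0_aug.
elim: k x => [|k IH]; last by move=> x; apply: (next_nil (twS T (ltn0Sn k))) IH _.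
have [v [mu [[lv vM _ _ _] vb]]] := tw1_tangent.
apply: (mpow_ind (P := fun x => x = 0)) => // [a u w -> ->|a b a0 /mpow1 b0].
  by rewrite scaler0 addr0.
apply: (bij_inj vb); rewrite vM a0 b0 !scale0r addr0 rmorphM /= a0 mul0r.
by rewrite linear0 (lin0 lv).
Qed.

Lemma tw_ker_mpow2 k x : p k.+1 x = 0 -> mpow (CC k.+2) 2 x.
Proof. by apply: (next_ker_mpow2 (twS T (ltn0Sn k))); apply: tw_fin. Qed.

Section Limit.
Variables (C : augAlg K) (pi : forall k, augHom C (CC k)) (limC : is_limit pi).

Lemma pi_p k c : p k (pi k.+1 c) = pi k c.
Proof. exact: (limC.1 k c). Qed.

Lemma pi_inj c : (forall k, pi k c = 0) -> c = 0.
Proof.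
move=> c0; have [|c' [_ uniq]] := limC.2 (fun k => 0).
  by move=> k; rewrite (lin0 (ahom_linear _)).
rewrite -(uniq c) //; apply: uniq => k; exact: (lin0 (ahom_linear _)).
Qed.

Lemma pi_eq c c' : (forall k, pi k c = pi k c') -> c = c'.
Proof.
move=> cc; apply/eqP; rewrite -subr_eq0; apply/eqP/pi_inj => k.
by rewrite (linB (ahom_linear _)) cc subrr.
Qed.

(** Compatibility is only needed from some rank k on: the terms before k are
    recovered from the term of rank k by the projections. *)
Lemma pi_tail k (z : forall j, CC j) : (forall j, (k <= j)%N -> p j (z j.+1) = z j) ->
  exists c, forall j, (k <= j)%N -> pi j c = z j.
Proof.
elim: k z => [|k IH] z zp.
  have [|c [cz _]] := limC.2 z; first by move=> j; apply: zp.
  by exists c.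
pose z' := dfwith z (p k (z k.+1)).
have z'E j : (k < j)%N -> z' j = z j by move=> kj; rewrite /z' dfwith_out // ltn_eqF.
have [j|c cz] := IH z'.
  rewrite leq_eqVlt => /orP[/eqP <-|kj]; first by rewrite z'E // /z' dfwith_in.
  by rewrite !z'E // ?zp // ltnW.
by exists c => j kj; rewrite cz ?z'E // ltnW.
Qed.

(** Lift x successively to the later C_j; the terms of rank less than k do not
    matter by [pi_tail]. *)
Lemma pi_surj k x : exists c, pi k c = x.
Proof.
(* at rank k the recursion is restarted with x *)
have [y [_ yP]] := dep_choice (X := CC)
  (R := fun j y y' => p j y' = if j == k then dfwith (fun=> 0) x j else y) 0
  (fun j y => tw_surj _).
have [j|c cy] := @pi_tail k (dfwith y x).
  rewrite leq_eqVlt => /orP[/eqP <-|kj].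
    by rewrite dfwith_out ?ltn_eqF // yP eqxx !dfwith_in.
  rewrite !dfwith_out ?ltn_eqF //; last exact: ltnW.
  by rewrite yP gtn_eqF.
by exists c; rewrite cy // dfwith_in.
Qed.

Lemma pi_nil k c : mpow C k.+1 c -> pi k c = 0.
Proof. by move=> mc; apply: tw_nil; apply: mpow_hom. Qed.

Lemma ker_pi_le k j c : (k <= j)%N -> pi j c = 0 -> pi k c = 0.
Proof.
move=> kj; rewrite -(subnK kj); elim: (j - k)%N => //= m IH c0; apply: IH.
by rewrite -pi_p c0 (lin0 (ahom_linear _)).
Qed.

(** No new generators of the maximal ideal appear after C_1. *)
Lemma pi1_ker k c : pi 1 c = 0 -> mpow (CC k.+1) 2 (pi k.+1 c).
Proof.
move=> c0; elim: k => [|k IH]; first by rewrite c0; apply: smem0.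
move: IH; rewrite -pi_p => /(mpow_surj (@tw_surj k.+1))[y my yp].
rewrite -[pi _ c](subrK y); apply: smemD => //; apply: tw_ker_mpow2.
by rewrite (linB (ahom_linear _)) yp subrr.
Qed.

(** By Nakayama and [pi1_ker] it suffices to lift to C a spanning family of
    the maximal ideal of C_1. *)
Lemma tw_gens : exists r (t : 'I_r -> C), forall k, mgens (fun i => pi k.+1 (t i)).
Proof.
have [r [e [x [lx xE _]]]] := fin_dim_basis (tw_fin 1).
have /choice[t tP] i := pi_surj (e i - (aug _ (e i))%:A).
have t0 i : aug _ (t i) = 0.
  by rewrite -(ahomP (pi 1)) tP linearB linearZ /= rmorph1 mulr1 subrr.
exists r, t => k; apply: mgens_nil (@tw_nil k.+1) _ _ => [i|a a0].
  by rewrite ahomP.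
have [c cE] := pi_surj a.
exists (fun i => x i (pi 1 c)); rewrite -cE.
have -> : pi k.+1 c - \sum_i x i (pi 1 c) *: pi k.+1 (t i) =
    pi k.+1 (c - \sum_i x i (pi 1 c) *: t i).
  rewrite (linB (ahom_linear _)) (lin_sum (ahom_linear _)).
  by congr (_ - _); apply: eq_bigr => i _; rewrite (linZ (ahom_linear _)).
apply: pi1_ker; rewrite (linB (ahom_linear _)) (lin_sum (ahom_linear _)).
under eq_bigr => i _ do rewrite (linZ (ahom_linear _)) tP scalerBr.
rewrite sumrB -xE subKr.
transitivity ((\sum_i x i (pi 1 c) * aug _ (e i))%:A : CC 1).
  by rewrite scaler_suml; apply: eq_bigr => i _; rewrite scalerA.
rewrite -[X in X%:A](_ : aug _ (pi 1 c) = _).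
  by rewrite ahomP -(ahomP (pi k.+1)) cE a0 scale0r.
rewrite {1}(xE (pi 1 c)) (scal_sum (@aug_scalar K _)).
by apply: eq_bigr => i _; rewrite (scalZ (@aug_scalar K _)).
Qed.

(** For each k the coefficients d exist in C_k, and the solutions form an
    affine subspace of a finite dimensional space, so compatible solutions
    exist by Mittag-Leffler. The last component of V0 is the homogenizing
    coordinate. *)
Lemma limit_gens r (t : 'I_r -> C) n c :
  (forall k, mgens (fun i => pi k.+1 (t i))) ->
  (forall k, mpow (CC k) n.+1 (pi k c)) ->
  exists d : 'I_r -> C, (forall i k, mpow (CC k) n (pi k (d i))) /\
    c = \sum_i t i * d i.
Proof.
move=> tg mc.
pose V0 k : lmodType K := (('I_r -> CC k) * K^o)%type.
have S0 k : (forall i, mpow (CC k) n ((0 : V0 k).1 i)) /\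
    \sum_i pi k (t i) * (0 : V0 k).1 i = (0 : V0 k).2 *: pi k c.
  split=> [i|]; first exact: smem0.
  by rewrite scale0r big1 // => i _; apply: mulr0.
have SP k (a : K) (u v : V0 k) :
    (forall i, mpow (CC k) n (u.1 i)) /\ \sum_i pi k (t i) * u.1 i = (u.2 : K) *: pi k c ->
    (forall i, mpow (CC k) n (v.1 i)) /\ \sum_i pi k (t i) * v.1 i = (v.2 : K) *: pi k c ->
    (forall i, mpow (CC k) n ((a *: u + v).1 i)) /\
    \sum_i pi k (t i) * (a *: u + v).1 i = ((a *: u + v).2 : K) *: pi k c.
  move=> [mu uE] [mv vE]; split=> [i|]; first exact: (smemP a (mu i) (mv i)).
  rewrite scalerDl -vE; have -> : (a *: u).2 *: pi k c = a *: ((u.2 : K) *: pi k c).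
    by rewrite scalerA.
  rewrite -uE scaler_sumr -big_split; apply: eq_bigr => i _.
  exact: (mull_linear (pi k (t i)) a (u.1 i) (v.1 i)).
pose V k : lmodType K := sub (Subspace (S0 k) (SP k)).
pose q k (u : V0 k.+1) : V0 k := (fun i => p k (u.1 i), u.2).
have lq k : linear (@q k).
  move=> a u v; congr pair; apply/funext => i.
  exact: (ahom_linear (p k) a (u.1 i) (v.1 i)).
have qS0 k (u : V0 k.+1) : Subspace (S0 k.+1) (SP k.+1) u -> Subspace (S0 k) (SP k) (q k u).
  move=> [mu uE]; split=> [i|] /=; first exact: mpow_hom.
  rewrite -pi_p -(linZ (ahom_linear (p k))) -uE (lin_sum (ahom_linear _)).
  by apply: eq_bigr => i _; rewrite ahomM pi_p.
have qS k (u : V k.+1) := qS0 k _ (smem_val u).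
have lval k : linear (val : V k -> V0 k) by apply: linear_map.
pose tr k (u : V k.+1) : V k := mksub (qS k u).
pose kap k (u : V k) : K := (val u).2.
have [|k a u v|k a u v|//|k|x [xt xk]] := @mittag_leffler K V tr kap.
- move=> k; apply/fin_dim_sub/fin_dim_prod; last exact: fin_dim_scalar.
  exact/fin_dim_fun/tw_fin.
- apply: val_inj; rewrite (lval k) -[LHS]/(q k (val (a *: u + v))) (lval k.+1).
  exact: lq.
- by rewrite /kap (lval k).
- have [d [md cE]] : exists d : 'I_r -> CC k, (forall i, mpow (CC k) n (d i)) /\
      pi k c = \sum_i pi k (t i) * d i.
    case: k => [|k]; last exact: mpow_gens (tg k) (mc k.+1).
    exists (fun=> 0); split=> [i|]; first exact: smem0.
    rewrite big1 => [|i _]; last by rewrite mulr0.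
    by apply: tw_nil; apply: mpow_le (mc 0).
  have dS : Subspace (S0 k) (SP k) (d, 1).
    by split=> //=; rewrite -cE scale1r.
  by exists (mksub dS).
have /choice[d dP] i : exists d, forall k, pi k d = (val (x k)).1 i.
  have [k|d [dP _]] := limC.2 (fun k => (val (x k)).1 i); last by exists d.
  by rewrite -(xt k).
exists d; split=> [i k|]; first by rewrite dP; have [] := smem_val (x k).
apply: pi_eq => k; rewrite (lin_sum (ahom_linear _)).
have [_] := smem_val (x k); rewrite -/(kap k _) xk scale1r => <-.
by apply: eq_bigr => i _; rewrite ahomM dP.
Qed.

Lemma C_gens : exists r (t : 'I_r -> C), mgens t.
Proof.
have [r [t tg]] := tw_gens; exists r, t; split=> [i|c c0].
  by rewrite -(ahomP (pi 1)); have [-> //] := tg 0.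
have [k|d [_ cE]] := @limit_gens r t 0 c tg; last by exists d.
by apply/mpow1; rewrite ahomP.
Qed.

(** By induction on n from [limit_gens]: the powers of the maximal ideal of C
    are closed for the topology of the limit. *)
Lemma mpow_limit n c : (forall k, mpow (CC k) n (pi k c)) -> mpow C n c.
Proof.
have [r [t tg]] := tw_gens.
elim: n c => [|n IH] c mc; first exact: mpow0.
have [d [md ->]] := limit_gens tg mc.
apply: smem_sum => i; apply: mpowM1; last exact: IH.
by rewrite -(ahomP (pi 1)); have [-> //] := tg 0.
Qed.

Lemma C_fin n : fin_dim (quot (mpow C n)).
Proof. by have [r [t tg]] := C_gens; apply: fin_dim_mpow tg. Qed.

(** Chevalley's theorem. The images of the kernels of the pi_k in the finite
    dimensional quotient by the n-th power decrease, hence are stationary; an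
    element of the stable image lies in the n-th power modulo every kernel,
    hence in the n-th power by [mpow_limit]. *)
Lemma ker_pi_mpow n : exists k, forall c, pi k c = 0 -> mpow C n c.
Proof.
pose S k (q : quot (mpow C n)) := exists2 c, pi k c = 0 & qpi _ c = q.
have S0 k : S k 0 by exists 0; rewrite ?(lin0 (ahom_linear _)) ?linear0.
have SP k (a : K) u v : S k u -> S k v -> S k (a *: u + v).
  move=> [c c0 <-] [d d0 <-]; exists (a *: c + d); last by rewrite linearP.
  by rewrite (ahom_linear (pi k)) c0 d0 scaler0 addr0.
have [|k0 k0P] := fin_dim_dcc (S := fun k => Subspace (S0 k) (SP k)) (C_fin n).
  by move=> k _ [c c0 <-]; exists c => //; rewrite -pi_p c0 (lin0 (ahom_linear _)).
exists k0 => c c0; apply: mpow_limit => k.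
have [kk0|/ltnW k0k] := leqP k k0.
  by rewrite (ker_pi_le kk0 c0); apply: smem0.
have [|d d0 /qpiP/asboolP] := k0P k (qpi _ c) k0k; first by exists c.
move/(mpow_hom (pi k)); rewrite (linB (ahom_linear _)) d0 sub0r => /smemN.
by rewrite opprK.
Qed.

Lemma C_local : is_local C.
Proof.
move=> a a0; have ex k : exists b, pi k a * b = 1.
  by apply: nil_unit (@tw_nil k) _; rewrite ahomP.
pose b k := projT1 (cid (ex k)).
have bP k : pi k a * b k = 1 := projT2 (cid (ex k)).
have [k|c [cP _]] := limC.2 b.
  have e : pi k a * p k (b k.+1) = 1 by rewrite -pi_p -ahomM bP ahom1.
  by rewrite -[LHS]mul1r -(bP k) [_ * b k]mulrC -mulrA e mulr1.
by exists c; apply: pi_eq => k; rewrite ahomM cP bP ahom1.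
Qed.

(** A sequence compatible modulo the powers of the maximal ideal has
    components in the C_k, where these powers vanish, and its limit is found
    there. *)
Lemma C_complete : is_complete C.
Proof.
move=> x xP; have xm n m : (n <= m)%N -> mpow C n (qrepr (x m) - qrepr (x n)).
  move=> nm; rewrite -(subnK nm); elim: (m - n)%N => [|j IH].
    by rewrite subrr; apply: smem0.
  rewrite -[qrepr _](subrK (qrepr (x (j + n)%N))) -addrA; apply: smemD => //.
  apply: mpow_le (leq_addl j n) _.
  by apply/asboolP/qpiP; rewrite xP qreprK.
have [k|a [aP _]] := limC.2 (fun k => pi k (qrepr (x k.+1))).
  rewrite pi_p; apply/eqP; rewrite -subr_eq0 -(linB (ahom_linear _)); apply/eqP.
  exact/pi_nil/xm.
(* for k + 1 < n the difference is in the power k + 1, which dies in C_k *)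
exists a; split=> [n|b bP].
  rewrite -[RHS]qreprK; apply/qpiP/asboolP/mpow_limit => k.
  rewrite (linB (ahom_linear _)) aP -(linB (ahom_linear _)).
  have [nk|kn] := leqP n k.+1; first exact/mpow_hom/xm.
  rewrite -opprB (linN (ahom_linear _)) pi_nil ?oppr0; first exact: smem0.
  exact/xm/ltnW.
apply: pi_eq => k; rewrite aP; apply/eqP.
rewrite -subr_eq0 -(linB (ahom_linear _)); apply/eqP/pi_nil/asboolP.
by apply/qpiP; rewrite bP qreprK.
Qed.

Lemma C_complete_local : complete_local C.
Proof.
split; [exact: C_local|exact: C_complete|move=> n _].
exact/fin_dim_subquot/C_fin.
Qed.

End Limit.
End TowerFacts.

(** * Quotients of a base *)

Arguments mpow : simpl never.

Section QuotAlg.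
Variables (K : fieldType) (A : augAlg K) (I : subspace A).
Hypotheses (Imul : forall a x, I x -> I (a * x)) (Iaug : forall x, I x -> aug A x = 0).

(** The two hypotheses on I are arguments of the type so that its canonical
    ring structure can depend on them. *)
Definition qalg of (forall a x, I x -> I (a * x)) & (forall x, I x -> aug A x = 0) :=
  quot I.
Local Notation Q := (qalg Imul Iaug).

HB.instance Definition _ := GRing.Lmodule.on Q.

Definition qmul (x y : Q) : Q := qpi I (qrepr x * qrepr y).

Lemma qmulE a b : qmul (qpi I a) (qpi I b) = qpi I (a * b).
Proof.
apply/qpiP/asboolP; set u := qrepr _; set v := qrepr _.
have -> : u * v - a * b = v * (u - a) + a * (v - b).
  by rewrite !mulrBr [v * u]mulrC [v * a]mulrC addrA subrK.
by apply: smemD; apply: Imul; apply/asboolP/qpiE.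
Qed.

Lemma qmulA : associative qmul.
Proof. by elim/quotI=> x; elim/quotI=> y; elim/quotI=> z; rewrite !qmulE mulrA. Qed.
Lemma qmulC : commutative qmul.
Proof. by elim/quotI=> x; elim/quotI=> y; rewrite !qmulE mulrC. Qed.
Lemma qmul1 : left_id (qpi I 1) qmul.
Proof. by elim/quotI=> x; rewrite qmulE mul1r. Qed.
Lemma qmulDl : left_distributive qmul +%R.
Proof.
elim/quotI=> x; elim/quotI=> y; elim/quotI=> z.
by rewrite -[_ + _]linearD !qmulE mulrDl linearD.
Qed.
Lemma qone_neq0 : (qpi I 1 : Q) != 0.
Proof.
apply/eqP => /qpi0/Iaug/eqP; rewrite rmorph1; apply/negP; exact: oner_neq0.
Qed.

HB.instance Definition _ := GRing.Zmodule_isComNzRing.Build Q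
  qmulA qmulC qmul1 qmulDl qone_neq0.

Lemma qscaleAl (k : K) (u v : Q) : k *: (u * v) = k *: u * v.
Proof.
rewrite -[LHS]/(k *: qmul u v) -[RHS]/(qmul (k *: u) v).
elim/quotI: u => x; elim/quotI: v => y.
by rewrite qmulE -(linZ (@qpi_linear K A I)) scalerAl -qmulE (linZ (@qpi_linear K A I)).
Qed.

HB.instance Definition _ := GRing.Lmodule_isLalgebra.Build K Q qscaleAl.
HB.instance Definition _ := GRing.Lalgebra_isComAlgebra.Build K Q.

Definition qaug (u : Q) : K := aug A (qrepr u).

Lemma qaugE a : qaug (qpi I a) = aug A a.
Proof.
apply/eqP; rewrite -subr_eq0 -linearB; apply/eqP/Iaug/asboolP; exact: qpiE.
Qed.

Lemma qaug_scalar : scalar qaug.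
Proof.
move=> k; elim/quotI=> x; elim/quotI=> y.
by rewrite -[_ + _](@qpi_linear K A I k x y) !qaugE linearP.
Qed.

Lemma qaug_monoid : monoid_morphism qaug.
Proof.
split=> [|]; first by rewrite -[1]/(qpi I 1) qaugE rmorph1.
by elim/quotI=> x; elim/quotI=> y; rewrite -[_ * _]/(qmul _ _) qmulE !qaugE rmorphM.
Qed.

HB.instance Definition _ := GRing.isLinear.Build K Q K *%R qaug qaug_scalar.
HB.instance Definition _ := GRing.isMonoidMorphism.Build Q K qaug qaug_monoid.

Definition quot_alg : augAlg K := @AugAlg K Q qaug.

Lemma quot_alg_pi : exists f : augHom A quot_alg,
  (forall b, exists a, f a = b) /\ forall x, f x = 0 <-> I x.
Proof.
have [||a b|a|f fE] := @augHom_of K A quot_alg (fun a => qpi I a).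
- exact: qpi_linear.
- by [].
- by rewrite -[RHS]/(qmul _ _) qmulE.
- exact: qaugE.
exists f; split=> [|x]; last by rewrite fE; apply: qpi0.
by elim/quotI=> a; exists a.
Qed.

End QuotAlg.

(** * Completed tensor products *)

Section Cev.
Variables (K : fieldType) (D : lmodType K).

Section CevBasic.
Variables (A B : augAlg K) (f : augHom A B) (n : nat).
Hypothesis fn : forall x, mpow A n x -> f x = 0.

(** The map induced by f on the quotient by a power of the maximal ideal that
    f kills. *)
Definition desc (u : quot (mpow A n)) : B := f (qrepr u).

Lemma descE a : desc (qpi _ a) = f a.
Proof.
apply/eqP; rewrite -subr_eq0 -(linB (ahom_linear f)); apply/eqP/fn/asboolP.
exact: qpiE.
Qed.

Lemma desc_lin : linear desc.
Proof.
move=> a; elim/quotI=> x; elim/quotI=> y.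
by rewrite -(@qpi_linear K A (mpow A n) a x y) !descE (ahom_linear f).
Qed.

(** The completed push-out along f, when f kills a power of the maximal ideal:
    it takes values in the uncompleted tensor product. *)
Definition cev (x : ctens D A) : tens B D := tens_map desc idfun (val x n).

Lemma cev_linear : linear cev.
Proof.
move=> a x y; rewrite /cev -(tens_map_linear desc_lin (@id_linear K D)).
congr (tens_map _ _ _).
Qed.

Lemma cev_canon (t : tens A D) : cev (Defs.canon t) = tpush f t.
Proof.
rewrite /cev /= (tens_map_comp t (@qpi_linear K A (mpow A n)) (@id_linear K D) desc_lin) //.
by congr (tens_map _ _ _); apply/funext => a /=; rewrite descE.
Qed.

Lemma cev_cact a x : cev (cact a x) = tact (f a) (cev x).
Proof.
have lm := quot_map_linear (mull_linear a) (@mpow_mull K A n a).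
rewrite /cev /= /cmap_fun /tact !tens_map_comp //;
  try exact: desc_lin; try exact: mull_linear.
congr (tens_map _ _ _); apply/funext; elim/quotI => b /=.
by rewrite (quot_mapE (mull_linear a) (@mpow_mull K A n a)) !descE ahomM.
Qed.

End CevBasic.

Definition qle (A : augAlg K) n m : quot (mpow A m) -> quot (mpow A n) :=
  @quot_map _ _ _ (mpow A m) (mpow A n) idfun.

Lemma qleE (A : augAlg K) n m a : (n <= m)%N -> qle n (qpi (mpow A m) a) = qpi (mpow A n) a.
Proof. by move=> nm; apply: quot_mapE => // x; apply: mpow_le. Qed.

Lemma qle_lin (A : augAlg K) n m : (n <= m)%N -> linear (@qle A n m).
Proof. by move=> nm; apply: quot_map_linear => // x; apply: mpow_le. Qed.

Lemma ctens_le (A : augAlg K) (x : ctens D A) n m : (n <= m)%N ->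
  val x n = tens_map (@qle A n m) idfun (val x m).
Proof.
move=> nm; rewrite -(subnK nm); elim: (m - n)%N => [|j IH].
  rewrite (_ : @qle A n n = idfun) ?tens_map_id //.
  by apply/funext; elim/quotI => a; rewrite qleE.
rewrite addSn [LHS]IH -(smem_val x (j + n)%N) /transition.
have l1 := @qle_lin A n (j + n)%N (leq_addl j n).
have l2 := @qle_lin A _ _ (leqnSn (j + n)%N).
rewrite -[quot_map _ _]/(@qle A (j + n)%N (j + n).+1) tens_map_comp //.
congr (tens_map _ _ _); apply/funext; elim/quotI => a /=.
rewrite !qleE ?leq_addl // -addSn; exact: leq_addl.
Qed.

Lemma ctens_eq (A : augAlg K) (x y : ctens D A) : (forall n, val x n = val y n) -> x = y.
Proof. by move=> xy; apply/val_inj/functional_extensionality_dep. Qed.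

Section CevFunctorial.
Variables (A B : augAlg K) (f : augHom A B) (n : nat).
Hypothesis fn : forall x, mpow A n x -> f x = 0.

Lemma cev_le m x : (n <= m)%N -> cev f m x = cev f n x.
Proof.
move=> nm; have fm z : mpow A m z -> f z = 0 by move=> mz; apply/fn/(mpow_le nm).
rewrite /cev (ctens_le x nm) tens_map_comp //; try exact: qle_lin; try exact: desc_lin.
congr (tens_map _ _ _); apply/funext; elim/quotI => a /=.
by rewrite qleE // !descE.
Qed.

Lemma cev_comp (B' : augAlg K) (q : augHom B B') (h : augHom A B') x :
  (forall a, h a = q (f a)) -> cev h n x = tpush q (cev f n x).
Proof.
move=> hE; have hn z : mpow A n z -> h z = 0 by move=> mz; rewrite hE fn // (lin0 (ahom_linear q)).
rewrite /cev /tpush tens_map_comp //; try exact: desc_lin; try exact: ahom_linear.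
congr (tens_map _ _ _); apply/funext; elim/quotI => a /=.
by rewrite !descE // hE.
Qed.

Lemma cev_push (A' : augAlg K) (g : augHom A' A) (h : augHom A' B) x :
  (forall a, h a = f (g a)) -> cev f n (cpush g x) = cev h n x.
Proof.
move=> hE; have hn z : mpow A' n z -> h z = 0 by move=> mz; rewrite hE fn //; apply: mpow_hom.
rewrite /cev /= /cmap_fun tens_map_comp //; try exact: desc_lin; last first.
  exact: quot_map_linear (ahom_linear g) (@mpow_hom K A' A g n).
congr (tens_map _ _ _); apply/funext; elim/quotI => a /=.
by rewrite (quot_mapE (ahom_linear g) (@mpow_hom K A' A g n)) !descE // hE.
Qed.

Lemma ceps_cev x : (0 < n)%N -> ceps x = teps (cev f n x).
Proof.
move=> n0; rewrite /ceps (ctens_le x n0) /teps /cev.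
have e1 a : aug A (qrepr (qpi (mpow A 1) a)) = aug A a.
  apply/eqP; rewrite -subr_eq0 -linearB; apply/eqP/mpow1/asboolP; exact: qpiE.
have lc : scalar (fun c : quot (mpow A 1) => aug A (qrepr c)).
  move=> k; elim/quotI=> u; elim/quotI=> v.
  by rewrite -(@qpi_linear K A (mpow A 1) k u v) !e1 linearP.
rewrite !contract_map //; try exact: qle_lin; try exact: desc_lin; try exact: aug_scalar.
congr (contract _ _); apply/funext; elim/quotI => a /=.
by rewrite qleE // e1 descE // ahomP.
Qed.

End CevFunctorial.

(** A complete algebra as the limit of a tower of quotients defining its
    topology. Both the tower of the C_k and the quotients of a base by the
    powers of its maximal ideal are of this kind, and the completed tensor
    product is the limit of the B_k (x) D in both cases. *)
Record presented (A : augAlg K) (B : nat -> augAlg K) (f : forall k, augHom A (B k))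
    (q : forall k, augHom (B k.+1) (B k)) : Prop := {
  pr_comp : forall k a, q k (f k.+1 a) = f k a;
  pr_surj : forall k b, exists a, f k a = b;
  pr_nil : forall k x, mpow A k.+1 x -> f k x = 0;
  pr_ker : forall n, exists k, forall x, f k x = 0 -> mpow A n x }.

Section Presented.
Variables (A : augAlg K) (B : nat -> augAlg K) (f : forall k, augHom A (B k)).
Variable (q : forall k, augHom (B k.+1) (B k)).
Hypothesis pr : presented f q.

Definition pev k (x : ctens D A) : tens (B k) D := cev (f k) k.+1 x.

Lemma pev_linear k : linear (@pev k).
Proof. exact/cev_linear/(pr_nil pr). Qed.

Lemma pev_canon k (t : tens A D) : pev k (Defs.canon t) = tpush (f k) t.
Proof. exact/cev_canon/(pr_nil pr). Qed.

Lemma pev_cact k a x : pev k (cact a x) = tact (f k a) (pev k x).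
Proof. exact/cev_cact/(pr_nil pr). Qed.

Lemma pev_ceps k x : teps (pev k x) = ceps x.
Proof. by rewrite (ceps_cev (pr_nil pr (k := k))). Qed.

Lemma pev_compat k x : tpush (q k) (pev k.+1 x) = pev k x.
Proof.
have nil := pr_nil pr.
rewrite /pev -(cev_le (nil k) x (leqnSn _)); apply/esym/cev_comp; first exact: nil.
by move=> a; rewrite (pr_comp pr).
Qed.

Lemma pr_section n : exists k (s : B k -> quot (mpow A n)),
  linear s /\ forall a, s (f k a) = qpi _ a.
Proof.
have [k kP] := pr_ker pr n; exists k.
have [|s ls sE] := lin_factor (ahom_linear (f k)) (@qpi_linear K A (mpow A n))
    (pr_surj pr (k := k)).
  by move=> u /kP/qpi0.
by exists s.
Qed.

(** The quotient by the n-th power is a quotient of some B_k, as the kernels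
    are cofinal with the powers. *)
Lemma pev_inj x y : (forall k, pev k x = pev k y) -> x = y.
Proof.
move=> xy; apply: ctens_eq => n; have [k [s [ls sE]]] := pr_section n.
have H (z : ctens D A) : val z n = tens_map s idfun (pev k z).
  pose N := maxn n k.+1; have nk : (k.+1 <= N)%N by apply: leq_maxr.
  have nN : (n <= N)%N by apply: leq_maxl.
  have nilN u : mpow A N u -> f k u = 0 by move/(mpow_le nk)/(pr_nil pr).
  rewrite /pev -(cev_le (pr_nil pr (k := k)) z nk) (ctens_le z nN) /cev.
  rewrite tens_map_comp //; last exact: desc_lin.
  congr (tens_map _ _ _); apply/funext; elim/quotI => a /=.
  by rewrite qleE // descE // sE.
by rewrite !H xy.
Qed.

(** The component at the power n is read off from any z_k with k large; feq
    and down say that the choice of k does not matter. *)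
Lemma pev_lim (z : forall k, tens (B k) D) : (forall k, tpush (q k) (z k.+1) = z k) ->
  exists x, forall k, pev k x = z k.
Proof.
move=> zq.
have down k j : (k <= j)%N -> exists d : B j -> B k,
    [/\ linear d, forall a, d (f j a) = f k a & z k = tens_map d idfun (z j)].
  move=> kj; rewrite -(subnK kj); elim: (j - k)%N => [|m [d [ld dE zE]]].
    by exists idfun; rewrite tens_map_id.
  exists (d \o q (m + k)); split=> [|a|].
  - exact: lin_comp (ahom_linear _) ld.
  - by rewrite /= (pr_comp pr) dE.
  - by rewrite zE -zq /tpush tens_map_comp //; apply: ahom_linear.
have feq k (V : lmodType K) (g h : B k -> V) : (forall a, g (f k a) = h (f k a)) -> g = h.
  by move=> gh; apply/funext => b; have [a <-] := pr_surj pr b.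
have ex n := pr_section n.
pose kk n := projT1 (cid (ex n)); pose ss n := projT1 (cid (projT2 (cid (ex n)))).
have [lss ssE] : (forall n, linear (ss n)) /\ forall n a, ss n (f (kk n) a) = qpi (mpow A n) a.
  by split=> n; have [] := projT2 (cid (projT2 (cid (ex n)))).
pose xx n : tens (quot (mpow A n)) D := tens_map (ss n) idfun (z (kk n)).
have xc : compat D A xx.
  move=> n; rewrite /transition -[quot_map _ _]/(@qle A n n.+1).
  have lq := @qle_lin A _ _ (leqnSn n).
  pose j := maxn (kk n) (kk n.+1).
  have [d [ld dE zE]] := down _ _ (leq_maxl _ _ : kk n <= j)%N.
  have [d' [ld' d'E z'E]] := down _ _ (leq_maxr _ _ : kk n.+1 <= j)%N.
  have l1 := lss n; have l2 := lss n.+1.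
  rewrite /xx zE z'E !tens_map_comp //; try (by apply: lin_comp).
  congr (tens_map _ _ _); apply: feq => a /=.
  by rewrite dE d'E !ssE qleE.
exists (@mksub _ _ (compat D A) _ xc) => k; rewrite /pev /cev /=.
pose j := maxn k (kk k.+1).
have [d [ld dE zE]] := down _ _ (leq_maxl _ _ : k <= j)%N.
have [d' [ld' d'E z'E]] := down _ _ (leq_maxr _ _ : kk k.+1 <= j)%N.
have l1 := lss k.+1; have ldesc := desc_lin (pr_nil pr (k := k)).
rewrite /xx zE z'E !tens_map_comp //; try (by apply: lin_comp).
congr (tens_map _ _ _); apply: feq => a /=.
by rewrite dE d'E ssE descE //; apply: (pr_nil pr).
Qed.

End Presented.
End Cev.

(** * Automatic continuity *)

Section CtensKer.
Variables (K : fieldType) (D : lmodType K).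

Lemma cval_linear (A : augAlg K) n :
  linear ((fun x => val x n) : ctens D A -> tens (quot (mpow A n)) D).
Proof. by move=> a x y; have -> := linearP (val : ctens D A -> dprod _) a x y. Qed.

(** A linear section of q splits the exact sequence, which stays exact after
    tensoring with D. *)
Lemma tens_ker (U V : lmodType K) (q : U -> V) (t : tens U D) : linear q -> fin_dim U ->
  (forall v, exists u, q u = v) -> tens_map q (@idfun D) t = 0 ->
  exists n (u : 'I_n -> U) (d : 'I_n -> D),
    (forall i, q (u i) = 0) /\ t = \sum_i pure (u i) (d i).
Proof.
move=> lq fU sq t0.
have [s [_ [_ [_ [[ls sK _] _]]]]] := fin_dim_split lq fU sq.
have [n [u [d tE]]] := tens_sum t.
exists n, (fun i => u i - s (q (u i))), d; split=> [i|].
  by rewrite (linB lq) sK subrr.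
pose ST (t : tens U D) := tens_map s (@idfun D) (tens_map q (@idfun D) t).
have lST : linear ST.
  by apply: lin_comp; apply: tens_map_linear.
have z : ST t = 0 by rewrite /ST t0 (lin0 (tens_map_linear ls (@id_linear K D))).
have -> : t = t - ST t by rewrite z subr0.
rewrite tE (lin_sum lST) -sumrB; apply: eq_bigr => i _.
rewrite /ST !tens_map_pure // (linB (pure_linl _)) //.
Qed.

Variable A : augAlg K.
Hypothesis lcA : complete_local A.

Lemma complete_fin n : fin_dim (quot (mpow A n)).
Proof.
have [_ _ fsub] := lcA.
case: n => [|n].
  apply: (@fin_dim_surj _ K^o _ (fun=> 0)); last exact: fin_dim_scalar.
    by move=> a u v; rewrite scaler0 addr0.
  by elim/quotI => x; exists 0; apply/esym/qpi0/mpow0.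
elim: n => [|n IH]; last first.
  by apply: fin_dim_quot_ext IH (fsub n.+1 isT) => x; apply: mpowS.
apply: (@fin_dim_surj _ K^o _ (fun k : K^o => (k : K) *: qpi _ 1)); last exact: fin_dim_scalar.
  by apply: lin_scalel => a u v.
elim/quotI => x; exists (aug A x); rewrite -linearZ; apply/qpiP/asboolP/mpow1.
by rewrite linearB linearZ /= rmorph1 mulr1 subrr.
Qed.

Lemma mpow_fin_gens n : exists r (g : 'I_r -> A), (forall i, mpow A n (g i)) /\
  forall x, mpow A n x -> exists c : 'I_r -> K, mpow A n.+1 (x - \sum_i c i *: g i).
Proof.
have [s sP] : fin_dim (subquot (mpow A n) (mpow A n.+1)).
  exact/fin_dim_subquot/complete_fin.
exists (size s), (fun i => val (qrepr s`_i)); split=> [i|x mx].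
  exact: (smem_val (qrepr s`_i)).
have [c cE] := sP (qpi _ (mksub mx)); exists c.
have lq := @qpi_linear _ _ (trace (mpow A n) (mpow A n.+1)).
have lval : linear (val : sub (mpow A n) -> A) by apply: linear_map.
have /qpi0 H : qpi (trace (mpow A n) (mpow A n.+1))
    (mksub mx - \sum_i c i *: qrepr s`_i) = 0.
  rewrite (linB lq) cE (lin_sum lq); apply/eqP; rewrite subr_eq0; apply/eqP.
  by apply: eq_bigr => i _; rewrite (linZ lq) qreprK.
have {H} : mpow A n.+1 (val (mksub mx - \sum_i c i *: qrepr s`_i)) := H.
rewrite (linB lval) (lin_sum lval).
by under eq_bigr => i _ do rewrite (linZ lval).
Qed.

Variables (n r : nat) (g : 'I_r -> A).
Hypothesis gP : forall x, mpow A n x ->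
  exists c : 'I_r -> K, mpow A n.+1 (x - \sum_i c i *: g i).

(** Generators of the n-th power modulo the next one generate the power N + n
    modulo the next one, with coefficients in the N-th power. *)
Lemma mpow_gens_add N x : mpow A (N + n) x ->
  exists w : 'I_r -> A, (forall i, mpow A N (w i)) /\
    mpow A (N + n).+1 (x - \sum_i g i * w i).
Proof.
elim: N x => [|N IH] x.
  move=> /gP[c mc]; exists (fun i => (c i)%:A); split=> [i|]; first exact: mpow0.
  rewrite (_ : \sum_i g i * (c i)%:A = \sum_i c i *: g i) //.
  by apply: eq_bigr => i _; rewrite -scalerAr mulr1.
move: x; apply: (mpow_ind (P := fun x => exists w : 'I_r -> A,
   (forall i, mpow A N.+1 (w i)) /\ mpow A (N.+1 + n).+1 (x - \sum_i g i * w i)))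
   => [|a u v [w [mw wP]] [w' [mw' w'P]]|a b a0 /IH[w [mw wP]]].
- exists (fun=> 0); split=> [i|]; first exact: smem0.
  rewrite big1 ?subr0 => [|i _]; [exact: smem0|by rewrite mulr0].
- exists (fun i => a *: w i + w' i); split=> [i|]; first exact: smemP.
  have -> : \sum_i g i * (a *: w i + w' i) = a *: (\sum_i g i * w i) + \sum_i g i * w' i.
    by rewrite scaler_sumr -big_split; apply: eq_bigr => i _; rewrite mulrDr scalerAr.
  by rewrite opprD addrACA -scalerBr; apply: smemP.
- exists (fun i => a * w i); split=> [i|]; first exact: mpowM1.
  have -> : \sum_i g i * (a * w i) = a * \sum_i g i * w i.
    by rewrite mulr_sumr; apply: eq_bigr => i _; rewrite mulrCA.
  by rewrite -mulrBr; apply: mpowM1.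
Qed.

Lemma qle_surj i j v : (i <= j)%N -> exists u, @qle K A i j u = v.
Proof. by move=> ij; elim/quotI: v => a; exists (qpi _ a); rewrite qleE. Qed.

Lemma cact_linear a : linear (@cact K D A a).
Proof.
move=> k x y; apply: ctens_eq => m; rewrite cval_linear /= /cmap_fun cval_linear.
have lm := quot_map_linear (mull_linear a) (@mpow_mull K A m a).
exact: (tens_map_linear lm (@id_linear K D)).
Qed.

(** One more order of approximation of x by combinations of the g_i. *)
Lemma ctens_ker_step N (x : ctens D A) : val x (N + n)%N = 0 ->
  exists z : 'I_r -> ctens D A, (forall i, val (z i) N = 0) /\
    val (x - \sum_i cact (g i) (z i)) (N + n).+1 = 0.
Proof.
move=> x0; have [|m [u [d [u0 xE]]]] := @tens_ker _ _ (@qle K A (N + n) (N + n).+1)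
  (val x (N + n).+1) (qle_lin (leqnSn _)) (complete_fin _) (fun v => qle_surj v (leqnSn _)).
  by rewrite -ctens_le // leqnSn.
have /choice[w wP] l : exists w : 'I_r -> A, (forall i, mpow A N (w i)) /\
    mpow A (N + n).+1 (qrepr (u l) - \sum_i g i * w i).
  apply: mpow_gens_add; apply/qpi0; rewrite -(u0 l) -{2}(qreprK (u l)) qleE //.
exists (fun i => Defs.canon (\sum_l pure (w l i) (d l))).
have lc k : linear (tens_map (qpi (mpow A k)) (@idfun D)).
  by apply: tens_map_linear => //; apply: qpi_linear.
split=> [i|].
  rewrite /= (lin_sum (lc N)) big1 // => l _; rewrite tens_map_pure //; last exact: qpi_linear.
  by have [/(_ i)/qpi0 -> _] := wP l; rewrite (lin0 (pure_linl _)).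
rewrite (linB (cval_linear (N + n).+1)) (lin_sum (cval_linear (N + n).+1)).
apply/eqP; rewrite subr_eq0; apply/eqP; rewrite xE.
have lm i := quot_map_linear (mull_linear (g i)) (@mpow_mull K A (N + n).+1 (g i)).
under [RHS]eq_bigr => i _.
  rewrite /= /cmap_fun /= (lin_sum (lc _)) (lin_sum (tens_map_linear (lm i) (@id_linear K D))).
  under eq_bigr => l _.
    rewrite tens_map_pure; [|exact: qpi_linear|by []].
    rewrite tens_map_pure; [|exact: lm|by []].
    rewrite (quot_mapE (mull_linear (g i)) (@mpow_mull K A (N + n).+1 (g i))).
    over.
  over.
rewrite exchange_big /=; apply: eq_bigr => l _.
rewrite -(lin_sum (pure_linl _)) -(lin_sum (@qpi_linear K A _)); congr pure.
by rewrite -[LHS]qreprK; apply/qpiP/asboolP; have [] := wP l.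
Qed.

(** The elements of the completed tensor product that vanish modulo the n-th
    power are combinations of generators of this power. Consequently
    A-bilinear products are continuous, although continuity is not part of the
    definition of a formal deformation. The coefficients y_i are the sums of
    the successive corrections, finite in each component. *)
Lemma ctens_ker (x : ctens D A) : val x n = 0 ->
  exists y : 'I_r -> ctens D A, x = \sum_i cact (g i) (y i).
Proof.
move=> x0; pose X N := {x : ctens D A | val x (N + n)%N = 0}.
have [N [u u0]|u [uE uS]] := @dep_choice X (fun N u v => exists z : 'I_r -> ctens D A,
    (forall i, val (z i) N = 0) /\ sval v = sval u - \sum_i cact (g i) (z i))
  (exist _ x x0).
  have [z [z0 zE]] := ctens_ker_step u0.
  by exists (exist (fun v : ctens D A => val v (N.+1 + n)%N = 0)
     (u - \sum_i cact (g i) (z i)) zE), z.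
have /choice[z zP] := uS.
have z0 N i M : (M <= N)%N -> val (z N i) M = 0.
  move=> MN; rewrite (ctens_le _ MN); have [-> _] := zP N.
  by rewrite (lin0 (tens_map_linear (qle_lin MN) (@id_linear K D))).
have xE N : x = sval (u N) + \sum_i cact (g i) (\sum_(j < N) z j i).
  elim: N => [|N IH].
    rewrite uE /= big1 ?addr0 // => i _.
    by rewrite big_ord0 (lin0 (cact_linear (g i))).
  rewrite IH; have [_ ->] := zP N; rewrite -addrA; congr (_ + _).
  apply: (canRL (addKr _)); rewrite -big_split; apply: eq_bigr => i _.
  by rewrite big_ord_recr (linD (cact_linear (g i))) addrC.
pose yy i M : tens (quot (mpow A M)) D := val (\sum_(j < M) z j i) M.
have yc i : compat D A (yy i).
  move=> M; rewrite /yy (smem_val (\sum_(j < M.+1) z j i) M) big_ord_recr.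
  by rewrite (linD (cval_linear M)) z0 // addr0.
exists (fun i => @mksub _ _ (compat D A) _ (yc i)); apply: ctens_eq => M.
rewrite {1}(xE M) (linD (cval_linear M)).
rewrite (ctens_le (sval (u M)) (leq_addr n M)) (svalP (u M)).
rewrite (lin0 (tens_map_linear (qle_lin (leq_addr n M)) (@id_linear K D))) add0r.
by rewrite !(lin_sum (cval_linear M)).
Qed.

End CtensKer.

(** * Limits and reductions of formal deformations *)

Lemma complete_presented (K : fieldType) (A : augAlg K) : complete_local A ->
  exists (B : nat -> augAlg K) (f : forall k, augHom A (B k))
    (q : forall k, augHom (B k.+1) (B k)),
  presented f q /\ forall k x, f k x = 0 <-> mpow A k.+1 x.
Proof.
move=> lcA.
have Iaug k x : mpow A k.+1 x -> aug A x = 0 by move=> mx; apply/mpow1; apply: mpow_le mx.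
pose B k := quot_alg (@mpow_mull K A k.+1) (@Iaug k).
pose ex k := quot_alg_pi (@mpow_mull K A k.+1) (@Iaug k).
pose f k : augHom A (B k) := projT1 (cid (ex k)).
have fs k b : exists a, f k a = b by have [] := projT2 (cid (ex k)).
have fk k x : f k x = 0 <-> mpow A k.+1 x by have [_] := projT2 (cid (ex k)).
have exq k : exists q : augHom (B k.+1) (B k), forall a, q (f k.+1 a) = f k a.
  have [|q lq qE] := lin_factor (ahom_linear (f k.+1)) (ahom_linear (f k)) (fs k.+1).
    by move=> u /fk mu; apply/fk/mpowS.
  have [|a b|a|q' q'E] := @augHom_of K (B k.+1) (B k) q lq.
  - by rewrite -(ahom1 (f k.+1)) qE ahom1.
  - by have [u <-] := fs k.+1 a; have [v <-] := fs k.+1 b; rewrite -ahomM !qE ahomM.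
  - by have [u <-] := fs k.+1 a; rewrite qE !ahomP.
  by exists q' => a; rewrite q'E.
exists B, f, (fun k => projT1 (cid (exq k))); split=> //; split=> //.
- by move=> k; apply: (projT2 (cid (exq k))).
- by move=> k x /fk.
- by move=> [|n]; [exists 0 => x _; apply: mpow0|exists n => x /fk].
Qed.

Section FDef.
Variables (K : fieldType) (D : lmodType K) (dD : dialgebra D).
Variables (A : augAlg K) (B : nat -> augAlg K) (f : forall k, augHom A (B k)).
Variable q : forall k, augHom (B k.+1) (B k).
Hypothesis pr : presented f q.

Lemma tpush_surj (A' B' : augAlg K) (h : augHom A' B') (t : tens B' D) :
  (forall b, exists a, h a = b) -> exists u, tpush h u = t.
Proof.
move=> sh; elim/tens_ind: t => [|b x t [u <-]].
  by exists 0; apply: (lin0 (tpush_linear h)).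
have [a <-] := sh b; exists (pure a x + u).
by rewrite (linD (tpush_linear h)) tpush_pure.
Qed.

Lemma pev_surj k t : exists x, pev (D := D) f k x = t.
Proof.
have [u uE] := tpush_surj t (pr_surj pr (k := k)).
by exists (Defs.canon u); rewrite (pev_canon pr).
Qed.

Lemma fdef_limit (rho : forall k, deformation dD (B k)) :
  (forall k, push_mor (q k) (rho k.+1) (rho k)) ->
  exists eta : fdeformation dD A,
    forall k s x y, pev f k (eta s x y) = rho k s (pev f k x) (pev f k y).
Proof.
move=> rq.
have ex s x y : exists z : ctens D A, forall k, pev f k z = rho k s (pev f k x) (pev f k y).
  apply: (pev_lim pr) => k; by rewrite rq !(pev_compat pr).
pose op s x y := projT1 (cid (ex s x y)).
have opE s x y k : pev f k (op s x y) = rho k s (pev f k x) (pev f k y).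
  exact: (projT2 (cid (ex s x y))).
have lp k := @pev_linear K D A B f q pr k.
have opb s : bilinear_map (op s).
  split=> x a u v; apply: (pev_inj pr) => k; have [rr rl] := dop_bilinear (rho k) s.
    by rewrite opE !lp rr !opE.
  by rewrite opE !lp rl !opE.
have opD : dialgebra_axioms op.
  by move=> x y z; split; [split| |split]; apply: (pev_inj pr) => k; rewrite !opE;
    case: (dopP (rho k) (pev f k x) (pev f k y) (pev f k z)) => [[? ?] ? [? ?]].
pose eta0 := Dialgebra opb opD.
have eta_act s : act_bilinear (@cact K D A) (eta0 s).
  move=> a x y; split; apply: (pev_inj pr) => k;
    rewrite opE !(pev_cact pr) opE;
    by case: (def_bilinear (rho k) s (f k a) (pev f k x) (pev f k y)).
have eta_eps s x y : ceps (eta0 s x y) = dD s (ceps x) (ceps y).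
  by rewrite -!(pev_ceps pr 0) opE def_eps.
by exists (FDeformation eta_act eta_eps).
Qed.

(** By [ctens_ker] the products preserve the kernels of the reductions, so
    they induce products on each B_k (x) D. *)
Lemma fdef_descend (lam : fdeformation dD A) : complete_local A ->
  (forall k x, f k x = 0 -> mpow A k.+1 x) ->
  exists rho : forall k, deformation dD (B k),
    forall k s x y, pev f k (lam s x y) = rho k s (pev f k x) (pev f k y).
Proof.
move=> lcA fk; suff ex k : exists rho : deformation dD (B k),
    forall s x y, pev f k (lam s x y) = rho s (pev f k x) (pev f k y).
  by exists (fun k => projT1 (cid (ex k))) => k; apply: (projT2 (cid (ex k))).
have lp := @pev_linear K D A B f q pr k.
have ker x : pev f k x = 0 -> exists r (g : 'I_r -> A) (y : 'I_r -> ctens D A),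
    (forall i, f k (g i) = 0) /\ x = \sum_i cact (g i) (y i).
  move=> x0; have [r [g [mg gP]]] := mpow_fin_gens lcA k.+1.
  have [|y ->] := ctens_ker lcA gP (x := x); last first.
    by exists r, g, y; split=> // i; apply: (pr_nil pr).
  have [|s ls sE] := lin_factor (ahom_linear (f k))
      (@qpi_linear K A (mpow A k.+1)) (pr_surj pr (k := k)).
    by move=> u /fk/qpi0.
  have ldesc := desc_lin (pr_nil pr (k := k)).
  have := congr1 (tens_map s (@idfun D)) x0.
  rewrite (lin0 (tens_map_linear ls (@id_linear K D))) /pev /cev tens_map_comp //.
  rewrite (_ : s \o _ = idfun) ?tens_map_id //.
  apply/funext; elim/quotI => a /=; rewrite descE ?sE //; exact: (pr_nil pr).
have tact0 (t : tens (B k) D) : tact 0 t = 0 by apply: (lin0 (tact_linearl t)).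
have ker_l s x y : pev f k x = 0 -> pev f k (lam s x y) = 0.
  move=> /ker[r [g [z [g0 ->]]]]; have [_ ll] := dop_bilinear lam s.
  rewrite (lin_sum (ll y)) (lin_sum lp) big1 // => i _.
  by rewrite (fdef_bilinear lam s _ _ _).1 (pev_cact pr) g0 tact0.
have ker_r s x y : pev f k y = 0 -> pev f k (lam s x y) = 0.
  move=> /ker[r [g [z [g0 ->]]]]; have [lr _] := dop_bilinear lam s.
  rewrite (lin_sum (lr x)) (lin_sum lp) big1 // => i _.
  by rewrite (fdef_bilinear lam s _ _ _).2 (pev_cact pr) g0 tact0.
have lamE s x y x' y' : pev f k x = pev f k x' -> pev f k y = pev f k y' ->
    pev f k (lam s x y) = pev f k (lam s x' y').
  move=> xx yy; have [lr ll] := dop_bilinear lam s.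
  transitivity (pev f k (lam s x' y)); apply/eqP; rewrite -subr_eq0 -(linB lp).
    by rewrite -(linB (ll y)) ker_l // (linB lp) xx subrr.
  by rewrite -(linB (lr x')) ker_r // (linB lp) yy subrr.
have /choice[h hK] := @pev_surj k.
pose op s u v := pev f k (lam s (h u) (h v)).
have opE s x y : pev f k (lam s x y) = op s (pev f k x) (pev f k y).
  by apply: lamE; rewrite hK.
have opb s : bilinear_map (op s).
  split=> x a u v; rewrite -[x]hK -[u]hK -[v]hK -lp -!opE -lp;
    by have [lr ll] := dop_bilinear lam s; rewrite ?lr ?(ll (h x)).
have opD : dialgebra_axioms op.
  move=> x y z; rewrite -[x]hK -[y]hK -[z]hK.
  split; [split| |split]; rewrite -!opE; congr (pev f k _);
    by case: (dopP lam (h x) (h y) (h z)) => [[? ?] ? [? ?]].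
pose rho0 := Dialgebra opb opD.
have rhoE s x y : rho0 s (pev f k x) (pev f k y) = pev f k (lam s x y) by rewrite opE.
have rho_act s : act_bilinear (@tact K D (B k)) (rho0 s).
  move=> b x y; have [a <-] := pr_surj pr b; rewrite -[x]hK -[y]hK -(pev_cact pr) -(pev_cact pr).
  by rewrite !rhoE -(pev_cact pr); split; congr (pev f k _);
     case: (fdef_bilinear lam s a (h x) (h y)).
have rho_eps s x y : teps (rho0 s x y) = dD s (teps x) (teps y).
  by rewrite -[x]hK -[y]hK rhoE !(pev_ceps pr) fdef_eps.
by exists (Deformation rho_act rho_eps).
Qed.

End FDef.

(** * Morphisms over a fixed base *)

Section BaseMaps.
Variables (K : fieldType) (D : lmodType K) (dD : dialgebra D).

Lemma ahom_id (A : augAlg K) : exists h : augHom A A, forall a, h a = a.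
Proof. by apply: (@augHom_of K A A id). Qed.

Lemma ahom_comp (A B E : augAlg K) (f : augHom A B) (g : augHom B E) :
  exists h : augHom A E, forall a, h a = g (f a).
Proof.
apply: augHom_of => [||a b|a].
- exact: lin_comp (ahom_linear f) (ahom_linear g).
- by rewrite !ahom1.
- by rewrite !ahomM.
- by rewrite !ahomP.
Qed.

Lemma ahom_aug (A B : augAlg K) : exists h : augHom A B, forall a, h a = (aug A a)%:A.
Proof.
apply: augHom_of => [||a b|a].
- by apply: lin_scalel => k a b; rewrite linearP.
- by rewrite rmorph1 scale1r.
- by rewrite rmorphM /= -scalerAl mul1r scalerA.
- by rewrite linearZ /= rmorph1 mulr1.
Qed.

Lemma def_morE (A R : augAlg K) (lam : deformation dD A) (rho : deformation dD R)
    (g : augHom A R) (T : D -> tens R D) : def_mor lam rho g T ->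
  forall s l1 l2, pull g T (lam s l1 l2) = rho s (pull g T l1) (pull g T l2).
Proof.
move=> [lT eT gT] s; have lP := pull_linear (ahom_linear g) lT.
have [lr ll] := dop_bilinear lam s; have [rr rl] := dop_bilinear rho s.
apply: (bilinear_ext (F := fun l1 l2 => pull g T (lam s l1 l2))
  (G := fun l1 l2 => rho s (pull g T l1) (pull g T l2))).
- by split=> l; apply: (lin_comp _ lP).
- by split=> l; [apply: (lin_comp lP (rr _))|apply: (lin_comp lP (rl _))].
- move=> a x b y; rewrite (act_bilinear_pure _ _ _ _ (def_bilinear lam s)) pull_tact // gT.
  rewrite !(pull_pure (ahom_linear g) lT).
  by rewrite (def_bilinear rho s _ _ _).1 (def_bilinear rho s _ _ _).2 -tactM -ahomM.
Qed.

Section Unipotent.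
Variables (R : augAlg K) (N : nat) (idR : augHom R R) (T : D -> tens R D).
Hypotheses (nil : forall x, mpow R N x -> x = 0) (idRE : forall a, idR a = a).
Hypotheses (lT : linear T) (eT : forall x, teps (T x) = x).

Let M j : subspace (tens R D) :=
  Defs.span (fun l => exists a x, mpow R j a /\ l = pure a x).

Let M_pure j a x : mpow R j a -> M j (pure a x).
Proof. by move=> ma W; apply; exists a, x. Qed.

Let M_map j i (h : tens R D -> tens R D) : linear h ->
  (forall a x, mpow R j a -> M i (h (pure a x))) -> forall l, M j l -> M i (h l).
Proof.
move=> lh hM; have S0 : M i (h 0) by rewrite (lin0 lh); apply: smem0.
have SP (k : K) u v : M i (h u) -> M i (h v) -> M i (h (k *: u + v)).
  by move=> mu mv; rewrite lh; apply: smemP.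
by move=> l /(_ (Subspace S0 SP)); apply=> _ [a [x [ma ->]]]; apply: hM.
Qed.

Let M0 l : M 0 l.
Proof.
elim/tens_ind: l => [|a x l Ml]; first exact: smem0.
by apply: smemD => //; apply: M_pure; apply: mpow0.
Qed.

Let MN l : M N l -> l = 0.
Proof.
have SP (k : K) (u v : tens R D) : u = 0 -> v = 0 -> k *: u + v = 0.
  by move=> -> ->; rewrite scaler0 addr0.
move=> /(_ (Subspace (erefl 0) SP)); apply=> _ [a [x [/nil -> ->]]].
exact: (lin0 (pure_linl x)).
Qed.

Let M1 l : M 1 (l - pure 1 (teps l)).
Proof.
elim/tens_ind: l => [|a x l Ml].
  by rewrite (lin0 (@teps_linear K D R)) (lin0 (pure_linr _)) subrr; apply: smem0.
rewrite (linD (@teps_linear K D R)) (linD (pure_linr _)) opprD addrACA.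
apply: smemD => //; rewrite teps_pure (linZ (pure_linr _)) -(linZ (pure_linl x)).
rewrite -(linB (pure_linl x)); apply: M_pure; apply/mpow1.
by rewrite linearB linearZ /= rmorph1 mulr1 subrr.
Qed.

Let lP := pull_linear (ahom_linear idR) lT.

Let MS j l : M j l -> M j.+1 (pull idR T l - l).
Proof.
move: l; apply: (M_map (h := fun l => pull idR T l - l)); first by apply: lin_sub.
move=> a x ma; rewrite pull_pure ?idRE //; last exact: ahom_linear.
rewrite -[a in pure a x]mulr1 -tact_pure -(linB (tact_linear a)).
have := M1 (T x); rewrite eT; apply: M_map; first exact: tact_linear.
by move=> b y mb; rewrite tact_pure; apply: M_pure; rewrite -addn1; apply: mpowM.
Qed.

(** The endomorphism differs from the identity by a map which raises the
    filtration M by the powers of the maximal ideal, and this filtration is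
    finite. *)
Lemma pull_unipotent : bijective (pull idR T).
Proof.
have inj : injective (pull idR T).
  move=> l l' ll'; apply/eqP; rewrite -subr_eq0; apply/eqP.
  have d0 : pull idR T (l - l') = 0 by rewrite (linB lP) ll' subrr.
  apply: MN; elim: N => [|j IH]; first exact: M0.
  by have := MS IH; rewrite d0 sub0r => /smemN; rewrite opprK.
have surj y : exists x, pull idR T x = y.
  have H j : exists x, M j (y - pull idR T x).
    elim: j => [|j [x mx]]; first by exists 0; apply: M0.
    exists (x + (y - pull idR T x)); rewrite (linD lP) opprD addrA.
    by rewrite -opprB; apply/smemN/MS.
  have [x mx] := H N; exists x; apply/eqP; rewrite eq_sym -subr_eq0; apply/eqP/MN/mx.
have /choice[h hK] := surj.
by exists h => // l; apply: inj; rewrite hK.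
Qed.

End Unipotent.

(** A base with nilpotent maximal ideal is its own completion. *)
Lemma canon_cev (B : augAlg K) (idB : augHom B B) n (y : ctens D B) :
  (forall b, idB b = b) -> (forall x, mpow B n x -> x = 0) ->
  Defs.canon (cev idB n y) = y.
Proof.
move=> idBE nil; have idn m x : mpow B (maxn m n) x -> idB x = 0.
  by rewrite idBE => /(mpow_le (leq_maxr m n)); apply: nil.
have idn0 x : mpow B n x -> idB x = 0 by rewrite idBE; apply: nil.
apply: ctens_eq => m; rewrite (ctens_le y (leq_maxl m n)) /=.
rewrite -(cev_le idn0 y (leq_maxr m n)) /cev tens_map_comp //;
  [|exact: desc_lin (idn m)|exact: qpi_linear].
congr (tens_map _ _ _); apply/funext; elim/quotI => a /=.
by rewrite qleE ?leq_maxl // descE ?idBE //; apply: idn.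
Qed.

Lemma cpush_canonE (A B : augAlg K) (f : augHom A B) n (l : ctens D A) t :
  (forall x, mpow B n x -> x = 0) -> cpush f l = Defs.canon t <-> cev f n l = t.
Proof.
move=> nil; have [idB idBE] := ahom_id B.
have idn0 x : mpow B n x -> idB x = 0 by rewrite idBE; apply: nil.
have e : cev idB n (cpush f l) = cev f n l by apply: cev_push => // a; rewrite idBE.
have e' (u : tens B D) : cev idB n (Defs.canon u) = u.
  rewrite cev_canon // /tpush (_ : (idB : B -> B) = idfun) ?tens_map_id //.
  by apply/funext => a; rewrite /= idBE.
split=> [lt|lt]; first by rewrite -e lt e'.
by rewrite -lt -e (canon_cev _ idBE).
Qed.

Section CompleteLim.
Variables (A : augAlg K) (B : nat -> augAlg K) (f : forall k, augHom A (B k)).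
Variable q : forall k, augHom (B k.+1) (B k).
Hypotheses (lcA : complete_local A) (pr : presented f q).
Hypothesis fk : forall k x, f k x = 0 <-> mpow A k.+1 x.

Lemma pres_inj a : (forall k, f k a = 0) -> a = 0.
Proof.
move=> a0; have [_ cA _] := lcA.
have [|b [_ bu]] := cA (fun n => 0).
  by move=> n; apply/qpi0; have /qpi0 := qreprK (0 : quot (mpow A n.+1)); apply: mpowS.
rewrite -(bu a) => [|n]; last by apply/qpi0; apply: mpowS; apply/fk.
by apply: bu => n; apply: linear0.
Qed.

Lemma pres_eq a b : (forall k, f k a = f k b) -> a = b.
Proof.
move=> ab; apply/eqP; rewrite -subr_eq0; apply/eqP/pres_inj => k.
by rewrite (linB (ahom_linear (f k))) ab subrr.
Qed.

(** Completeness of A, restated for the tower B. *)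
Lemma pres_lim (z : forall k, B k) : (forall k, q k (z k.+1) = z k) ->
  exists a, forall k, f k a = z k.
Proof.
move=> zq; have ex k := pr_surj pr (z k); pose b k := projT1 (cid (ex k)).
have bE k : f k (b k) = z k := projT2 (cid (ex k)).
have [_ cA _] := lcA.
have bb k : mpow A k.+1 (b k.+1 - b k).
  by apply/fk; rewrite (linB (ahom_linear _)) -(pr_comp pr) !bE zq subrr.
have [n|a [aP _]] := cA (fun n => qpi _ (b n)).
  apply/qpiP/asboolP; rewrite -[qrepr _](subrK (b n.+1)) -addrA; apply: smemD.
    by apply: mpowS; apply/asboolP/qpiE.
  exact/mpowS/bb.
exists a => k; have /qpiP/asboolP/fk := aP k.+1.
rewrite (linB (ahom_linear _)) => /eqP; rewrite subr_eq0 => /eqP ->.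
by rewrite -(pr_comp pr) bE zq.
Qed.

Lemma pres_fin k : fin_dim (B k).
Proof.
have nil := pr_nil pr (k := k).
apply: (fin_dim_surj (desc_lin nil)) (complete_fin lcA k.+1) => b.
by have [a <-] := pr_surj pr b; exists (qpi _ a); rewrite descE.
Qed.

Lemma pres_small_ext k : inhabited (small_ext (q k)).
Proof.
apply: small_ext_exists (pres_fin _) _ _ => [b|a n].
  by have [a <-] := pr_surj pr b; exists (f k.+1 a); apply: (pr_comp pr).
have [a' <-] := pr_surj pr a; have [n' <-] := pr_surj pr n.
rewrite (pr_comp pr) ahomP => /fk mn; apply/eqP; rewrite -subr_eq0; apply/eqP.
rewrite -ahomM -(linZ (ahom_linear _)) -(linB (ahom_linear _)); apply/fk.
rewrite -[aug A a' *: n']mul1r -scalerAr scalerAl -mulrBl; apply: mpowM1 => //.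
by rewrite linearB linearZ /= rmorph1 mulr1 subrr.
Qed.

End CompleteLim.
End BaseMaps.

(** * Every formal deformation is induced *)

Section Existence.
Variables (K : fieldType) (D : lmodType K) (dD : dialgebra D).
Hypothesis HY2fin : fin_dim (HY dD 2).
Variables (T : tower dD) (C : augAlg K) (pi : forall k, augHom C (tw_alg T k)).
Hypothesis limC : is_limit pi.
Local Notation CC := (tw_alg T).
Local Notation p := (tw_proj T).

Lemma tower_presented : presented pi p.
Proof.
split.
- exact: pi_p.
- exact: pi_surj.
- exact: pi_nil.
- exact: ker_pi_mpow.
Qed.

(** C_k (x) D is its own completion, so the projections to it can be taken
    uncompleted. *)
Lemma limit_defP (eta : fdeformation dD C) : is_limit_def pi eta <->
  forall k s x y, pev pi k (eta s x y) = tw_def T k s (pev pi k x) (pev pi k y).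
Proof.
have E k (l : ctens D C) t : cpush (pi k) l = Defs.canon t <-> pev pi k l = t.
  by apply: cpush_canonE; apply: tw_nil.
split=> [H k s x y|H k s l1 l2 x1 x2 /E e1 /E e2].
  by apply/E/H; apply/E.
by apply/E; rewrite H e1 e2.
Qed.

Lemma limit_def_exists : exists eta : fdeformation dD C, is_limit_def pi eta.
Proof.
have [eta etaE] := fdef_limit tower_presented (@tw_push K D dD T).
by exists eta; apply/limit_defP.
Qed.

Variables (eta : fdeformation dD C).
Hypothesis etaE : forall k s x y,
  pev pi k (eta s x y) = tw_def T k s (pev pi k x) (pev pi k y).

Section CompleteBase.
Variables (A : augAlg K) (lam : fdeformation dD A).
Hypothesis lcA : complete_local A.
Variables (B : nat -> augAlg K) (f : forall k, augHom A (B k)).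
Variable q : forall k, augHom (B k.+1) (B k).
Hypotheses (pr : presented f q) (fk : forall k x, f k x = 0 <-> mpow A k.+1 x).
Variable rho : forall k, deformation dD (B k).
Hypothesis rhoE : forall k s x y, pev f k (lam s x y) = rho k s (pev f k x) (pev f k y).

Lemma rho_push k : push_mor (q k) (rho k.+1) (rho k).
Proof.
move=> s u v; have [x <-] := pev_surj pr u; have [y <-] := pev_surj pr v.
by rewrite -rhoE !(pev_compat pr) rhoE.
Qed.

Lemma B0_aug (b : B 0) : aug _ b = 0 -> b = 0.
Proof.
have [a <-] := pr_surj pr b; rewrite ahomP => a0.
by apply/fk/mpow1.
Qed.

(** The kernel of q_k is annihilated by the maximal ideal. The homomorphism
    lifts by the universality of C_{k+1}, and then the morphism of
    deformations lifts after adjusting it. Over C_0, which is the ground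
    field, the homomorphism lifts to the augmentation of C_1. *)
Lemma versal_step k (g : augHom (CC k) (B k)) (S : D -> tens (B k) D) :
  def_mor (tw_def T k) (rho k) g S ->
  exists (g' : augHom (CC k.+1) (B k.+1)) (S' : D -> tens (B k.+1) D),
  [/\ forall a, q k (g' a) = g (p k a), forall x, tpush (q k) (S' x) = S x
    & def_mor (tw_def T k.+1) (rho k.+1) g' S'].
Proof.
move=> mor; have [E] := pres_small_ext lcA pr fk k.
have [v [mu tg]] := tw_tangent T k.
have [g' sq] : exists g' : augHom (CC k.+1) (B k.+1), forall a, q k (g' a) = g (p k a).
  case: k g S mor E v mu tg => [|k] g S mor E v mu tg; last first.
    by apply: (hom_lift E (@rho_push k.+1) mor (twS T (ltn0Sn k))).
  have [g' g'E] := ahom_aug (CC 1) (B 1); exists g' => a; rewrite g'E.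
  have -> : p 0 a = (aug _ a)%:A.
    apply/eqP; rewrite -subr_eq0; apply/eqP/tw0_aug.
    by rewrite linearB linearZ /= rmorph1 mulr1 ahomP subrr.
  by rewrite (linZ (ahom_linear _)) (linZ (ahom_linear g)) !ahom1.
by apply: (mor_lift E (@tw_push K D dD T k) (@rho_push k) mor sq tg).
Qed.

Lemma versal_tower : exists (g : forall k, augHom (CC k) (B k))
    (S : forall k, D -> tens (B k) D),
  [/\ forall k a, q k (g k.+1 a) = g k (p k a),
      forall k x, tpush (q k) (S k.+1 x) = S k x
    & forall k, def_mor (tw_def T k) (rho k) (g k) (S k)].
Proof.
pose X k := {gS : augHom (CC k) (B k) * (D -> tens (B k) D) |
  def_mor (tw_def T k) (rho k) gS.1 gS.2}.
have [x0] : inhabited (X 0).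
  have [g0 g0E] := ahom_aug (CC 0) (B 0).
  pose S0 x : tens (B 0) D := pure 1 x.
  have eS x : teps (S0 x) = x by apply: teps_pure1.
  have lS : linear S0 by apply: pure_linr.
  have mor0 : def_mor (tw_def T 0) (rho 0) g0 S0.
    split=> // s x y; apply: teps_inj B0_aug _.
    by rewrite pull_teps // !def_eps !eS !teps_pure1.
  by split; exists (g0, S0).
have [k [[g S] /= mor]|x [_ xP]] := dep_choice (X := X) (R := fun k (x : X k) (y : X k.+1) =>
   (forall a, q k ((sval y).1 a) = (sval x).1 (p k a)) /\
   (forall u, tpush (q k) ((sval y).2 u) = (sval x).2 u)) x0.
  by have [g' [S' [e e' mor']]] := versal_step mor; exists (exist _ (g', S') mor').
exists (fun k => (sval (x k)).1), (fun k => (sval (x k)).2); split=> k.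
- by have [] := xP k.
- by have [] := xP k.
- exact: svalP (x k).
Qed.

(** The g_k have a limit h. The S_k define, over the identity of the B_k, the
    A-linear automorphisms Th k, whose limit F is bijective; transporting lam
    by F gives the push-out of eta along h. *)
Lemma versal_hom : exists h : augHom C A, induces eta h lam.
Proof.
have [g [S [gq Sq mor]]] := versal_tower.
have lS k : linear (S k) by case: (mor k).
have eS k x : teps (S k x) = x by case: (mor k).
have /choice[h0 h0E] c : exists a, forall k, f k a = g k (pi k c).
  by apply: (pres_lim lcA pr fk) => k; rewrite gq pi_p.
have [||a b|a|h hE] := @augHom_of K C A h0.
- move=> k c d; apply: (pres_eq lcA fk) => j.
  by rewrite (ahom_linear (f j)) !h0E (ahom_linear (pi j)) (ahom_linear (g j)).
- by apply: (pres_eq lcA fk) => j; rewrite h0E !ahom1.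
- by apply: (pres_eq lcA fk) => j; rewrite ahomM !h0E !ahomM.
- by rewrite -(ahomP (f 0)) h0E !ahomP.
have fh k c : f k (h c) = g k (pi k c) by rewrite hE h0E.
exists h.
have exI k := ahom_id (B k); pose idB k := projT1 (cid (exI k)).
have idBE k b : idB k b = b := projT2 (cid (exI k)) b.
pose Th k := pull (idB k) (S k).
have lTh k : linear (Th k) := pull_linear (ahom_linear (idB k)) (lS k).
have Thq k u : tpush (q k) (Th k.+1 u) = Th k (tpush (q k) u).
  by apply: pull_square => // a; rewrite !idBE.
have nilB k x : mpow (B k) k.+1 x -> x = 0.
  move=> /(mpow_surj (pr_surj pr (k := k)))[y my <-]; exact: (pr_nil pr).
have bTh k : bijective (Th k) := pull_unipotent (@nilB k) (idBE k) (lS k) (eS k).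
have /choice[F FE] x : exists y : ctens D A, forall k, pev f k y = Th k (pev f k x).
  by apply: (pev_lim pr) => k; rewrite Thq (pev_compat pr).
have /choice[G GF] y : exists x, F x = y.
  have ex k : exists u, Th k u = pev f k y.
    by have [Ti _ TiK] := bTh k; exists (Ti (pev f k y)).
  pose u k := projT1 (cid (ex k)).
  have uE k : Th k (u k) = pev f k y := projT2 (cid (ex k)).
  have [k|x xE] := pev_lim pr (z := u).
    by apply: (bij_inj (bTh k)); rewrite -Thq !uE (pev_compat pr).
  by exists x; apply: (pev_inj pr) => k; rewrite FE xE uE.
have Finj : injective F.
  move=> x y xy; apply: (pev_inj pr) => k; apply: (bij_inj (bTh k)).
  by rewrite -!FE xy.
have FG x : G (F x) = x by apply: Finj; rewrite GF.
have lp k := @pev_linear K D A B f q pr k.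
have lF : linear F.
  by move=> a x y; apply: (pev_inj pr) => k; rewrite lp !FE lp lTh.
have lG : linear G := lin_inverse lF FG GF.
have Fact a x : F (cact a x) = cact a (F x).
  apply: (pev_inj pr) => k; rewrite FE !(pev_cact pr) FE.
  by rewrite /Th pull_tact ?idBE.
have Gact a x : G (cact a x) = cact a (G x) by apply: Finj; rewrite Fact !GF.
have Feps x : ceps (F x) = ceps x.
  by rewrite -!(pev_ceps pr 0) FE /Th pull_teps.
have Geps x : ceps (G x) = ceps x by rewrite -[in RHS](GF x) Feps.
pose op s x y := G (lam s (F x) (F y)).
have opb s : bilinear_map (op s).
  have [lr ll] := dop_bilinear lam s.
  by split=> x; apply: (lin_comp _ lG); [apply: lin_comp lF (lr _)|apply: lin_comp lF (ll _)].
have opD : dialgebra_axioms op.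
  by move=> x y z; rewrite /op; split; [split| |split]; rewrite !GF;
     case: (dopP lam (F x) (F y) (F z)) => [[e1 e2] e3 [e4 e5]]; congr (G _).
have opact s : act_bilinear (@cact K D A) (Dialgebra opb opD s).
  move=> a x y; rewrite /= /op !Fact -!Gact.
  by split; congr (G _); case: (fdef_bilinear lam s a (F x) (F y)).
have opeps s x y : ceps (Dialgebra opb opD s x y) = dD s (ceps x) (ceps y).
  by rewrite /= /op Geps fdef_eps !Feps.
exists (FDeformation opact opeps); last first.
  exists (lin_pack lG); split.
  - by exists F.
  - exact: Gact.
  - by move=> s x y; rewrite /= /op !GF.
  - exact: Geps.
move=> s a1 a2 l1 l2; rewrite /= /op.
(* F o cpush h is the limit of the semilinear extensions of the S_k over the
   g_k *)
have PE k l : pev f k (F (cpush h l)) = pull (g k) (S k) (pev pi k l).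
  have [gpi gpiE] := ahom_comp (pi k) (g k).
  have e1 : cev (f k) k.+1 (cpush h l) = cev gpi k.+1 l.
    by apply: cev_push => [|a]; [apply: (pr_nil pr)|rewrite gpiE fh].
  have e2 : cev gpi k.+1 l = tpush (g k) (cev (pi k) k.+1 l).
    by apply: cev_comp => //; apply: (pr_nil tower_presented).
  have tid (t : tens (B k) D) : tpush (idB k) t = t.
    rewrite /tpush (_ : (idB k : B k -> B k) = idfun) ?tens_map_id //.
    by apply/funext => a; rewrite /= idBE.
  rewrite FE /pev e1 e2 -/(pev pi k l) /Th.
  rewrite -(pull_square (p := g k) (q := idB k) (g' := g k) (T' := S k)) ?tid //.
apply: Finj; rewrite GF !Fact; apply: (pev_inj pr) => k.
rewrite (fdef_bilinear lam s _ _ _).1 (fdef_bilinear lam s _ _ _).2 !(pev_cact pr).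
by rewrite rhoE !PE -tactM -ahomM etaE (def_morE (mor k)).
Qed.

End CompleteBase.
End Existence.

(** * Uniqueness on bases of square zero *)

Lemma zmod_balance (V : zmodType) (k m m' t t' x x' y y' : V) :
  k + t = m + x + y -> k + t' = m' + x' + y' ->
  m - m' = y' - y - (t' - t) + (x' - x).
Proof.
move=> e e'; have -> : m = k + t - y - x by rewrite e !addrK.
have -> : m' = k + t' - y' - x' by rewrite e' !addrK.
by rewrite !opprD !opprK !addrA [LHS](ACl (7*3*6*2*8*4*(1*5))) /= subrr addr0.
Qed.

Section TangentUnique.
Variables (K : fieldType) (D : lmodType K) (dD : dialgebra D).
Hypothesis HY2fin : fin_dim (HY dD 2).
Variables (T : tower dD) (C : augAlg K) (pi : forall k, augHom C (tw_alg T k)).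
Hypothesis limC : is_limit pi.
Local Notation CC := (tw_alg T).
Local Notation p := (tw_proj T).
Variables (eta : fdeformation dD C).
Hypothesis etaE : forall k s x y,
  pev pi k (eta s x y) = tw_def T k s (pev pi k x) (pev pi k y).
Variables (A : augAlg K).
Hypothesis A2 : forall x, mpow A 2 x -> x = 0.
Variables (xi : A -> K) (lxi : scalar xi) (xi1 : xi 1 = 0).

Lemma xiM a b : xi (a * b) = aug A a * xi b + aug A b * xi a.
Proof. by apply: form_derivation => // y /A2 ->; apply: scal0. Qed.

Variables (idA : augHom A A) (idAE : forall a, idA a = a).

Lemma idA_mpow2 x : mpow A 2 x -> idA x = 0.
Proof. by rewrite idAE; apply: A2. Qed.

Local Notation U := (cev idA 2).
(** The component of z in the direction of the tangent vector xi. *)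
Definition xcomp (z : ctens D A) : D := contract xi (U z).
Local Notation X := xcomp.
Definition ucan (B : augAlg K) (x : D) : ctens D B := Defs.canon (pure 1 x).

Lemma uncomp_inj (z w : ctens D A) : U z = U w -> z = w.
Proof. by move=> zw; rewrite -(canon_cev z idAE A2) zw (canon_cev _ idAE A2). Qed.

Lemma uncomp_canon (t : tens A D) : U (Defs.canon t) = t.
Proof.
rewrite cev_canon; last exact: idA_mpow2.
rewrite /tpush (_ : (idA : A -> A) = idfun) ?tens_map_id //.
by apply/funext => a; rewrite /= idAE.
Qed.

Lemma uncomp_cact a (z : ctens D A) : U (cact a z) = tact a (U z).
Proof. by rewrite (cev_cact idA_mpow2) idAE. Qed.

Lemma uncomp_linear : linear (cev (D := D) idA 2).
Proof. exact: cev_linear idA_mpow2. Qed.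

Lemma xcomp_linear : linear X.
Proof. exact: lin_comp uncomp_linear (contract_linear lxi). Qed.

Lemma xcomp_cact a (z : ctens D A) : X (cact a z) = aug A a *: X z + xi a *: ceps z.
Proof.
rewrite /xcomp uncomp_cact (ceps_cev idA_mpow2 z isT); move: (U z) => t.
apply: (tens_ext (f := fun t : tens A D => contract xi (tact a t))
  (g := fun t => aug A a *: contract xi t + xi a *: teps t)) => [||b x].
- exact: lin_comp (tact_linear a) (contract_linear lxi).
- by apply: lin_add; apply: lin_scale; [apply: contract_linear|apply: teps_linear].
- rewrite tact_pure !contract_pure // teps_pure xiM scalerDl !scalerA.
  by rewrite [aug A b * _]mulrC.
Qed.

Lemma xcomp_ucan x : X (ucan A x) = 0.
Proof. by rewrite /xcomp uncomp_canon contract_pure // xi1 scale0r. Qed.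

Lemma ceps_ucan x : ceps (ucan A x) = x.
Proof. by rewrite (ceps_cev idA_mpow2 _ isT) uncomp_canon teps_pure1. Qed.

Lemma cact1 z : cact 1 z = z :> ctens D A.
Proof. by apply: uncomp_inj; rewrite uncomp_cact tact1. Qed.

Lemma canon_pure a x : Defs.canon (pure a x) = cact a (ucan A x).
Proof. by apply: uncomp_inj; rewrite uncomp_cact !uncomp_canon tact_pure mulr1. Qed.

(** An equivalence is the identity modulo the maximal ideal m, and m^2 = 0, so
    its xi-component is a shift by a function of the fibre. *)
Lemma xcomp_semilinear (Phi : ctens D A -> ctens D A) : linear Phi ->
  (forall a z, Phi (cact a z) = cact a (Phi z)) -> (forall z, ceps (Phi z) = ceps z) ->
  forall z, X (Phi z) = X z + X (Phi (ucan A (ceps z))).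
Proof.
move=> lPhi Pa Pe z; rewrite -(canon_cev z idAE A2); move: (U z) => t.
have lc : linear (@Defs.canon K D A).
  by move=> a u v; apply: uncomp_inj; rewrite uncomp_linear !uncomp_canon.
have lu : linear (ucan A) by apply: lin_comp lc; apply: pure_linr.
have le : linear (@ceps K D A).
  by move=> a u v; rewrite !(ceps_cev idA_mpow2 _ isT) uncomp_linear teps_linear.
apply: (tens_ext (f := fun t => X (Phi (Defs.canon t)))
  (g := fun t => X (Defs.canon t) + X (Phi (ucan A (ceps (Defs.canon t)))))) => [||a x].
- exact: lin_comp lc (lin_comp lPhi xcomp_linear).
- apply: lin_add; first exact: lin_comp lc xcomp_linear.
  exact: lin_comp (lin_comp lc (lin_comp le lu)) (lin_comp lPhi xcomp_linear).
- rewrite canon_pure Pa !xcomp_cact xcomp_ucan scaler0 add0r Pe !ceps_ucan.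
  rewrite (ceps_cev idA_mpow2 _ isT) uncomp_cact uncomp_canon tact_pure mulr1 teps_pure.
  by rewrite (linZ lu) (linZ lPhi) (linZ xcomp_linear) addrC.
Qed.

(** As m^2 = 0, only one of the two arguments can contribute its first order
    part. *)
Lemma xcomp_def (lam : fdeformation dD A) s z w :
  X (lam s z w) = X (lam s (ucan A (ceps z)) (ucan A (ceps w))) +
    dD s (X z) (ceps w) + dD s (ceps z) (X w).
Proof.
have lc : linear (@Defs.canon K D A).
  by move=> a u v; apply: uncomp_inj; rewrite uncomp_linear !uncomp_canon.
have lu : linear (ucan A) by apply: lin_comp lc; apply: pure_linr.
have le : linear (@ceps K D A).
  by move=> a u v; rewrite !(ceps_cev idA_mpow2 _ isT) uncomp_linear teps_linear.
have [lr ll] := dop_bilinear lam s; have [dr dl] := dop_bilinear dD s.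
rewrite -(canon_cev z idAE A2) -(canon_cev w idAE A2); move: (U z) (U w) => t t'.
have lce := lin_comp lc le; have lcX := lin_comp lc xcomp_linear.
apply: (bilinear_ext (F := fun t t' => X (lam s (Defs.canon t) (Defs.canon t')))
  (G := fun t t' => X (lam s (ucan A (ceps (Defs.canon t))) (ucan A (ceps (Defs.canon t')))) +
    dD s (X (Defs.canon t)) (ceps (Defs.canon t')) +
    dD s (ceps (Defs.canon t)) (X (Defs.canon t')))) => [||a x b y].
- by split=> u; [exact: (lin_comp (lin_comp lc (lr _)) xcomp_linear)|
    exact: (lin_comp (lin_comp lc (ll _)) xcomp_linear)].
- split=> u; (apply: lin_add; first apply: lin_add).
  + exact: (lin_comp (lin_comp (lin_comp lce lu) (lr _)) xcomp_linear).
  + exact: lin_comp lce (dr _).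
  + exact: lin_comp lcX (dr _).
  + exact: (lin_comp (lin_comp (lin_comp lce lu) (ll _)) xcomp_linear).
  + exact: lin_comp lcX (dl _).
  + exact: lin_comp lce (dl _).
- have ce (c : A) (u : D) : ceps (Defs.canon (pure c u)) = aug A c *: u.
    rewrite -[u in RHS](ceps_ucan u) (ceps_cev idA_mpow2 _ isT) (ceps_cev idA_mpow2 _ isT).
    by rewrite canon_pure uncomp_cact teps_tact.
  have cX (c : A) (u : D) : X (Defs.canon (pure c u)) = xi c *: u.
    by rewrite canon_pure xcomp_cact xcomp_ucan ceps_ucan scaler0 add0r.
  rewrite !ce !cX !canon_pure.
  rewrite (fdef_bilinear lam s _ _ _).1 (fdef_bilinear lam s _ _ _).2 !xcomp_cact.
  rewrite fdef_eps !ceps_ucan (ceps_cev idA_mpow2 _ isT) uncomp_cact teps_tact.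
  rewrite -(ceps_cev idA_mpow2 _ isT).
  rewrite fdef_eps !ceps_ucan !(linZ lu) (linZ (ll _)) (linZ (lr _)) !(linZ xcomp_linear).
  rewrite !(linZ (dl _)) !(linZ (dr _)) !scalerDr !scalerA.
  exact: addrAC.
Qed.

Variables (v : CC 1 -> dual (HY dD 2)) (mu : HY dD 2 -> sub (ZY dD 2)).
Hypotheses (tg : tangent (tw_def T 1) v mu) (vb : bijective (fun a => (aug (CC 1) a, v a))).

(** The form xi o h vanishes at 1 and on m_C^2, which contains the kernel of
    pi_1, so it descends to C_1; forms on C_1 vanishing at 1 are elements of
    HY^2 by reflexivity. *)
Lemma tangent_class (h : augHom C A) :
  exists alpha, forall c, xi (h c) = val (v (pi 1 c)) alpha.
Proof.
have [lv vM _ _ _] := tg.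
have lxh : scalar (fun c => xi (h c)) := lin_comp (V := A) (W := K^o) (ahom_linear h) lxi.
have [|chi lchi chiE] := lin_factor (W := K^o) (ahom_linear (pi 1)) lxh (pi_surj limC (k := 1)).
  move=> c c0; have : mpow C 2 c.
    apply: (mpow_limit HY2fin limC) => -[|k]; last exact: pi1_ker.
    by rewrite -(pi_p limC) c0 (lin0 (ahom_linear _)); apply: smem0.
  by move/(mpow_hom h)/A2 ->; apply: scal0.
have [inv invK Kinv] := vb.
have linv : linear (inv : (K^o * dual (HY dD 2))%type -> CC 1).
  apply: (@lin_inverse K (CC 1) (K^o * dual (HY dD 2))%type
    (fun a => (aug (CC 1) a, v a))) invK Kinv.
  by move=> a x y; congr pair; [rewrite linearP|rewrite lv].
have [|alpha aE] := dual_reflexive (chi := fun m => chi (inv (0, m))) HY2fin.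
  move=> a m m'; rewrite -[RHS]lchi -linv; congr (chi (inv _)).
  by congr pair; rewrite /= scaler0 addr0.
have v1 := derivation1 vM.
exists alpha => c; rewrite -chiE -aE.
have -> : inv (0, v (pi 1 c)) = pi 1 c - (aug _ (pi 1 c))%:A.
  apply: (can_inj invK); rewrite Kinv linearB linearZ /= rmorph1 mulr1 subrr.
  by rewrite (linB lv) (linZ lv) v1 scaler0 subr0.
have chi1 : chi 1 = 0 by rewrite -(ahom1 (pi 1)) chiE ahom1 xi1.
by rewrite (linB lchi) (linZ lchi) chi1 scaler0 subr0.
Qed.

(** The xi-component of the push-out of eta is the cocycle mu alpha, and the
    equivalence with lam changes it by the coboundary of th. So the class
    alpha can be read off from lam. *)
Lemma induced_class (lam : fdeformation dD A) (h : augHom C A) alpha :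
  (forall c, xi (h c) = val (v (pi 1 c)) alpha) -> induces eta h lam ->
  exists th : D -> D, linear th /\ forall s x y,
    X (lam s (ucan A x) (ucan A y)) + th (dD s x y) =
    val (mu alpha) (ytree s) [tuple x; y] + dD s (th x) y + dD s x (th y).
Proof.
move=> xih [lam' po [Phi [_ Pa Pm Pe]]]; have [lv _ _ _ vmu] := tg.
have lc : linear (@Defs.canon K D A).
  by move=> a u w; apply: uncomp_inj; rewrite uncomp_linear !uncomp_canon.
have lu : linear (ucan A) by apply: lin_comp lc; apply: pure_linr.
exists (fun x => X (Phi (ucan A x))); split.
  exact: lin_comp lu (lin_comp (linear_map Phi) xcomp_linear).
move=> s x y; have := xcomp_semilinear (linear_map Phi) Pa Pe (lam s (ucan A x) (ucan A y)).
rewrite fdef_eps !ceps_ucan => <-; rewrite Pm xcomp_def !Pe !ceps_ucan.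
congr (_ + _ + _).
have up u : ucan A u = cact 1 (cpush h (ucan C u)).
  rewrite cact1; apply: uncomp_inj; rewrite uncomp_canon.
  have hn z : mpow C 2 z -> h z = 0 by move/(mpow_hom h)/A2.
  rewrite (cev_push idA_mpow2 (h := h)) => [|a]; last by rewrite idAE.
  by rewrite (cev_canon hn) tpush_pure ahom1.
rewrite (up x) (up y) po mulr1 cact1 -vmu /xcomp.
have hn z : mpow C 2 z -> h z = 0 by move/(mpow_hom h)/A2.
rewrite (cev_push idA_mpow2 (h := h)) => [|a]; last by rewrite idAE.
have pn : forall z, mpow C 2 z -> pi 1 z = 0 by apply: pi_nil.
have pc u : pure 1 u = pev pi 1 (ucan C u) :> tens (CC 1) D.
  by rewrite (pev_canon (tower_presented HY2fin limC)) tpush_pure ahom1.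
rewrite (pc x) (pc y) -etaE /pev /cev.
rewrite !contract_map; try exact: desc_lin; try exact: lxi; last first.
  by move=> k a b; rewrite lv dual_evalP.
congr (contract _ _); apply/funext; elim/quotI => c /=.
by rewrite !descE // xih.
Qed.

(** Both classes are that of the xi-component of lam. *)
Lemma induced_class_unique (lam : fdeformation dD A) (h h' : augHom C A) :
  induces eta h lam -> induces eta h' lam -> forall c, xi (h c) = xi (h' c).
Proof.
move=> ih ih' c; have [_ _ lmu muK _] := tg.
have [al alE] := tangent_class h; have [al' al'E] := tangent_class h'.
have [th [lth thE]] := induced_class alE ih.
have [th' [lth' th'E]] := induced_class al'E ih'.
rewrite alE al'E; congr (val _ _); apply/eqP; rewrite -subr_eq0 -(muK al) -(muK al').
rewrite -(linB (linear_map (HYclass dD 2))); apply/eqP/HYclass0.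
pose t : cochain D 1 := fun _ a => th' (tnth a ord0) - th (tnth a ord0).
exists t.
  move=> y a j k x z; rewrite /t !tnth_mktuple (ord1 j) eqxx.
  exact: (lin_sub lth' lth).
apply/funext; elim/Y2_ind => s; apply/funext => a.
have tE u : t one_tree [tuple u] = th' u - th u by [].
rewrite delta1E !tE.
have [dr dl] := dop_bilinear dD s.
have aE : a = [tuple tnth a ord0; tnth a ord_max].
  apply: eq_from_tnth => -[[|[|//]] j2]; rewrite [RHS](tnth_nth 0) /=;
    by congr (tnth a _); apply: val_inj.
have e := thE s (tnth a ord0) (tnth a ord_max).
have e' := th'E s (tnth a ord0) (tnth a ord_max).
rewrite -aE in e e'.
have -> : val (mu al - mu al') (ytree s) a =
    val (mu al) (ytree s) a - val (mu al') (ytree s) a by rewrite raddfB.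
rewrite (linB (dr _)) (linB (dl _)).
move: e e'; set k := X _; set m := val (mu al) _ _; set m' := val (mu al') _ _.
exact: zmod_balance.
Qed.

End TangentUnique.


(** * Miniversality *)

Theorem theorem8p3 (K : fieldType) (charK0 : [pchar K]%R =i pred0)
    (D : lmodType K) (dD : dialgebra D) (HY2fin : fin_dim (HY dD 2))
    (T : tower dD) (C : augAlg K) (pi : forall k, augHom C (tw_alg T k))
    (limC : is_limit pi) :
  (exists eta : fdeformation dD C, is_limit_def pi eta) /\
  (forall eta : fdeformation dD C, is_limit_def pi eta -> miniversal eta).
Proof.
split; first exact: limit_def_exists.
move=> eta etaL; have etaE := (limit_defP pi eta).1 etaL.
split; first exact: (C_complete_local HY2fin limC).
move=> A lcA lam; split.
  have [B [f [q [pr fk]]]] := complete_presented lcA.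
  have [rho rhoE] := fdef_descend pr lam lcA (fun k x => (fk k x).1).
  exact: (versal_hom HY2fin limC etaE lcA pr fk rhoE).
move=> A0 h h' ih ih' c; apply/eqP; rewrite -subr_eq0; apply/eqP.
have A2 x : mpow A 2 x -> x = 0.
  apply: (mpow_ind (P := fun x => x = 0)) => // [k u v -> ->|a b a0 /mpow1 b0].
    by rewrite scaler0 addr0.
  exact: A0.
have fA : fin_dim A.
  apply: (fin_dim_inj (@qpi_linear K A (mpow A 2)) _ (complete_fin lcA 2)).
  by move=> x y /qpiP/asboolP/A2/eqP; rewrite subr_eq0 => /eqP.
have d0 : aug A (h c - h' c) = 0 by rewrite linearB /= !ahomP subrr.
apply: contrapT => dn.
have W0 : exists k : K, 0 = k%:A :> A by exists 0; rewrite scale0r.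
have WP (k : K) (u v : A) : (exists a : K, u = a%:A) -> (exists a : K, v = a%:A) ->
    exists a : K, k *: u + v = a%:A.
  by move=> [a ->] [b ->]; exists (k * a + b); rewrite scalerDl scalerA.
have [|xi lxi [xid xi0]] := fin_dim_sep (S := Subspace W0 WP) (x := h c - h' c) fA.
  move=> [k kE]; apply: dn; rewrite kE.
  move: d0; rewrite kE linearZ /= rmorph1 mulr1 => ->; exact: scale0r.
have xi1 : xi 1 = 0 by apply: xi0; exists 1; rewrite scale1r.
have [idA idAE] := ahom_id A.
have [v [mu [tg vb]]] := tw1_tangent T.
have := induced_class_unique HY2fin limC etaE A2 lxi xi1 idAE tg vb ih ih' c.
by move=> e; move/eqP: xid; rewrite (scalB lxi) e subrr eq_sym oner_eq0.
Qed.
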